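(* Let $n\ge1$ and let $Y=\{Y_m\}_{m=1}^n$ be a square-integrable martingale difference sequence with $s_n>0$. (i) For any N-function $\psi\preccurlyeq x^3$ such that $x\mapsto\psi(\sqrt x)$ is convex, $$\mathcal W_2(X_n,\mathcal N)\le C\Big(L_\psi+\|V_n^2-1\|_1^{1/2}\Big),$$ where $C$ is a universal constant. (ii) For any N-function $\psi\succcurlyeq x^3$, $$\mathcal W_2(X_n,\mathcal N)\le C_{\psi(1)}\Big(L_\psi+\frac{\|Y\|_\psi}{s_n}\left[n\,g^{-1}\big(\psi^{-1}(n)^2\big)\right]^{1/4}+\|V_n^2-1\|_1^{1/2}\Big),$$ where $g(x)=\psi(x)/x$, $g^{-1}$ is the inverse function of $g$, and the constant $C_{\psi(1)}$ depends only on $\psi(1)$. As consequences, for a universal constant $C$ and all $p\in(2,\infty)$, $$\mathcal W_2(X_n,\mathcal N)\le C\Big(L_p+\|V_n^2-1\|_1^{1/2}\Big)\quad\text{when }p\in(2,3],$$ $$\mathcal W_2(X_n,\mathcal N)\le C\Big(n^{1/4+1/(2p^2-2p)}s_n^{-1}\|Y\|_p+\|V_n^2-1\|_1^{1/2}\Big)\quad\text{when }p>3.$$ In particular (taking $p\to\infty$), $$\mathcal W_2(X_n,\mathcal N)\le C\Big(\frac{n^{1/4}}{s_n}\|Y\|_\infty+\|V_n^2-1\|_1^{1/2}\Big).$$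
   Context: Martingale setting: $Y=\{Y_m\}_{m=1}^n$ is a square-integrable martingale difference sequence with respect to $\sigma$-fields $\{\mathcal F_m\}_{m=0}^n$, where $\mathcal F_0$ is trivial. Put $s_n^2=\sum_{i=1}^nE[Y_i^2]$, $\sigma_i^2(Y)=E[Y_i^2\mid\mathcal F_{i-1}]$, $V_n^2=\frac1{s_n^2}\sum_{i=1}^n\sigma_i^2(Y)$, $X_n=\frac1{s_n}\sum_{i=1}^nY_i$. $\mathcal N$ denotes a standard normal $N(0,1)$ random variable. For a random variable $U$ and $r>0$, $\|U\|_r=E[|U|^r]^{1/r}$, and $\|U\|_\infty$ is the essential supremum of $|U|$. The Wasserstein distance of order $r\ge1$ is $\mathcal W_r(\mu,\nu)=\inf\{\|U-V\|_r:U\sim\mu,V\sim\nu\}$; random variables are used as synonyms of their distributions. An N-function is a convex $\psi:[0,\infty)\to[0,\infty)$ with $\lim_{x\to0}\psi(x)/x=0$, $\lim_{x\to\infty}\psi(x)/x=\infty$ and $\psi(x)>0$ for $x>0$ (as usual $\psi(0)=0$, so $\psi$ is an increasing bijection of $[0,\infty)$ with inverse $\psi^{-1}$). For functions $\psi_1,\psi_2:[0,\infty)\to[0,\infty)$, $\psi_1\preccurlyeq\psi_2$ (equivalently $\psi_2\succcurlyeq\psi_1$) means $\psi_2(x)/\psi_1(x)$ is non-decreasing on $(0,\infty)$. Here $x^p$ denotes the function $x\mapsto x^p$. Norms of the sequence: $\|Y\|_\psi=\inf\{c>0:\frac1n\sum_{i=1}^nE[\psi(|Y_i|/c)]\le1\}$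 (possibly $+\infty$, in which case the bound is trivial); $\|Y\|_p=\big(\frac1n\sum_{i=1}^nE|Y_i|^p\big)^{1/p}$; $\|Y\|_\infty=\max_{1\le i\le n}\|Y_i\|_\infty$. Lyapunov-type coefficients: $$L_\psi=\frac1{s_n}\|Y\|_\psi\,\psi^{-1}(n),\qquad L_p=\frac1{s_n}\Big(\sum_{i=1}^nE|Y_i|^p\Big)^{1/p}.$$ *)

(* Defs.v *)
From HB Require Import structures.
From mathcomp Require Import all_boot all_order all_algebra.
From mathcomp Require Import all_classical all_reals all_analysis.
From mathcomp Require Import measurable_realfun.

Set Implicit Arguments.
Unset Strict Implicit.
Unset Printing Implicit Defensive.
Import Order.TTheory GRing.Theory Num.Theory.
Import numFieldNormedType.Exports.

Local Open Scope classical_set_scope.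
Local Open Scope ring_scope.

Section N_functions.
Context {R : realType}.

(* Functions on [0, +oo[ are represented by total functions on R whose values at
   negative arguments are irrelevant. *)
Definition N_function (psi : R -> R) : Prop :=
  [/\ convex_function (`[0, +oo[ : set R^o) psi,
      psi 0 = 0,
      (forall x, 0 < x -> 0 < psi x),
      psi x / x @[x --> 0^'+] --> 0 &
      psi x / x @[x --> +oo] --> +oo].

Definition prec (psi1 psi2 : R -> R) : Prop :=
  {in `]0, +oo[ &, {homo (fun x => psi2 x / psi1 x) : x y / x <= y}}.

(* The inverse of a bijection of [0, +oo[ onto itself. Since x / 0 = 0, the
   function x |-> psi x / x takes at 0 its limit there when [psi] is an
   N-function. *)
Definition ge0_inv (f : R -> R) : R -> R := pinv (`[0, +oo[ : set R) f.

End N_functions.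

Section wasserstein.
Local Open Scope ereal_scope.
Context {R : realType}.

(* Laws are compared on Borel sets only: a measure takes arbitrary values on
   non-measurable sets. The infimum ranges over all probability spaces. *)
Definition has_law d (T : measurableType d) (P : probability T R)
    (U : {RV P >-> R}) (mu : set R -> \bar R) : Prop :=
  forall A, measurable A -> distribution P U A = mu A.

Definition wasserstein (r : R) (mu nu : set R -> \bar R) : \bar R :=
  ereal_inf [set w | exists (d : measure_display) (T : measurableType d)
      (P : probability T R) (U V : {RV P >-> R}),
    [/\ has_law U mu, has_law V nu & w = 'N[P]_r%:E[EFin \o (U \- V)]%R]].

End wasserstein.

Section martingale_difference.
Context {d : measure_display} {T : measurableType d} {R : realType}.
Variable P : probability T R.

(* [Z] is a version of E[X | G]; its G-measurability says that the sigma-algebra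
   generated by [Z] is included in [G]. *)
Definition is_cond_exp (G : set (set T)) (X Z : T -> R) : Prop :=
  [/\ X \in Lfun P 1%E, Z \in Lfun P 1%E, g_sigma_algebra_preimage Z `<=` G &
      forall A, G A ->
        (\int[P]_(w in A) (Z w)%:E = \int[P]_(w in A) (X w)%:E)%E].

Definition is_filtration (n : nat) (F : nat -> set (set T)) : Prop :=
  (forall i, (i <= n)%N -> sigma_algebra setT (F i) /\ F i `<=` measurable) /\
  (forall i j, (i <= j <= n)%N -> F i `<=` F j).

(* Only Y_1, ..., Y_n and F_0, ..., F_n matter. *)
Definition martingale_difference (n : nat) (F : nat -> set (set T))
    (Y : nat -> {RV P >-> R}) : Prop :=
  [/\ is_filtration n F,
      F 0%N = [set set0; setT],
      forall i, (1 <= i <= n)%N -> g_sigma_algebra_preimage (Y i) `<=` F i &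
      forall i, (1 <= i <= n)%N -> is_cond_exp (F i.-1) (Y i) (cst 0)].

Definition square_integrable (n : nat) (Y : nat -> {RV P >-> R}) : Prop :=
  forall i, (1 <= i <= n)%N -> (Y i : T -> R) \in Lfun P 2%:E.

Variables (n : nat) (Y : nat -> {RV P >-> R}).

Definition std_sum : R :=
  Num.sqrt (fine (\sum_(1 <= i < n.+1) 'E_P[fun w => (Y i w ^+ 2)%R])%E).

Definition normalized_sum : {RV P >-> R} :=
  std_sum^-1 \o* (\sum_(1 <= i < n.+1) Y i).

(* [sigma2 i] stands for a version of E[Y_i^2 | F_(i-1)]. *)
Definition normalized_cond_var (sigma2 : nat -> T -> R) (w : T) : R :=
  (std_sum ^+ 2)^-1 * \sum_(1 <= i < n.+1) sigma2 i w.

Local Open Scope ereal_scope.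

Definition orlicz_norm (psi : R -> R) : \bar R :=
  ereal_inf [set c%:E | c in [set c : R | (0 < c)%R /\
    (n%:R^-1)%:E * \sum_(1 <= i < n.+1) 'E_P[fun w => psi (`|Y i w| / c)%R]
      <= 1]].

Definition seq_norm (p : R) : \bar R :=
  ((n%:R^-1)%:E *
    \sum_(1 <= i < n.+1) 'E_P[fun w => (`|Y i w| `^ p)%R]) `^ p^-1.

Definition seq_norm_oo : \bar R :=
  \big[maxe/0]_(1 <= i < n.+1) 'N[P]_+oo[EFin \o Y i].

Definition lyapunov_orlicz (psi : R -> R) : \bar R :=
  (std_sum^-1)%:E * orlicz_norm psi * (ge0_inv psi n%:R)%:E.

Definition lyapunov (p : R) : \bar R :=
  (std_sum^-1)%:E *
  (\sum_(1 <= i < n.+1) 'E_P[fun w => (`|Y i w| `^ p)%R]) `^ p^-1.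

End martingale_difference.

(* Main.v *)
(* For X and Z with comonotone coupling (U, V) there is an f with 1-Lipschitz derivative
   such that (U - V)^2 <= 4 (f(U) - f(V)), whence W_2(X, Z)^2 <= 4 (E f(X) - E f(Z)) for
   this f. With u(t, x) = E f(x + sqrt(t) N), N standard normal, the difference
   E f(X_n) - E f(N) is followed along u(t_k, S_k), where S_k are the partial sums
   and t_k = kappa^2 + (1 - V_k^2)_+ is the remaining conditional variance, a
   predictable clock. Gaussian smoothing bounds the error of a step by
   E[Y^2 min(1, |Y| / sqrt(t))], and the mismatch of the clocks costs E|V_n^2 - 1|.
   After truncating Y at a level that depends on sqrt(t), the truncated parts are
   summed through (t_k - t_{k+1}) / sqrt(t_k) <= 2 (sqrt(t_k) - sqrt(t_{k+1})), which
   telescopes, and the excess is absorbed by E[psi(|Y| / c)]. The power functions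
   give the consequences, letting p = n + 3 for the supremum norm. *)
Require Import Defs.
From HB Require Import structures.
From mathcomp Require Import all_boot all_order all_algebra.
From mathcomp Require Import all_classical all_reals all_analysis.
From mathcomp Require Import measurable_realfun ess_sup_inf.
From mathcomp Require Import ring lra.

Set Implicit Arguments.
Unset Strict Implicit.
Unset Printing Implicit Defensive.
Import Order.TTheory GRing.Theory Num.Theory.
Import numFieldNormedType.Exports.

Local Open Scope classical_set_scope.
Local Open Scope ring_scope.

(** The test function produced by the coupling depends on the two laws, so every estimate must be
    uniform over all functions with a 1-Lipschitz derivative. Such functions have no third
    derivative: regularity comes from the Gaussian alone, at scale [sqrt t], and degenerates as [t]
    tends to 0. This is why the clock never goes below [kappa ^+ 2]. The price is [kappa] in W_2, so
    [kappa] is taken to be [c * x / s] with [psi x = n] and [c] admissible for the Orlicz norm; the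
    infimum over [c] turns it into L_psi. For [psi] between square and cube this choice already
    bounds the whole Lindeberg sum by [kappa ^+ 2], without truncation. For faster [psi] no single
    level will do: a low level leaves too much excess when [t] is small, a high one is too expensive
    when [t] is of order 1. The level therefore decreases through [x], [m], 1, in units of [c / s],
    as [sqrt t] grows, where [psi m = m * x ^+ 2]; the fourth-root term is the cost of the middle
    level. *)

Local Notation rint mu f := (integrable mu setT (EFin \o f)).

(** * Integrability of real-valued functions *)

Section real_integral.
Context d (T : measurableType d) (R : realType).
Variable mu : {measure set T -> \bar R}.
Implicit Types f g : T -> R.

Lemma rint_meas f : rint mu f -> measurable_fun setT f.
Proof. by move=> /measurable_int/measurable_EFinP. Qed.

Lemma rintD f g : rint mu f -> rint mu g -> rint mu (fun x => f x + g x).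
Proof. by move=> hf hg; have := integrableD measurableT hf hg. Qed.

Lemma rintN f : rint mu f -> rint mu (fun x => - f x).
Proof. by move=> hf; have := integrableN hf. Qed.

Lemma rintB f g : rint mu f -> rint mu g -> rint mu (fun x => f x - g x).
Proof. by move=> hf hg; apply: rintD => //; exact: rintN. Qed.

Lemma rintZl (c : R) f : rint mu f -> rint mu (fun x => c * f x).
Proof. by move=> hf; have := integrableZl measurableT c hf. Qed.

Lemma rintZr (c : R) f : rint mu f -> rint mu (fun x => f x * c).
Proof. by move=> hf; have := integrableZr measurableT c hf. Qed.

Lemma rint_norm f : rint mu f -> rint mu (fun x => `|f x|).
Proof. by move=> hf; have := integrable_norm hf. Qed.

Lemma rint_eq f g : f =1 g -> rint mu f -> rint mu g.
Proof. by move=> fg; rewrite (_ : f = g)//; exact/funext. Qed.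

Lemma rint_le g f : measurable_fun setT f -> (forall x, `|f x| <= g x) ->
  rint mu g -> rint mu f.
Proof.
move=> mf fg ig; apply: (le_integrable measurableT _ _ ig).
  exact/measurable_EFinP.
move=> x _ /=; rewrite lee_fin (le_trans (fg x))// ler_norm//.
Qed.

Lemma rint_sum (I : Type) (s : seq I) (P : pred I) (F : I -> T -> R) :
  (forall i, P i -> rint mu (F i)) -> rint mu (fun x => \sum_(i <- s | P i) F i x).
Proof.
move=> h; elim: s => [|i s ih].
  apply: (@rint_eq (fun=> 0)); last exact: integrable0.
  by move=> x; rewrite big_nil.
apply: (@rint_eq (fun x => (if P i then F i x else 0) + \sum_(i <- s | P i) F i x)).
  by move=> x; rewrite big_cons; case: ifP => //; rewrite add0r.
apply: rintD => //; case: (boolP (P i)) => [/h//|_].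
exact: integrable0.
Qed.

Lemma rint_mul f g : measurable_fun setT f -> measurable_fun setT g ->
  rint mu (fun x => f x ^+ 2) -> rint mu (fun x => g x ^+ 2) ->
  rint mu (fun x => f x * g x).
Proof.
move=> mf mg f2 g2; apply: (@rint_le (fun x => f x ^+ 2 + g x ^+ 2)).
- exact: measurable_funM.
- move=> x; rewrite normrM -[f x ^+ 2]real_normK ?num_real//.
  rewrite -[g x ^+ 2]real_normK ?num_real//.
  have := sqr_ge0 (`|f x| - `|g x|); nra.
- exact: rintD.
Qed.

Lemma Rintegral_sum (I : Type) (s : seq I) (P : pred I) (F : I -> T -> R) :
  (forall i, P i -> rint mu (F i)) ->
  Rintegral mu setT (fun x => \sum_(i <- s | P i) F i x) =
  \sum_(i <- s | P i) Rintegral mu setT (F i).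
Proof.
move=> h; elim: s => [|i s ih].
  rewrite big_nil (_ : (fun x => _) = cst 0); first by rewrite /Rintegral integral0.
  by apply/funext => x /=; rewrite big_nil.
rewrite big_cons -ih; case: ifPn => [Pi|nPi].
  rewrite -RintegralD//; [|exact: h|exact: rint_sum].
  by apply: eq_Rintegral => x _; rewrite big_cons Pi.
by apply: eq_Rintegral => x _; rewrite big_cons (negbTE nPi).
Qed.

Lemma EFin_Rintegral f : rint mu f ->
  ((Rintegral mu setT f)%:E = \int[mu]_x (f x)%:E)%E.
Proof. by move=> hf; rewrite /Rintegral fineK//; exact: integrable_fin_num. Qed.

Lemma le_Rint f g : rint mu f -> rint mu g -> (forall x, f x <= g x) ->
  Rintegral mu setT f <= Rintegral mu setT g.
Proof. by move=> hf hg fg; apply: le_Rintegral => // x _; exact: fg. Qed.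

End real_integral.

Section real_expectation.
Context d (T : measurableType d) (R : realType).
Variable P : probability T R.
Implicit Types f g : T -> R.

Lemma rint_cst (c : R) : rint P (fun=> c).
Proof.
apply/integrableP; split; first exact/measurable_EFinP.
by rewrite integral_cst//= probability_setT mule1 ltry.
Qed.

Lemma Rintegral_prob_cst (c : R) : Rintegral P setT (fun=> c) = c.
Proof. by rewrite /Rintegral integral_cst//= probability_setT mule1. Qed.

Lemma rint_bounded (c : R) f : measurable_fun setT f -> (forall x, `|f x| <= c) ->
  rint P f.
Proof. by move=> mf fc; apply: rint_le (rint_cst c). Qed.

Lemma rint_sqr f : measurable_fun setT f -> rint P (fun x => f x ^+ 2) -> rint P f.
Proof.
move=> mf hf; apply: (@rint_le _ _ _ P (fun x => 1 + f x ^+ 2)) => //.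
  by move=> x; rewrite -[f x ^+ 2]real_normK ?num_real//; nra.
by apply: rintD => //; exact: rint_cst.
Qed.

Lemma rint_sqrD f g : measurable_fun setT f -> measurable_fun setT g ->
  rint P (fun x => f x ^+ 2) -> rint P (fun x => g x ^+ 2) ->
  rint P (fun x => (f x + g x) ^+ 2).
Proof.
move=> mf mg f2 g2; apply: (@rint_eq _ _ _ P (fun x => f x ^+ 2 + 2 * (f x * g x) + g x ^+ 2)).
  by move=> x; ring.
by do 2!apply: rintD => //; apply: rintZl; exact: rint_mul.
Qed.

Lemma rint_sqrZ (c : R) f : rint P (fun x => f x ^+ 2) ->
  rint P (fun x => (c * f x) ^+ 2).
Proof.
move=> f2; apply: (@rint_eq _ _ _ P (fun x => c ^+ 2 * f x ^+ 2)).
  by move=> x; rewrite exprMn.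
exact: rintZl.
Qed.

Lemma rint_sqr_sum (I : Type) (s : seq I) (Q : pred I) (F : I -> T -> R) :
  (forall i, Q i -> measurable_fun setT (F i)) ->
  (forall i, Q i -> rint P (fun x => F i x ^+ 2)) ->
  rint P (fun x => (\sum_(i <- s | Q i) F i x) ^+ 2).
Proof.
move=> mF h; elim: s => [|i s ih].
  apply: (@rint_eq _ _ _ P (fun=> 0)); last exact: rint_cst.
  by move=> x; rewrite big_nil expr0n.
case: (boolP (Q i)) => Qi; last first.
  by apply: rint_eq ih => x; rewrite big_cons (negbTE Qi).
apply: (@rint_eq _ _ _ P (fun x => (F i x + \sum_(i <- s | Q i) F i x) ^+ 2)).
  by move=> x; rewrite big_cons Qi.
apply: rint_sqrD => //; [exact: mF| |exact: h].
elim: s {ih} => [|j s ih].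
  by rewrite (_ : (fun x => _) = cst 0)//; apply/funext => x; rewrite big_nil.
rewrite (_ : (fun x => _) = (fun x => (if Q j then F j x else 0) + \sum_(i0 <- s | Q i0) F i0 x)).
  apply: measurable_funD => //; case: (boolP (Q j)) => [/mF//|_]; exact: measurable_cst.
by apply/funext => x; rewrite big_cons; case: ifPn => // _; rewrite add0r.
Qed.

End real_expectation.

(** * Quantile coupling and smooth test functions *)

Section quantile.
Context d (T : measurableType d) (R : realType) (P : probability T R).
Variable X : {RV P >-> R}.

Let F x := fine (cdf X x).
Let FE x : ((F x)%:E = cdf X x)%E.
Proof. by rewrite /F fineK// fin_num_measure. Qed.

(** Generalised inverse of the distribution function. The value 0 outside []0, 1[] is the same for
    all variables, so that inequalities between two quantile functions are trivial there. *)
Definition quantile (u : R) : R :=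
  if (0 < u) && (u < 1) then inf [set x | u <= F x] else 0.

Let F_nd x y : x <= y -> F x <= F y.
Proof. by move=> xy; rewrite -lee_fin !FE; exact: cdf_nondecreasing. Qed.

Let has_infF (u : R) : 0 < u < 1 -> has_inf [set x | u <= F x].
Proof.
move=> /andP[u0 u1]; split.
  have /cvgr_gt/(_ _ u1)[M [_ hM]] : fine \o cdf X @ +oo --> (1:R).
    exact/fine_cvg/cvg_cdfy1.
  by exists (M + 1); rewrite /= ltW//; apply: (hM (M + 1)); rewrite ltrDl.
have /cvgr_lt/(_ _ u0)[M [_ hM]] : fine \o cdf X @ -oo --> (0:R).
  exact/fine_cvg/cvg_cdfNy0.
exists (M - 1) => x /= ux; rewrite leNgt; apply/negP => xM.
suff : F x < u by rewrite ltNge ux.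
by apply: (hM x); rewrite (lt_trans xM)// gtrDl ltrN10.
Qed.

(** Right-continuity of the distribution function makes the infimum attained. This Galois connection
    yields both the monotonicity and the law of the quantile function. *)
Lemma le_quantile (u x : R) : 0 < u < 1 -> (quantile u <= x) = (u%:E <= cdf X x)%E.
Proof.
move=> u01; rewrite /quantile u01 -FE lee_fin.
have [[y Sy] Slb] := has_infF u01.
apply/idP/idP => [qx|ux]; last by apply: ge_inf.
apply: (@le_trans _ _ (F (inf [set x | u <= F x]))); last exact: F_nd.
set S := [set x | u <= F x] in qx Sy Slb *.
have h : F x @[x --> (inf S)^'+] --> F (inf S).
  by apply: fine_cvg; rewrite FE; exact: cdf_right_continuous.
rewrite leNgt; apply/negP => Fu; have [e /= e0 he] := cvgr_lt _ h _ Fu.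
have [z Sz zlt] := inf_adherent e0 (has_infF u01).
have [zS|Sz'] := leP z (inf S).
  by have := le_lt_trans (F_nd zS) Fu; rewrite ltNge Sz.
suff : F z < u by rewrite ltNge Sz.
by apply: he => //=; rewrite distrC gtr0_norm ?subr_gt0// ltrBlDl.
Qed.

Lemma nd_quantile : {in `]0, 1[ &, {homo quantile : u v / u <= v}}.
Proof.
move=> u v; rewrite !in_itv/= => u01 v01 uv; rewrite le_quantile//.
apply: (@le_trans _ _ v%:E); first by rewrite lee_fin.
by rewrite -le_quantile.
Qed.

(** By monotonicity the preimage of a ray meets []0, 1[] in an interval; elsewhere the function is
    constant. *)
Lemma measurable_quantile : measurable_fun setT quantile.
Proof.
apply: (measurability (@RGenCInfty.G R)) => [|/= _ [_] [r] -> <-].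
  exact: RGenCInfty.measurableE.
rewrite setTI (_ : _ @^-1` _ = (`]0, 1[ `&` quantile @^-1` `[r, +oo[) `|`
    (~` `]0, 1[ `&` (if r <= 0 then setT else set0))); last first.
  apply/seteqP; split => u /=; rewrite !in_itv/= !andbT.
    rewrite /quantile; case: ifPn => u01 ru; [by left|right].
    by split; [exact/negP|rewrite ru].
  by case=> -[]// /negP u01; rewrite /quantile (negbTE u01); case: ifP.
apply: measurableU; last apply: measurableI.
- apply: is_interval_measurable => s t /=.
  move=> [s01 rs] [t01 _] u /andP[su ut].
  have u01 : u \in `]0, 1[.
    move: s01 t01; rewrite !in_itv/= => /andP[s0 _] /andP[_ t1].
    by rewrite (lt_le_trans s0 su) (le_lt_trans ut t1).
  split=> //; move: rs; rewrite !in_itv/= !andbT => rs.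
  by apply: le_trans rs _; exact: nd_quantile.
- exact: measurableC.
- by case: ifP.
Qed.
End quantile.

Lemma uniform01E (R : realType) (A : set R) : measurable A ->
  uniform_prob (@ltr01 R) A = lebesgue_measure (A `&` `[0%R, 1%R]).
Proof.
move=> mA; rewrite /uniform_prob integral_uniform_pdf.
rewrite (eq_integral (cst 1%E)); last first.
  by move=> x; rewrite inE/= in_itv/= /uniform_pdf => -[_ ->]; rewrite subr0 invr1.
by rewrite integral_cst ?mul1e//; exact: measurableI.
Qed.

Lemma probability_oc_itv (R : realType) (m : probability R R) (a b : R) :
  a <= b -> (m `]a, b]%classic = m `]-oo, b]%classic - m `]-oo, a]%classic)%E.
Proof.
move=> ab.
have -> : `]a, b]%classic = `]-oo, b] `\` `]-oo, a].
  by rewrite -[RHS]setCK setCD setCitvl setUC -[LHS]setCK setCitv.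
rewrite measureD//; last by rewrite -ge0_fin_numE// fin_num_measure.
by rewrite setIidr//; exact: subset_itvl.
Qed.

Section quantile_law.
Context d (T : measurableType d) (R : realType) (P : probability T R).
Variable X : {RV P >-> R}.

Lemma uniform_quantile_itv (x : R) :
  uniform_prob (@ltr01 R) (quantile X @^-1` `]-oo, x]) = cdf X x.
Proof.
have mA : measurable (quantile X @^-1` `]-oo, x]).
  by rewrite -[_ @^-1` _]setTI; exact: measurable_quantile.
rewrite uniform01E//.
have p0 := cdf_ge0 X x; have p1 := cdf_le1 X x.
have pE : (fine (cdf X x))%:E = cdf X x by rewrite fineK// fin_num_measure.
rewrite -pE in p0 p1 *; rewrite !lee_fin in p0 p1; set p := fine _ in p0 p1 pE *.
apply/eqP; rewrite eq_le; apply/andP; split.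
  (* The point 1 is added because [quantile] takes its default value there, which may fall below [x]
     even when [p < 1]. *)
  apply: (@le_trans _ _ (lebesgue_measure (`[0, p]%classic `|` [set 1%R]))).
    apply: le_measure; rewrite ?inE//=; [exact: measurableI|exact: measurableU|].
    move=> u [/=]; rewrite !in_itv/= => qu /andP[u0 u1].
    have [->|un1] := eqVneq u 1%R; [by right|left].
    have [->|un0] := eqVneq u 0%R; first by rewrite lexx.
    rewrite u0/= -lee_fin pE -le_quantile//.
    by rewrite !lt_neqAle un1 u1 u0 eq_sym un0.
  apply: le_trans (measureU2 _ _ _) _ => //.
  have h0p : (lebesgue_measure `[0%R, p]%classic <= p%:E)%E.
    rewrite lebesgue_measure_itv/=.
    by case: ifPn => //; rewrite ?oppr0 ?adde0// lee_fin.
  rewrite -[leRHS]adde0; apply: leeD; first exact: h0p.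
  by have /eqP := lebesgue_measure_set1 (1:R); rewrite eq_le => /andP[].
apply: (@le_trans _ _ (lebesgue_measure `]0, p[%classic)).
  rewrite lebesgue_measure_itv/= lte_fin.
  by case: ltP => h; rewrite ?oppr0 ?adde0// lee_fin.
apply: le_measure; rewrite ?inE//=; first exact: measurableI.
move=> u /=; rewrite !in_itv/= => /andP[u0 up].
rewrite (ltW u0) (ltW (lt_le_trans up p1)); split=> //.
by rewrite le_quantile ?u0 ?(lt_le_trans up)//= -pE lee_fin ltW.
Qed.

Let q : measurableTypeR R -> R := quantile X.
Let mq : measurable_fun setT q := measurable_quantile X.
HB.instance Definition _ := isMeasurableFun.Build _ _ _ _ q mq.

Lemma uniform_quantile (A : set R) : measurable A ->
  uniform_prob (@ltr01 R) (quantile X @^-1` A) = distribution P X A.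
Proof.
move: A.
apply: (@measure_unique _ R _ (@ocitv R) (fun k => `](- k%:R), k%:R]%classic) _ _ _ _
  (distribution (uniform_prob (@ltr01 R)) q) (distribution P X)) => //.
- exact: ocitvI.
- by move=> k; exact: is_ocitv.
- apply/seteqP; split => // x _; exists (Num.truncn `|x|).+1 => //=.
  rewrite in_itv/=; have := truncnS_gt `|x|; rewrite ltr_norml => /andP[-> /ltW ->]//.
- move=> _ [[a b] _ <-].
  have [ab|ba] := leP a b; last first.
    by rewrite [`](a, b).1, _]%classic]set_itv_ge ?measure0// bnd_simp -leNgt ltW.
  etransitivity; first exact: (probability_oc_itv (distribution (uniform_prob ltr01) q) ab).
  etransitivity; last exact/esym/(probability_oc_itv (distribution P X) ab).
  by congr (_ - _)%E; exact: uniform_quantile_itv.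
- by move=> k; rewrite -ge0_fin_numE// fin_num_measure.
Qed.
End quantile_law.

(** * Derivatives, primitives and Taylor bounds *)

Section derivatives.
Context {R : realType}.
Implicit Types f g : R -> R.

Definition lip1 f := forall x y, `|f x - f y| <= `|x - y|.

Lemma lip1_continuous f : lip1 f -> continuous f.
Proof.
move=> lf x; apply/cvgrPdist_lt => e e0; near=> y.
by apply: le_lt_trans (lf x y) _; near: y; exact: cvgr_dist_lt.
Unshelve. all: by end_near. Qed.

Lemma is_derive_quad f (a K x : R) :
  (forall y, `|f y - f x - a * (y - x)| <= K * (y - x) ^+ 2) ->
  is_derive x 1 f a.
Proof.
move=> fK.
have K0 : 0 <= K.
  have := le_trans (normr_ge0 _) (fK (x + 1)).
  by rewrite (_ : x + 1 - x = 1) ?expr1n ?mulr1//; ring.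
suff h : h^-1 *: ((f \o shift x) (h *: 1) - f x) @[h --> 0^'] --> a.
  by apply: DeriveDef; [apply: cvgP h|apply/cvg_lim: h].
apply/cvgrPdist_le => e e0; near=> h => /=.
have h0 : h != 0 by near: h; exact: nbhs_dnbhs_neq.
have hK : `|h| <= e / (K + 1).
  near: h; apply: dnbhs0_le; first by rewrite divr_gt0// ltr_wpDl.
have := fK (h + x); rewrite addrK => fh.
rewrite -(@ler_pM2l _ `|h|) ?normr_gt0// -normrM.
rewrite [h *: 1]mulr1 [_ *: _]mulrC mulrBr mulrCA divff// mulr1 distrC mulrC.
rewrite (le_trans fh)// -[h ^+ 2]real_normK ?num_real//.
have K1 : 0 < K + 1 by lra.
have : `|h| * (K + 1) <= e by rewrite -ler_pdivlMr.
have := normr_ge0 h; nra.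
Unshelve. all: by end_near. Qed.

Lemma derive_le f g f' g' (a b : R) : a <= b ->
  (forall x, a <= x <= b -> is_derive x 1 f (f' x)) ->
  (forall x, a <= x <= b -> is_derive x 1 g (g' x)) ->
  (forall x, a <= x <= b -> f' x <= g' x) -> f b - f a <= g b - g a.
Proof.
rewrite le_eqVlt => /predU1P[->|ab] df dg fg; first by rewrite !subrr.
have dgf x : a <= x <= b -> is_derive x 1 (g \- f) (g' x - f' x).
  by move=> xab; apply: is_deriveB; [exact: dg|exact: df].
have [c /itvP cab] : exists2 c, c \in `]a, b[ &
    (g \- f) b - (g \- f) a = (g' c - f' c) * (b - a).
  apply: (@MVT _ _ (fun x => g' x - f' x)) => //.
    by move=> x /itvP xab; apply: dgf; rewrite !xab.
  by apply: derivable_within_continuous => x; rewrite in_itv/= => /dgf[].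
have := fg c; rewrite !cab => /(_ isT) fgc /= h.
suff : 0 <= (g' c - f' c) * (b - a) by rewrite -h; lra.
by rewrite mulr_ge0// subr_ge0// ltW.
Qed.

(** Integrates a bound on a derivative by comparing derivatives. It raises the order of a Taylor
    remainder by one, from Lipschitz to quadratic in [derive_smooth1] and from quadratic to cubic in
    [heat_taylor]. *)
Lemma derive_dist_le (f f' b b' : R -> R) (x : R) :
  (forall y : R, is_derive y 1 f (f' y)) ->
  (forall y : R, is_derive y 1 b (b' y)) ->
  (forall h, `|f' (x + h)| <= b' `|h|) ->
  forall h, `|f (x + h) - f x| <= b `|h| - b 0.
Proof.
move=> df db fb h.
(* The sign of [h]: along the segment [x + s * r] with [r] in [[0, |h|]] both directions become one
   comparison in [r]. *)
pose s : R := if 0 <= h then 1 else -1.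
have s1 : `|s| = 1 by rewrite /s; case: ifP; rewrite ?normrN normr1.
have -> : x + h = x + s * `|h|.
  rewrite /s; case: lerP => h0; first by rewrite mul1r ger0_norm.
  by rewrite ltr0_norm// mulN1r opprK.
have dfs (r : R) : is_derive r 1 (fun r => f (x + s * r)) (s * f' (x + s * r)).
  have dl : is_derive r 1 (fun r : R => x + s * r) s.
    by apply: is_derive_eq; rewrite add0r mul1r [_ *: 1]mulr1.
  have := @is_derive1_comp _ f (fun r : R => x + s * r) r _ _ (df _) dl.
  by rewrite mulrC.
have dfN (r : R) : is_derive r 1 (fun r => - f (x + s * r)) (- (s * f' (x + s * r))).
  exact: is_deriveN.
have hle r : 0 <= r <= `|h| -> `|s * f' (x + s * r)| <= b' r.
  move=> /andP[r0 _]; rewrite normrM s1 mul1r (le_trans (fb _))//.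
  by rewrite normrM s1 mul1r ger0_norm.
have h1 : f (x + s * `|h|) - f (x + s * 0) <= b `|h| - b 0.
  apply: (@derive_le (fun r => f (x + s * r)) _ _ _ _ _ (normr_ge0 h)
    (fun r _ => dfs r) (fun r _ => db r)) => r hr.
  exact: le_trans (ler_norm _) (hle r hr).
have h2 : - f (x + s * `|h|) - (- f (x + s * 0)) <= b `|h| - b 0.
  apply: (@derive_le (fun r => - f (x + s * r)) _ _ _ _ _ (normr_ge0 h)
    (fun r _ => dfN r) (fun r _ => db r)) => r hr.
  by apply: le_trans (hle r hr); rewrite -normrN ler_norm.
rewrite mulr0 addr0 in h1 h2.
by rewrite ler_norml; apply/andP; split; lra.
Qed.

Definition primitive (g : R -> R) (x : R) : R :=
  if 0 <= x then \int[lebesgue_measure]_(r in `[0, x]) g r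
  else - \int[lebesgue_measure]_(r in `[x, 0]) g r.

Lemma primitiveB g (x y : R) : continuous g -> x <= y ->
  primitive g y - primitive g x = \int[lebesgue_measure]_(r in `[x, y]) g r.
Proof.
move=> cg xy.
have ig (a b : R) : lebesgue_measure.-integrable `[a, b] (EFin \o g).
  apply: continuous_compact_integrable; first exact: segment_compact.
  exact: continuous_subspaceT.
have cut (a b c : R) : a <= b -> b <= c -> \int[lebesgue_measure]_(r in `[a, c]) g r =
    \int[lebesgue_measure]_(r in `[a, b]) g r +
    \int[lebesgue_measure]_(r in `[b, c]) g r.
  move=> ab bc; have := @Rintegral_itvB _ g (BLeft a) (BRight c) b (ig a c).
  rewrite !bnd_simp => /(_ ab bc) h; apply/eqP; rewrite addrC -subr_eq h; apply/eqP.
  by rewrite Rintegral_itv_obnd_cbnd//; apply: integrableS (ig b c) => //; exact: subset_itv_oc_cc.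
rewrite /primitive; case: (lerP 0 x) => x0; case: (lerP 0 y) => y0.
- by rewrite (cut 0 x y)// addrC addKr.
- by have := lt_le_trans y0 x0; rewrite ltNge xy.
- by rewrite opprK addrC -(cut x 0 y)// ltW.
- by rewrite (cut x y 0)//; [rewrite opprK addrC addrK|exact: ltW].
Qed.

(** A 1-Lipschitz function varies by at most [b - a] on [[a, b]], which gives the expansion required
    by [is_derive_quad] at once. *)
Lemma is_derive_primitive g (x : R) : lip1 g -> is_derive x 1 (primitive g) (g x).
Proof.
move=> lg; have cg := lip1_continuous lg.
have ig (a b : R) : lebesgue_measure.-integrable `[a, b] (EFin \o g).
  apply: continuous_compact_integrable; first exact: segment_compact.
  exact: continuous_subspaceT.
have bnd (a b c : R) : a <= b -> a <= c <= b ->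
    `|\int[lebesgue_measure]_(r in `[a, b]) g r - g c * (b - a)| <= (b - a) ^+ 2.
  move=> ab /andP[ac cb].
  have muab : fine (lebesgue_measure `[a, b]) = b - a.
    rewrite lebesgue_measure_itv/= lte_fin; move: ab; rewrite le_eqVlt.
    by case/predU1P => [->|->//]; rewrite ltxx subrr.
  have icst (k : R) : lebesgue_measure.-integrable `[a, b] (EFin \o cst k).
    apply: continuous_compact_integrable; first exact: segment_compact.
    by apply: continuous_subspaceT => ?; exact: cvg_cst.
  have intc k : \int[lebesgue_measure]_(r in `[a, b]) (cst k r) = k * (b - a).
    by rewrite Rintegral_cst//= muab.
  rewrite -intc -RintegralB//; apply: (le_trans (le_normr_Rintegral _ _)) => //.
    exact: (integrableB _ (ig a b) (icst (g c))).
  rewrite expr2 -intc; apply: le_Rintegral => //.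
    apply: integrable_norm; exact: (integrableB _ (ig a b) (icst (g c))).
  move=> r /=; rewrite in_itv/= => /andP[ar rb]; rewrite (le_trans (lg _ _))//.
  by rewrite ler_norml; apply/andP; split; lra.
apply: (@is_derive_quad _ _ 1) => y; rewrite mul1r.
have [xy|yx] := leP x y.
  by rewrite primitiveB//; apply: bnd; rewrite ?lexx.
have := bnd y x x (ltW yx); rewrite lexx (ltW yx) => /(_ isT).
rewrite -(primitiveB cg (ltW yx)) => h.
have -> : (y - x) ^+ 2 = (x - y) ^+ 2 by ring.
by rewrite -normrN; congr (is_true (_ <= _)): h; congr `|_|; ring.
Qed.

End derivatives.

Section smooth.
Context {R : realType}.
Implicit Types f g : R -> R.

(** The link between [f] and [f'] is an inequality rather than a derivative, because an inequality
    survives averaging against a Gaussian ([heat_smooth1]); differentiability is recovered by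
    [is_derive_quad]. *)
Definition smooth1 f f' := lip1 f' /\
  forall x y, `|f y - f x - f' x * (y - x)| <= (y - x) ^+ 2 / 2.

Lemma smooth1_is_derive f f' (x : R) : smooth1 f f' -> is_derive x 1 f (f' x).
Proof.
move=> [_ h]; apply: (@is_derive_quad _ _ _ 2^-1) => y.
by rewrite [leRHS]mulrC; exact: h.
Qed.

Lemma smooth1_continuous f f' : smooth1 f f' -> continuous f.
Proof.
move=> h x; apply: differentiable_continuous; apply/derivable1_diffP.
by have [] := smooth1_is_derive x h.
Qed.

Lemma smooth1_measurable f f' : smooth1 f f' -> measurable_fun setT f.
Proof. by move=> h; apply: continuous_measurable_fun; exact: smooth1_continuous h. Qed.

Lemma lip1_measurable f : lip1 f -> measurable_fun setT f.
Proof. by move=> h; apply: continuous_measurable_fun; exact: lip1_continuous. Qed.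

Lemma derive_smooth1 f f' : lip1 f' -> (forall x : R, is_derive x 1 f (f' x)) ->
  smooth1 f f'.
Proof.
move=> lf df; split=> // x y.
have -> : (y - x) ^+ 2 / 2 = `|y - x| ^+ 2 / 2 - 0 ^+ 2 / 2.
  by rewrite real_normK ?num_real// expr0n/= mul0r subr0.
have -> : f y - f x - f' x * (y - x) = f (x + (y - x)) - f' x * (x + (y - x)) - (f x - f' x * x).
  by rewrite [x + _]addrC subrK; ring.
apply: (derive_dist_le (f := fun r => f r - f' x * r) (f' := fun r => f' r - f' x)
  (b := fun r => r ^+ 2 / 2) (b' := id)) => [r|r|h].
- have h : is_derive r 1 (fun r : R => f' x * r) (f' x).
    by apply: is_derive_eq; rewrite [_ *: 1]mulr1.
  exact: is_deriveB (df r) h.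
- have h : is_derive r 1 (fun r : R => r ^+ 2 / 2) r.
    apply: is_derive_eq.
    by rewrite !scaler0 add0r [r%:A]mulr1 /GRing.scale/=; field.
  exact: h.
- by rewrite (le_trans (lf _ _))// addrAC subrr add0r.
Qed.

Lemma smooth1_rint d (T : measurableType d) (P : probability T R) f f' (X : T -> R) :
  smooth1 f f' -> measurable_fun setT X -> rint P (fun w => X w ^+ 2) ->
  rint P (fun w => f (X w)).
Proof.
move=> hf mX X2; apply: (@rint_le _ _ _ P (fun w => `|f 0| + `|f' 0| * `|X w| + X w ^+ 2 / 2)).
- by apply: measurableT_comp mX; exact: smooth1_measurable hf.
- move=> w; have := hf.2 0 (X w); rewrite subr0 -normrM => h.
  have := ler_normD (f (X w) - f 0 - f' 0 * X w) (f 0 + f' 0 * X w).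
  have := ler_normD (f 0) (f' 0 * X w).
  rewrite (_ : _ - _ - _ + _ = f (X w)); last by ring.
  lra.
- apply: rintD; last exact: rintZr.
  apply: rintD; first exact: rint_cst.
  by apply: rintZl; apply: rint_norm; exact: rint_sqr.
Qed.

(** McShane extension: the infimum of the cones [e i + |z - m i|]. The indexing by [i] lets [m] be
    non-injective, the hypothesis forcing [e i = e j] whenever [m i = m j]. *)
Lemma lip1_extension (I : Type) (A : set I) (m e : I -> R) : A !=set0 ->
  (forall i j, A i -> A j -> `|e i - e j| <= `|m i - m j|) ->
  exists2 g, lip1 g & forall i, A i -> g (m i) = e i.
Proof.
move=> [i0 Ai0] em.
pose S z := [set e i + `|z - m i| | i in A].
have S0 z : S z !=set0 by exists (e i0 + `|z - m i0|), i0.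
have tri i j z : A i -> A j -> e i <= e j + `|z - m j| + `|z - m i|.
  move=> Ai Aj; have := em _ _ Ai Aj; have := ler_norm (e i - e j).
  have := ler_distD z (m i) (m j); rewrite (distrC (m i) z); lra.
have Slb z : has_lbound (S z).
  exists (e i0 - `|z - m i0|) => _ [j Aj <-].
  by have := tri _ _ z Ai0 Aj; lra.
exists (fun z => inf (S z)); last first.
  move=> i Ai; apply/eqP; rewrite eq_le; apply/andP; split.
    by apply: ge_inf => //; exists i => //; rewrite subrr normr0 addr0.
  apply: lb_le_inf => // _ [j Aj <-].
  by have := tri _ _ (m i) Ai Aj; rewrite subrr normr0 addr0.
have half x y : inf (S x) <= inf (S y) + `|x - y|.
  rewrite -lerBlDr; apply: lb_le_inf => // _ [j Aj <-]; rewrite lerBlDr.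
  apply: (@le_trans _ _ (e j + `|x - m j|)); first by apply: ge_inf => //; exists j.
  by have := ler_distD y x (m j); lra.
move=> x y; rewrite ler_norml; apply/andP; split.
  by have := half y x; rewrite distrC; lra.
by have := half x y; lra.
Qed.

End smooth.

(** * Integrals depend only on the law *)

Section same_law.
Context d (T : measurableType d) (R : realType) (P : {measure set T -> \bar R}).
Context d' (T' : measurableType d') (Q : {measure set T' -> \bar R}).
Variables (X : T -> R) (Z : T' -> R).
Hypotheses (mX : measurable_fun setT X) (mZ : measurable_fun setT Z).
Hypothesis lawXZ : forall A, measurable A -> Q (Z @^-1` A) = P (X @^-1` A).

Let ge0_integral_law (f : R -> \bar R) : measurable_fun setT f ->
  (forall x, 0 <= f x)%E -> (\int[Q]_w f (Z w) = \int[P]_w f (X w))%E.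
Proof.
move=> mf f0.
transitivity (\int[pushforward Q Z]_y f y)%E.
  by rewrite (ge0_integral_pushforward mZ).
transitivity (\int[pushforward P X]_y f y)%E.
  by apply: eq_measure_integral => A mA _; exact: lawXZ.
by rewrite (ge0_integral_pushforward mX).
Qed.

Lemma law_rint (f : R -> R) : measurable_fun setT f ->
  rint P (fun w => f (X w)) -> rint Q (fun w => f (Z w)).
Proof.
move=> mf /integrableP[_ h]; apply/integrableP; split.
  by apply/measurable_EFinP; apply: measurableT_comp.
by rewrite (ge0_integral_law (f := fun x => `|(f x)%:E|%E))//;
  apply/measurableT_comp => //; exact/measurable_EFinP.
Qed.

Lemma law_Rintegral (f : R -> R) : measurable_fun setT f ->
  \int[Q]_w f (Z w) = \int[P]_w f (X w).
Proof.
move=> mf; congr fine; rewrite [LHS]integralE [RHS]integralE; congr (_ - _)%E.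
- have h : measurable_fun setT ((EFin \o f)^\+%E).
    by apply: measurable_funepos; exact/measurable_EFinP.
  by move: (ge0_integral_law h (fun x => funepos_ge0 _ x)); rewrite !unlock.
- have h : measurable_fun setT ((EFin \o f)^\-%E).
    by apply: measurable_funeneg; exact/measurable_EFinP.
  by move: (ge0_integral_law h (fun x => funeneg_ge0 _ x)); rewrite !unlock.
Qed.

End same_law.

Section wasserstein_bound.
Context d (T : measurableType d) (R : realType) (P : probability T R).
Context d' (T' : measurableType d') (Q : probability T' R).
Variables (X : {RV P >-> R}) (Z : {RV Q >-> R}).
Hypotheses (X2 : rint P (fun w => X w ^+ 2)) (Z2 : rint Q (fun w => Z w ^+ 2)).

Let U : measurableTypeR R -> R := quantile X.
Let V : measurableTypeR R -> R := quantile Z.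
HB.instance Definition _ := isMeasurableFun.Build _ _ _ _ U (measurable_quantile X).
HB.instance Definition _ := isMeasurableFun.Build _ _ _ _ V (measurable_quantile Z).
Let m := uniform_prob (@ltr01 R).

(* On the quantile coupling [(U - V) / 2] is a 1-Lipschitz function of the midpoint
   [(U + V) / 2], by comonotonicity. Let f' extend it: expanding f at the midpoint
   gives [(U - V) ^+ 2 <= 4 * (f U - f V)]. *)
Lemma wasserstein_le_smooth : exists f f', smooth1 f f' /\
  (wasserstein 2 (distribution P X) (distribution Q Z) <=
   (Num.sqrt (4 * (\int[P]_w f (X w) - \int[Q]_w f (Z w))))%:E)%E.
Proof.
have cm u v : 0 < u < 1 -> 0 < v < 1 ->
    `|(U u - V u) / 2 - (U v - V v) / 2| <= `|(U u + V u) / 2 - (U v + V v) / 2|.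
  wlog uv : u v / u <= v.
    move=> h hu hv; have [|/ltW] := leP u v; first by move/h; exact.
    by move/h => /(_ hv hu); rewrite distrC [leRHS]distrC.
  move=> hu hv.
  have hU : U u <= U v by apply: nd_quantile => //; rewrite in_itv.
  have hV : V u <= V v by apply: nd_quantile => //; rewrite in_itv.
  rewrite [leRHS]ler0_norm; last by lra.
  by rewrite ler_norml; apply/andP; split; lra.
have [|g lg ge] := @lip1_extension R R [set u | 0 < u < 1] (fun u => (U u + V u) / 2)
    (fun u => (U u - V u) / 2) _ cm.
  by exists (2^-1); rewrite /= ?invr_gt0 ?ltr0n ?invf_lt1 ?ltr1n.
have sf := derive_smooth1 lg (fun x => is_derive_primitive x lg).
set f := primitive g in sf.
have ineq u : (U u - V u) ^+ 2 <= 4 * (f (U u) - f (V u)).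
  have [u01|u01] := boolP (0 < u < 1); last first.
    by rewrite /U /V /quantile (negbTE u01) !subrr expr0n mulr0.
  have := sf.2 ((U u + V u) / 2) (U u); have := sf.2 ((U u + V u) / 2) (V u).
  rewrite ge//= !ler_norml => /andP[h1 h2] /andP[h3 h4].
  nra.
have lawU A : measurable A -> m (U @^-1` A) = P (X @^-1` A).
  exact: uniform_quantile.
have lawV A : measurable A -> m (V @^-1` A) = Q (Z @^-1` A).
  exact: uniform_quantile.
exists f, g; split => //.
apply: (@le_trans _ _ 'N[m]_2%:E[EFin \o (U \- V)]%R)%E.
  by apply: ereal_inf_lbound; exists _, _, m, U, V.
have mf := smooth1_measurable sf.
have iU2 : rint m (fun u => U u ^+ 2).
  by apply: (law_rint (f := fun x => x ^+ 2) _ _ lawU).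
have iV2 : rint m (fun u => V u ^+ 2).
  by apply: (law_rint (f := fun x => x ^+ 2) _ _ lawV).
have mU : measurable_fun setT U by [].
have mV : measurable_fun setT V by [].
have ifU : rint m (fun u => f (U u)) by exact: smooth1_rint sf _ iU2.
have ifV : rint m (fun u => f (V u)) by exact: smooth1_rint sf _ iV2.
rewrite -(law_Rintegral _ _ lawU mf)// -(law_Rintegral _ _ lawV mf)//.
have iUV2 : rint m (fun u => (U u - V u) ^+ 2).
  have := rint_sqrD mU (measurable_funN mV) iU2; apply.
  by apply: rint_eq iV2 => u /=; rewrite sqrrN.
rewrite unlock.
have -> : (\int[m]_u `|(EFin \o (U \- V)%R) u| `^ 2 =
    (Rintegral m setT (fun u => (U u - V u) ^+ 2)%R)%:E)%E.
  rewrite EFin_Rintegral//; apply: eq_integral => u _ /=.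
  by rewrite powR_mulrn// real_normK ?num_real.
rewrite poweR_EFin powR12_sqrt; last by apply: Rintegral_ge0 => u _; exact: sqr_ge0.
rewrite lee_fin ler_sqrt.
  have ifUV := rintB ifU ifV.
  by rewrite -RintegralB// -RintegralZl//; apply: le_Rint => //; exact: rintZl.
rewrite -RintegralB// -RintegralZl//; last exact: rintB.
by apply: Rintegral_ge0 => u _; apply: le_trans (ineq u); exact: sqr_ge0.
Qed.

End wasserstein_bound.

(** * The Gaussian heat semigroup *)

Section density.
Local Open Scope ereal_scope.
Context d (T : measurableType d) (R : realType).
Variables (mu nu : {measure set T -> \bar R}) (g : T -> R).
Hypotheses (g0 : forall x, (0 <= g x)%R) (mg : measurable_fun setT g).
Hypothesis nuE : forall A, measurable A -> nu A = \int[mu]_(x in A) (g x)%:E.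

Let integral_density_indic E : measurable E ->
  \int[nu]_x (\1_E x)%:E = \int[mu]_x ((\1_E x)%:E * (g x)%:E).
Proof.
move=> mE; rewrite integral_indic// setIT nuE// integral_mkcond.
apply: eq_integral => x _; rewrite patchE indicE.
by case: ifP => xE; rewrite /= ?xE ?mul1e ?mul0e.
Qed.

Import HBNNSimple.

Let integral_density_nnsfun (h : {nnsfun T >-> R}) :
  \int[nu]_x (h x)%:E = \int[mu]_x ((h x)%:E * (g x)%:E).
Proof.
under [LHS]eq_integral do rewrite fimfunE -fsumEFin//.
rewrite [LHS]ge0_integral_fsum//; last 2 first.
  - by move=> r; exact/measurable_EFinP/measurableT_comp.
  - by move=> n x _; rewrite EFinM nnfun_muleindic_ge0.
under [RHS]eq_integral.
  move=> x xD; rewrite fimfunE -fsumEFin// ge0_mule_fsuml; last first.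
    by move=> r; rewrite EFinM nnfun_muleindic_ge0.
  over.
rewrite [RHS]ge0_integral_fsum//; last 2 first.
  - move=> r; apply: emeasurable_funM; last exact/measurable_EFinP.
    exact/measurable_EFinP/measurableT_comp.
  - move=> n x _; apply: mule_ge0; last by rewrite lee_fin.
    by rewrite EFinM nnfun_muleindic_ge0.
apply: eq_fsbigr => r /[!inE] -[x _ hr].
have r0 : (0 <= r)%R by rewrite -hr.
under eq_integral do rewrite EFinM.
rewrite ge0_integralZl//; last exact/measurable_EFinP.
rewrite integral_density_indic//.
under [RHS]eq_integral do rewrite EFinM -muleA.
rewrite ge0_integralZl//.
- by apply: emeasurable_funM; exact/measurable_EFinP.
- by move=> t _; rewrite mule_ge0// lee_fin.
Qed.

Lemma ge0_integral_density (f : T -> \bar R) : measurable_fun setT f ->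
  (forall x, 0 <= f x) -> \int[nu]_x f x = \int[mu]_x (f x * (g x)%:E).
Proof.
move=> mf f0; pose f_ := nnsfun_approx measurableT mf.
transitivity (limn (fun n => \int[nu]_x (f_ n x)%:E)).
  rewrite -monotone_convergence//=.
  - apply: eq_integral => x /[!inE] xD; apply/esym/cvg_lim => //=.
    exact: cvg_nnsfun_approx.
  - by move=> n; apply: measurableT_comp => //; exact: measurable_funTS.
  - by move=> n x _; rewrite lee_fin.
  - by move=> x _ a b ab; rewrite lee_fin//; exact/lefP/nd_nnsfun_approx.
rewrite (_ : \int[mu]_x _ = limn (fun n => \int[mu]_x ((f_ n x)%:E * (g x)%:E))); last first.
  rewrite -monotone_convergence//=.
  - apply: eq_integral => x /[!inE] xD; apply/esym/cvg_lim => //.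
    by apply: cvgeZr => //; exact: cvg_nnsfun_approx.
  - by move=> n; apply: emeasurable_funM; exact/measurable_EFinP.
  - by move=> n x _; rewrite mule_ge0// lee_fin.
  - by move=> x _ a b ab; rewrite lee_wpmul2r ?lee_fin//; exact/lefP/nd_nnsfun_approx.
by congr (limn _); apply/funext => n /=; rewrite integral_density_nnsfun.
Qed.

Lemma Rintegral_density (f : T -> R) : measurable_fun setT f ->
  (Rintegral nu setT f = Rintegral mu setT (fun x => f x * g x))%R.
Proof.
move=> mf; congr fine; rewrite [LHS]integralE [RHS]integralE; congr (_ - _).
- rewrite ge0_integral_density//; last first.
    by apply: measurable_funepos; exact/measurable_EFinP.
  apply: eq_integral => x _; rewrite !funeposE EFinM maxeMl ?lee_fin//.
  by rewrite mul0e.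
- rewrite ge0_integral_density//; last first.
    by apply: measurable_funeneg; exact/measurable_EFinP.
  apply: eq_integral => x _; rewrite !funenegE EFinM maxeMl ?lee_fin//.
  by rewrite mul0e mulNe.
Qed.

Lemma rint_density (f : T -> R) : measurable_fun setT f ->
  rint nu f <-> rint mu (fun x => (f x * g x)%R).
Proof.
move=> mf.
have mf' : measurable_fun setT (fun x => `|(f x)%:E|).
  by apply: measurableT_comp => //; exact/measurable_EFinP.
have h : \int[nu]_x `|(f x)%:E| = \int[mu]_x `|(f x * g x)%:E|.
  rewrite ge0_integral_density//; apply: eq_integral => x _.
  by rewrite EFinM abseM (gee0_abs (_ : 0 <= (g x)%:E)) ?lee_fin.
split => /integrableP[_ fi]; apply/integrableP; split.
- by apply/measurable_EFinP; exact: measurable_funM.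
- by rewrite /= -h.
- exact/measurable_EFinP.
- by rewrite /= h.
Qed.

End density.

(** * Affine change of variables *)

Section lebesgue_affine.
Context {R : realType}.
Local Notation leb := (@lebesgue_measure R).
Variables (a s : R) (s0 : 0 < s).
Let F : measurableTypeR R -> measurableTypeR R := fun x => a + s * x.
Let mF : measurable_fun setT F.
Proof. by apply: measurable_funD => //; exact: measurable_funM. Qed.
Let lebF : {measure set (measurableTypeR R) -> \bar R} :=
  measure_function_pushforward__canonical__measure_function_Measure leb mF.
Let s0' : 0 <= s := ltW s0.

(** Lebesgue measure is [s] times its image under [x |-> a + s * x], by uniqueness on half-open
    intervals. *)
Lemma ge0_integral_affine (f : R -> \bar R) : measurable_fun setT f ->
  (forall x, 0 <= f x)%E ->
  (\int[leb]_x f x = s%:E * \int[leb]_x f (a + s * x)%R)%E.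
Proof.
move=> mf f0.
transitivity (\int[mscale (NngNum s0') lebF]_x f x)%E.
  apply: eq_measure_integral => A mA _.
  apply: lebesgue_measure_unique => // _ [[b c] _ <-].
  transitivity (s%:E * leb (F @^-1` `]b, c]%classic))%E; last by [].
  rewrite (_ : F @^-1` _ = `]((b - a) / s), ((c - a) / s)]%classic); last first.
    apply/seteqP; split => x; rewrite /F /= !in_itv/= ltr_pdivrMr// ler_pdivlMr//.
      by move=> /andP[? ?]; apply/andP; split; lra.
    by move=> /andP[? ?]; apply/andP; split; lra.
  rewrite !lebesgue_measure_itv/= !lte_fin ltr_pM2r ?invr_gt0// ltrD2r.
  case: ifP => _; last by rewrite mule0.
  by rewrite -!EFinD -EFinM; congr (_%:E); field; rewrite gt_eqF.
rewrite ge0_integral_mscale//=; congr (_ * _)%E.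
by rewrite ge0_integral_pushforward.
Qed.

End lebesgue_affine.

(** * Translations of the Gaussian measure *)

Section gaussian.
Context {R : realType}.
Local Notation leb := (@lebesgue_measure R).
Local Notation gam := (normal_prob (0 : R) 1).
Implicit Types (a z : R) (f : R -> R).

Lemma normal_pdf01E z : normal_pdf 0 1 z = normal_peak 1 * expR (- (z ^+ 2 / 2)).
Proof.
rewrite normal_pdfE ?oner_eq0// /normal_fun subr0 expr1n.
by congr (_ * expR _); rewrite mulNr.
Qed.

Lemma ge0_integral_normal (f : R -> \bar R) : measurable_fun setT f ->
  (forall x, 0 <= f x)%E ->
  (\int[gam]_z f z = \int[leb]_z (f z * (normal_pdf 0 1 z)%:E))%E.
Proof.
move=> mf f0; apply: ge0_integral_density => //.
- by move=> x; exact: normal_pdf_ge0.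
- exact: measurable_normal_pdf.
Qed.

(** The Cameron-Martin density of N(a, 1) with respect to N(0, 1). *)
Definition shift_density a z := expR (a * z - a ^+ 2 / 2).

Lemma normal_pdf_shift a z :
  normal_pdf 0 1 (- a + z) = shift_density a z * normal_pdf 0 1 z.
Proof.
rewrite !normal_pdf01E mulrCA -expRD; congr (_ * expR _).
by field.
Qed.

Lemma measurable_shift_density a : measurable_fun setT (shift_density a).
Proof.
by apply: measurableT_comp => //; apply: measurable_funB.
Qed.

Let ge0_integral_shift a (f : R -> \bar R) : measurable_fun setT f ->
  (forall x, 0 <= f x)%E ->
  (\int[gam]_z f (a + z)%R = \int[gam]_z (f z * (shift_density a z)%:E))%E.
Proof.
move=> mf f0.
have mfa (b : R) : measurable_fun setT (fun z => f (b + 1 * z)%R).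
  apply: measurableT_comp => //; exact: measurable_funD.
rewrite ge0_integral_normal//; last first.
  by have := mfa a; under eq_fun do rewrite mul1r.
rewrite (@ge0_integral_affine _ (- a) 1)//; last 2 first.
- apply: emeasurable_funM; last by apply/measurable_EFinP; exact: measurable_normal_pdf.
  by have := mfa a; under eq_fun do rewrite mul1r.
- by move=> x; rewrite mule_ge0// lee_fin normal_pdf_ge0.
rewrite ge0_integral_normal//; last 2 first.
- by apply: emeasurable_funM => //; apply/measurable_EFinP; exact: measurable_shift_density.
- by move=> x; rewrite mule_ge0// lee_fin expR_ge0.
rewrite mul1e; apply: eq_integral => z _.
by rewrite mul1r addrA subrr add0r normal_pdf_shift EFinM muleA.
Qed.

Let shiftR a : measurableTypeR R -> measurableTypeR R := fun z => a + z.
Let mshiftR a : measurable_fun setT (shiftR a).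
Proof. exact: measurable_funD. Qed.
Let shift_measure a : {measure set (measurableTypeR R) -> \bar R} :=
  measure_function_pushforward__canonical__measure_function_Measure gam (mshiftR a).

Let shift_measureE a (A : set (measurableTypeR R)) : measurable A ->
  (shift_measure a A = \int[gam]_(z in A) (shift_density a z)%:E)%E.
Proof.
move=> mA; have mSA : measurable (shiftR a @^-1` A).
  by rewrite -[_ @^-1` _]setTI; exact: mshiftR.
transitivity (\int[gam]_z (\1_A (a + z)%R)%:E)%E.
  by rewrite (_ : (fun _ => _) = EFin \o \1_(shiftR a @^-1` A))// integral_indic// setIT.
rewrite [RHS]integral_mkcond (@ge0_integral_shift a (EFin \o \1_A)).
- apply: eq_integral => z _; rewrite patchE /= indicE.
  by case: ifP; rewrite ?mul1e ?mul0e.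
- by apply/measurable_EFinP; exact: measurable_indic.
- by move=> x; rewrite lee_fin.
Qed.

(** Moves a translation from the argument of [f] onto an analytic weight, so that expansions in [a]
    ask no smoothness of [f]. This takes the place of Gaussian integration by parts. *)
Lemma Rintegral_shift a f : measurable_fun setT f ->
  \int[gam]_z f (a + z) = \int[gam]_z (f z * shift_density a z).
Proof.
move=> mf; rewrite -(@Rintegral_density _ _ _ gam (shift_measure a))//.
- apply: (@law_Rintegral _ _ _ (shift_measure a) _ _ gam idfun (shiftR a)) => //; [exact: measurable_id|exact: mshiftR].
- by move=> z; exact: expR_ge0.
- exact: measurable_shift_density.
- exact: shift_measureE.
Qed.

Lemma rint_shift a f : measurable_fun setT f ->
  rint gam (fun z => f (a + z)) <-> rint gam (fun z => f z * shift_density a z).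
Proof.
move=> mf; rewrite -(@rint_density _ _ _ gam (shift_measure a))//.
- split.
    apply: (@law_rint _ _ _ gam _ _ (shift_measure a) (shiftR a) idfun) => //; [exact: mshiftR|exact: measurable_id].
  apply: (@law_rint _ _ _ (shift_measure a) _ _ gam idfun (shiftR a)) => //; [exact: measurable_id|exact: mshiftR].
- by move=> z; exact: expR_ge0.
- exact: measurable_shift_density.
- exact: shift_measureE.
Qed.

End gaussian.

(** * Rotation invariance of the Gaussian measure *)

Section rotation.
Context {R : realType}.
Local Notation leb := (@lebesgue_measure R).
Local Notation gam := (normal_prob (0 : R) 1).
Variables (a b : R) (b0 : 0 < b) (ab1 : a ^+ 2 + b ^+ 2 = 1).

(** For independent standard normals [z] and [w], the joint density of [z] and [y = a * z + b * w]
    is symmetric in the two variables. Integrating out [z] then leaves the standard normal density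
    in [y]. *)
Let normal_pdf_rot (z y : R) :
  normal_pdf 0 1 z * normal_pdf 0 1 ((y - a * z) / b) =
  normal_pdf 0 1 y * normal_pdf 0 1 ((z - a * y) / b).
Proof.
rewrite !normal_pdf01E mulrACA [RHS]mulrACA -!expRD; congr (_ * expR _).
have b0' : b != 0 by rewrite gt_eqF.
have b2 : b ^+ 2 = 1 - a ^+ 2 by rewrite -ab1; ring.
have e (u v : R) : - (u ^+ 2 / 2) - ((v - a * u) / b) ^+ 2 / 2 =
    - ((u ^+ 2 * b ^+ 2 + (v - a * u) ^+ 2) / b ^+ 2 / 2) by field.
rewrite !e; congr (- (_ / _ / _)); rewrite b2; ring.
Qed.

Let mpdf : measurable_fun setT (normal_pdf (0 : R) 1) := measurable_normal_pdf 0 1.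

Let ge0_integral_normal_affine (c : R) (f : R -> \bar R) : measurable_fun setT f ->
  (forall x, 0 <= f x)%E ->
  (\int[gam]_w f (c + b * w)%R =
   \int[leb]_y (f y * (normal_pdf 0 1 ((y - c) / b) / b)%:E))%E.
Proof.
move=> mf f0; rewrite ge0_integral_normal//; last first.
  by apply: measurableT_comp => //; apply: measurable_funD => //; exact: measurable_funM.
rewrite [RHS](@ge0_integral_affine _ c b)//; last 2 first.
- apply: emeasurable_funM; first exact: mf.
  apply/measurable_EFinP/measurable_funM => //.
  by apply: measurableT_comp => //; apply: measurable_funM => //; exact: measurable_funB.
- by move=> x; rewrite mule_ge0// lee_fin divr_ge0 ?normal_pdf_ge0// ltW.
rewrite -ge0_integralZl//.
- apply: eq_integral => w _; rewrite muleCA -EFinM; congr (_ * _%:E)%E.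
  rewrite mulrCA divff ?gt_eqF// mulr1 addrAC subrr add0r mulrC mulKf ?gt_eqF//.
- apply: emeasurable_funM; last apply/measurable_EFinP/measurable_funM => //.
    by apply: measurableT_comp => //; apply: measurable_funD => //; exact: measurable_funM.
  apply: measurableT_comp => //; apply: measurable_funM => //; apply: measurable_funB => //.
  by apply: measurable_funD => //; exact: measurable_funM.
- by move=> x _; rewrite mule_ge0// lee_fin divr_ge0 ?normal_pdf_ge0// ltW.
- by rewrite lee_fin ltW.
Qed.

Let ge0_integral_rotation (f : R -> \bar R) : measurable_fun setT f ->
  (forall x, 0 <= f x)%E ->
  (\int[gam]_z \int[gam]_w f (a * z + b * w)%R = \int[gam]_z f z)%E.
Proof.
move=> mf f0.
pose G (p : measurableTypeR R * measurableTypeR R) :=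
  (f p.2 * (normal_pdf 0 1 p.1 * normal_pdf 0 1 ((p.2 - a * p.1) / b) / b)%:E)%E.
have mG : measurable_fun setT G.
  apply: emeasurable_funM; first exact: measurableT_comp.
  apply/measurable_EFinP/measurable_funM => //; apply: measurable_funM.
    exact: measurableT_comp.
  apply: measurableT_comp => //; apply: measurable_funM => //.
  apply: measurable_funB => //; exact: measurable_funM.
have G0 p : (0 <= G p)%E.
  by rewrite mule_ge0// lee_fin divr_ge0 ?mulr_ge0 ?normal_pdf_ge0// ltW.
transitivity (\int[leb]_z \int[leb]_y G (z, y))%E.
  under eq_integral do rewrite ge0_integral_normal_affine//.
  rewrite ge0_integral_normal//; last 2 first.
  - apply: (@measurable_fun_fubini_tonelli_F _ _ (measurableTypeR R) (measurableTypeR R) R leb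
      (fun p : measurableTypeR R * measurableTypeR R => f p.2 * (normal_pdf 0 1 ((p.2 - a * p.1) / b) / b)%:E)%E).
      apply: emeasurable_funM; first exact: measurableT_comp.
      apply/measurable_EFinP/measurable_funM => //.
      apply: measurableT_comp => //; apply: measurable_funM => //.
      by apply: measurable_funB => //; exact: measurable_funM.
    by move=> p; rewrite mule_ge0// lee_fin divr_ge0 ?normal_pdf_ge0// ltW.
  - move=> z; apply: integral_ge0 => y _.
    by rewrite mule_ge0// lee_fin divr_ge0 ?normal_pdf_ge0// ltW.
  apply: eq_integral => z _; rewrite muleC -ge0_integralZl//.
  - apply: eq_integral => y _; rewrite /G/= muleCA -EFinM mulrA//.
  - apply: emeasurable_funM; first exact: mf.
  apply/measurable_EFinP/measurable_funM => //.
    by apply: measurableT_comp => //; apply: measurable_funM => //; exact: measurable_funB.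
  - by move=> y _; rewrite mule_ge0// lee_fin divr_ge0 ?normal_pdf_ge0// ltW.
  - by rewrite lee_fin normal_pdf_ge0.
rewrite fubini_tonelli// ge0_integral_normal//.
apply: eq_integral => y _.
have pdf1 : (\int[leb]_z (normal_pdf 0 1 ((z - a * y) / b) / b)%:E = 1)%E.
  transitivity (\int[gam]_w cst 1%E w)%E.
    rewrite (@ge0_integral_normal_affine (a * y) (cst 1%E))//.
    by apply: eq_integral => z _; rewrite mul1e.
  rewrite integral_cst//= mul1e; exact: (@probability_setT _ _ _ gam).
transitivity (\int[leb]_z ((f y * (normal_pdf 0 1 y)%:E) * (normal_pdf 0 1 ((z - a * y) / b) / b)%:E))%E.
  by apply: eq_integral => z _; rewrite /G/= normal_pdf_rot -muleA -EFinM mulrA.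
rewrite ge0_integralZl ?pdf1 ?mule1//.
- apply/measurable_EFinP/measurable_funM => //.
  by apply: measurableT_comp => //; apply: measurable_funM => //; exact: measurable_funB.
- by move=> z _; rewrite lee_fin divr_ge0 ?normal_pdf_ge0// ltW.
- by rewrite mule_ge0// lee_fin normal_pdf_ge0.
Qed.

Let rot (p : measurableTypeR R * measurableTypeR R) : R := a * p.1 + b * p.2.
Let mrot : measurable_fun setT rot.
Proof. by apply: measurable_funD; exact: measurable_funM. Qed.

Let rotation_law (A : set R) : measurable A ->
  (gam \x gam)%E (rot @^-1` A) = gam A.
Proof.
move=> mA; have mrA : measurable (rot @^-1` A).
  by rewrite -[_ @^-1` _]setTI; exact: mrot.
transitivity (\int[(gam \x gam)%E]_p (\1_A (rot p))%:E)%E.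
  by rewrite (_ : (fun _ => _) = EFin \o \1_(rot @^-1` A))// integral_indic// setIT.
rewrite (fubini_tonelli1 (fun p => (\1_A (rot p))%:E)).
rewrite (ge0_integral_rotation (f := EFin \o \1_A)).
- by rewrite integral_indic// setIT.
- by apply/measurable_EFinP; exact: measurable_indic.
- by move=> x; rewrite lee_fin.
- by apply/measurable_EFinP; apply: measurableT_comp mrot => //; exact: measurable_indic.
- by move=> p; rewrite lee_fin.
Qed.

Lemma Rintegral_rotation (f : R -> R) : rint gam f ->
  (forall z, rint gam (fun w => f (a * z + b * w))) ->
  \int[gam]_z \int[gam]_w f (a * z + b * w) = \int[gam]_z f z.
Proof.
move=> fi fiz; have mf := rint_meas fi.
have fi2 : rint (gam \x gam)%E (fun p => f (rot p)).
  apply: (@law_rint _ _ _ gam _ _ (gam \x gam)%E idfun rot) => //; exact: measurable_id.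
rewrite -(@law_Rintegral _ _ _ gam _ _ (gam \x gam)%E idfun rot)//; last exact: measurable_id.
rewrite /Rintegral -integral12_prod_meas1//.
congr fine; apply: eq_integral => z _.
by rewrite /fubini_F fineK//; exact: integrable_fin_num (fiz z).
Qed.

End rotation.

(** * Moments of the Gaussian measure *)

Section gaussian_moments.
Context {R : realType}.
Local Notation gam := (normal_prob (0 : R) 1).
Implicit Types (a z : R).

Lemma expR_sub1_sub_id (w : R) : `|expR w - 1 - w| <= w ^+ 2 * expR `|w|.
Proof.
have h1 : 1 + w <= expR w := expR_ge1Dx w.
have h2 : expR w - 1 <= w * expR w.
  have := expR_ge1Dx (- w); rewrite expRN => h.
  have : (1 - w) * expR w <= (expR w)^-1 * expR w by rewrite ler_pM2r ?expR_gt0.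
  by rewrite mulVf ?gt_eqF ?expR_gt0//; lra.
rewrite ger0_norm; last lra.
have e0 := expR_gt0 w.
case: (lerP 0 w) => w0; first by rewrite ger0_norm// expr2 -mulrA; nra.
have : 1 <= expR `|w| by rewrite -[leLHS]expR0 ler_expR.
nra.
Qed.

(** With [w = a * z - a ^+ 2 / 2] and [|a| <= 1], one has [|w| <= |a| * exp |z|] and
    [exp |w| <= e * exp |z|], so the remainder [w ^+ 2 * exp |w|] is at most
    [a ^+ 2 * e * exp (3 * |z|)]. The added 1 pays for [a ^+ 2 / 2], the gap between [w] and
    [a * z]. *)
Definition shift_bound z : R := (expR 1 + 1) * expR (3 * `|z|).

Lemma shift_density_taylor a z : `|a| <= 1 ->
  `|shift_density a z - 1 - a * z| <= a ^+ 2 * shift_bound z.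
Proof.
move=> a1; rewrite /shift_density; set w := a * z - a ^+ 2 / 2.
have a2 : a ^+ 2 = `|a| ^+ 2 by rewrite real_normK ?num_real.
have z0 := normr_ge0 z; have a0 := normr_ge0 a.
have wa : `|w| <= `|a| * (`|z| + 1).
  rewrite (le_trans (ler_normB _ _))// normrM [X in _ + X]ger0_norm; last first.
    by rewrite divr_ge0// sqr_ge0.
  by rewrite a2; nra.
have ez : 1 + `|z| <= expR `|z| := expR_ge1Dx _.
have w2 : w ^+ 2 <= a ^+ 2 * (expR `|z|) ^+ 2.
  rewrite a2 -[w ^+ 2]real_normK ?num_real// -exprMn lerXn2r ?nnegrE//.
  rewrite (le_trans wa)// ler_wpM2l//; lra.
have ew : expR `|w| <= expR 1 * expR `|z|.
  rewrite -expRD ler_expR; nra.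
have h := expR_sub1_sub_id w.
have -> : expR w - 1 - a * z = (expR w - 1 - w) - a ^+ 2 / 2 by rewrite /w; field.
rewrite (le_trans (ler_normB _ _))// [X in _ + X]ger0_norm; last first.
  by rewrite divr_ge0// sqr_ge0.
have e3 : expR (3 * `|z|) = expR `|z| ^+ 2 * expR `|z|.
  by rewrite -exprSr -expRM_natl.
have h2 : w ^+ 2 * expR `|w| <= a ^+ 2 * (expR `|z|) ^+ 2 * (expR 1 * expR `|z|).
  by apply: ler_pM => //; rewrite ?sqr_ge0 ?expR_ge0.
have h3 : 1 <= expR (3 * `|z|) by rewrite -[leLHS]expR0 ler_expR mulr_ge0.
have h4 : 0 <= a ^+ 2 := sqr_ge0 a.
have h5 : a ^+ 2 <= a ^+ 2 * expR (3 * `|z|) by rewrite ler_peMr.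
rewrite /shift_bound.
have -> : a ^+ 2 * ((expR 1 + 1) * expR (3 * `|z|)) =
  a ^+ 2 * (expR `|z|) ^+ 2 * (expR 1 * expR `|z|) + a ^+ 2 * expR (3 * `|z|).
  by rewrite e3; ring.
have : a ^+ 2 / 2 <= a ^+ 2 by lra.
lra.
Qed.

Lemma measurable_shift_density_rest a :
  measurable_fun setT (fun z => shift_density a z - 1 - a * z).
Proof.
apply: measurable_funB; last exact: measurable_funM.
by apply: measurable_funB => //; exact: measurable_shift_density.
Qed.

(** The shift identity for the constant 1 gives exponential moments without computing an
    integral. *)
Lemma rint_expR a : rint gam (fun z => expR (a * z)).
Proof.
have : rint gam (fun z => cst 1 z * shift_density a z).
  by apply/(rint_shift a); [exact: measurable_cst|exact: rint_cst].
move=> /(rintZl (expR (a ^+ 2 / 2))); apply: rint_eq => z.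
by rewrite /= mul1r -expRD; congr expR; ring.
Qed.

Lemma rint_expR_norm a : 0 <= a -> rint gam (fun z => expR (a * `|z|)).
Proof.
move=> a0; apply: (@rint_le _ _ _ gam (fun z => expR (a * z) + expR (- a * z))).
- by apply: measurableT_comp => //; apply: measurable_funM.
- move=> z; rewrite [leLHS]ger0_norm ?expR_ge0//; case: (ger0P z) => z0.
    by rewrite lerDl expR_ge0.
  by rewrite mulrN -mulNr lerDr expR_ge0.
- by apply: rintD; exact: rint_expR.
Qed.

Lemma norm_le_expR z : `|z| <= expR `|z|.
Proof. by have := expR_ge1Dx `|z|; lra. Qed.

Lemma rint_normX_expR (k : nat) a : 0 <= a ->
  rint gam (fun z => `|z| ^+ k * expR (a * `|z|)).
Proof.
move=> a0; apply: (@rint_le _ _ _ gam (fun z => expR ((a + k%:R) * `|z|))).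
- apply: measurable_funM.
    by apply: measurable_funX; exact: normr_measurable.
  by apply: measurableT_comp => //; apply: measurable_funM => //; exact: normr_measurable.
- move=> z; rewrite [leLHS]ger0_norm ?mulr_ge0 ?expR_ge0 ?exprn_ge0//.
  rewrite mulrDl expRD mulrC ler_wpM2l ?expR_ge0// expRM_natl.
  by rewrite lerXn2r ?nnegrE ?expR_ge0 ?norm_le_expR.
- by apply: rint_expR_norm; rewrite addr_ge0.
Qed.

Lemma rint_normX (k : nat) : rint gam (fun z => `|z| ^+ k).
Proof.
apply: rint_eq (@rint_normX_expR k 0 (lexx _)) => z.
by rewrite mul0r expR0 mulr1.
Qed.

Lemma rint_shift_bound (k : nat) : rint gam (fun z => `|z| ^+ k * shift_bound z).
Proof.
have := rintZl (expR 1 + 1) (@rint_normX_expR k 3 (ler0n _ 3)).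
by apply: rint_eq => z; rewrite /shift_bound mulrCA.
Qed.

Lemma rint_id_normal : rint gam (fun z => z).
Proof.
by apply: rint_le (rint_normX 1) => // z; rewrite expr1.
Qed.

Lemma rint_sqr_normal : rint gam (fun z => z ^+ 2).
Proof.
by apply: rint_eq (rint_normX 2) => z; rewrite real_normK ?num_real.
Qed.

(* Both moments come from the first-order expansion in [a] of the shift identity
   applied to [1] and to [z]. *)
Let moment_aux (g : R -> R) (k : nat) : measurable_fun setT g ->
  (forall z, `|g z| = `|z| ^+ k) -> forall a, `|a| <= 1 ->
  `|\int[gam]_z g (a + z) - \int[gam]_z g z - a * \int[gam]_z (g z * z)| <=
  a ^+ 2 * \int[gam]_z (`|z| ^+ k * shift_bound z).
Proof.
move=> mg gk a a1.
have ig : rint gam g by apply: rint_le (rint_normX k) => // z; rewrite gk.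
have igz : rint gam (fun z => g z * z).
  apply: rint_le (rint_normX k.+1); first exact: measurable_funM.
  by move=> z; rewrite normrM gk exprSr.
have igr : rint gam (fun z => g z * (shift_density a z - 1 - a * z)).
  apply: rint_le (rintZl (a ^+ 2) (rint_shift_bound k)).
    by apply: measurable_funM => //; exact: measurable_shift_density_rest.
  move=> z; rewrite normrM gk mulrCA ler_wpM2l ?exprn_ge0//.
  exact: shift_density_taylor.
rewrite Rintegral_shift//.
have -> : \int[gam]_z (g z * shift_density a z) =
    \int[gam]_z (g z + a * (g z * z) + g z * (shift_density a z - 1 - a * z)).
  by apply: eq_Rintegral => z _; ring.
have igza := rintZl a igz.
rewrite !RintegralD//; last exact: rintD.
rewrite RintegralZl// (_ : _ - _ - _ = \int[gam]_z (g z * (shift_density a z - 1 - a * z))); last by ring.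
rewrite (le_trans (le_normr_Rintegral _ igr))// -RintegralZl//; last exact: rint_shift_bound.
apply: le_Rint; [exact: rint_norm|exact/rintZl/rint_shift_bound|].
move=> z; rewrite normrM gk mulrCA ler_wpM2l ?exprn_ge0//.
exact: shift_density_taylor.
Qed.

Let linear_bound0 (c K : R) : (forall a, 0 < a <= 1 -> `|a * c| <= a ^+ 2 * K) -> c = 0.
Proof.
move=> h; apply/eqP; rewrite -normr_eq0 eq_le normr_ge0 andbT leNgt; apply/negP => c0.
have K0 : 0 < K.
  by have := h 1; rewrite ltr01 lexx mul1r expr1n mul1r => /(_ isT); exact: lt_le_trans.
pose a := Num.min 1 (`|c| / (2 * K)).
have a0 : 0 < a by rewrite lt_min ltr01 divr_gt0// mulr_gt0.
have a1 : a <= 1 by rewrite ge_min lexx.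
have a2 : a * (2 * K) <= `|c| by rewrite -ler_pdivlMr ?mulr_gt0// ge_min lexx orbT.
have := h a; rewrite a0 a1 normrM gtr0_norm// => /(_ isT); nra.
Qed.

Lemma Rintegral_id_normal : \int[gam]_z z = 0.
Proof.
apply: (@linear_bound0 _ (\int[gam]_z (`|z| ^+ 0 * shift_bound z))) => a /andP[a0 a1].
have a1' : `|a| <= 1 by rewrite gtr0_norm.
have g1 z : `|cst (1 : R) z| = `|z| ^+ 0 by rewrite normr1.
have := moment_aux (measurable_cst _) g1 a1'.
rewrite /= !Rintegral_prob_cst subrr sub0r normrN.
have -> // : \int[gam]_z (1 * z) = \int[gam]_z z.
by apply: eq_Rintegral => z _; rewrite mul1r.
Qed.

Lemma Rintegral_sqr_normal : \int[gam]_z (z ^+ 2) = 1.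
Proof.
apply/esym/eqP; rewrite -subr_eq0; apply/eqP.
apply: (@linear_bound0 _ (\int[gam]_z (`|z| ^+ 1 * shift_bound z))) => a /andP[a0 a1].
have a1' : `|a| <= 1 by rewrite gtr0_norm.
have g1 z : `|idfun z| = `|z| ^+ 1 by [].
have := moment_aux (@measurable_id _ _ _) g1 a1'.
rewrite /= RintegralD//; [|exact: rint_cst|exact: rint_id_normal].
rewrite Rintegral_prob_cst addrK mulrBr mulr1 => h.
by apply: h.
Qed.

End gaussian_moments.

(** * Space and time expansions of the heat flow *)

Section heat.
Context {R : realType}.
Local Notation gam := (normal_prob (0 : R) 1).
Implicit Types (f g : R -> R) (t s x y : R).

Definition heat g t x := \int[gam]_z g (x + Num.sqrt t * z).

(* For [g = f'] this is the second space derivative of [heat f], by Gaussian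
   integration by parts. *)
Definition heat_dxx g t x :=
  (Num.sqrt t)^-1 * \int[gam]_z ((g (x + Num.sqrt t * z) - g x) * z).

Let maff x s : measurable_fun setT (fun z : R => x + s * z).
Proof. by apply: measurable_funD => //; exact: measurable_funM. Qed.

Let mlip g x s : lip1 g ->
  measurable_fun [set: measurableTypeR R] (fun z => g (x + s * z)).
Proof.
move=> lg; apply: (measurableT_comp (lip1_measurable lg)); exact: maff.
Qed.

Lemma lip1_rint g x s : lip1 g -> rint gam (fun z => g (x + s * z)).
Proof.
move=> lg; apply: (@rint_le _ _ _ gam (fun z => `|g x| + `|s| * `|z|)).
- exact: mlip.
- move=> z; have := lg (x + s * z) x; rewrite addrAC subrr add0r normrM.
  have := ler_normD (g (x + s * z) - g x) (g x); rewrite subrK; lra.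
- apply: rintD; first exact: rint_cst.
  by apply: rintZl; apply: rint_eq (rint_normX 1) => z; rewrite expr1.
Qed.

Lemma smooth1_rint_normal f f' x s : smooth1 f f' ->
  rint gam (fun z => f (x + s * z)).
Proof.
move=> sf; apply: (smooth1_rint sf); first exact: maff.
apply: rint_sqrD; [exact: measurable_cst|exact: measurable_funM|exact: rint_cst|].
by apply: rint_sqrZ; exact: rint_sqr_normal.
Qed.

Lemma heat_smooth1 f f' t : smooth1 f f' -> smooth1 (heat f t) (heat f' t).
Proof.
move=> sf; have [lf tf] := sf; split=> x y; rewrite /heat.
  rewrite -RintegralB//; [|exact: lip1_rint..].
  apply: (le_trans (le_normr_Rintegral _ _)) => //.
    by apply: rintB; exact: lip1_rint.
  rewrite -[leRHS](Rintegral_prob_cst gam); apply: le_Rint.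
  - by apply: rint_norm; apply: rintB; exact: lip1_rint.
  - exact: rint_cst.
  - by move=> z; rewrite (le_trans (lf _ _))// opprD addrACA subrr addr0.
have iy := smooth1_rint_normal y (Num.sqrt t) sf.
have ix := smooth1_rint_normal x (Num.sqrt t) sf.
have id := rintZr (y - x) (lip1_rint x (Num.sqrt t) lf).
rewrite -RintegralZr//; last exact: lip1_rint.
rewrite -!RintegralB//; last exact: rintB.
apply: (le_trans (le_normr_Rintegral _ _)) => //; first by do 2!apply: rintB => //.
rewrite -[leRHS](Rintegral_prob_cst gam); apply: le_Rint.
- by apply: rint_norm; do 2!apply: rintB => //.
- exact: rint_cst.
- move=> z; have := tf (x + Num.sqrt t * z) (y + Num.sqrt t * z).
  by rewrite (_ : y + _ - (x + _) = y - x)//; ring.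
Qed.

Lemma rint_heat_dxx g t x : lip1 g ->
  rint gam (fun z => (g (x + Num.sqrt t * z) - g x) * z).
Proof.
move=> lg; apply: (@rint_le _ _ _ gam (fun z => Num.sqrt t * `|z| ^+ 2)).
- by apply: measurable_funM => //; apply: measurable_funB => //; exact: mlip.
- move=> z; have := lg (x + Num.sqrt t * z) x; rewrite addrAC subrr add0r.
  rewrite !normrM (ger0_norm (sqrtr_ge0 t)) expr2 mulrA => h.
  by rewrite ler_wpM2r.
- by apply: rintZl; exact: rint_normX.
Qed.

Lemma heat_dxx_bound g t x : lip1 g -> `|heat_dxx g t x| <= 1.
Proof.
move=> lg; rewrite /heat_dxx normrM normfV (ger0_norm (sqrtr_ge0 t)).
(* For [t <= 0] the value of [heat_dxx] is 0, because [0^-1 = 0]. *)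
have := sqrtr_ge0 t; rewrite le_eqVlt => /predU1P[<-|t0].
  by rewrite invr0 mul0r.
rewrite mulrC ler_pdivrMr// mul1r.
apply: (le_trans (le_normr_Rintegral _ _)) => //; first exact: rint_heat_dxx.
apply: (@le_trans _ _ (\int[gam]_z (Num.sqrt t * z ^+ 2))).
  apply: le_Rint; [exact/rint_norm/rint_heat_dxx|exact/rintZl/rint_sqr_normal|].
  move=> z; have := lg (x + Num.sqrt t * z) x; rewrite addrAC subrr add0r.
  rewrite !normrM (ger0_norm (sqrtr_ge0 t)) -[z ^+ 2]real_normK ?num_real// => h.
  by rewrite expr2 mulrA ler_wpM2r.
by rewrite RintegralZl ?Rintegral_sqr_normal ?mulr1//; exact: rint_sqr_normal.
Qed.

(** The integral serves [|y| < sqrt t]; the summand 2 serves [|y| >= sqrt t], where the trivial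
    bound [2 * |y|] is enough. *)
Definition shift_cst : R := \int[gam]_z (`|z| ^+ 1 * shift_bound z) + 2.

Lemma shift_cst_ge2 : 2 <= shift_cst.
Proof.
rewrite /shift_cst lerDr; apply: Rintegral_ge0 => z _.
by rewrite mulr_ge0 ?exprn_ge0// mulr_ge0 ?expR_ge0// addr_ge0 ?expR_ge0.
Qed.

(** Write [y = sqrt t * a]. Translating by [y] amounts to shifting the Gaussian by [a], and the
    expansion of the shift density has an error of order [a ^+ 2]. Subtracting the constant [g x]
    leaves an integrand of size [sqrt t * |z|], whence [sqrt t * a ^+ 2 = y ^+ 2 / sqrt t]. *)
Lemma heat_dx_taylor g t x y : 0 < t -> lip1 g ->
  `|heat g t (x + y) - heat g t x - heat_dxx g t x * y| <=
  shift_cst * (y ^+ 2 / Num.sqrt t).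
Proof.
move=> t0 lg; set r := Num.sqrt t; have r0 : 0 < r by rewrite sqrtr_gt0.
have q0 : 0 <= y ^+ 2 / r by rewrite divr_ge0 ?sqr_ge0 ?ltW.
case: (lerP r `|y|) => [ry|yr].
  have h1 : `|heat g t (x + y) - heat g t x| <= `|y|.
    rewrite /heat -RintegralB//; [|exact: lip1_rint..].
    apply: (le_trans (le_normr_Rintegral _ _)) => //.
      by apply: rintB; exact: lip1_rint.
    rewrite -[leRHS](Rintegral_prob_cst gam); apply: le_Rint.
    - by apply: rint_norm; apply: rintB; exact: lip1_rint.
    - exact: rint_cst.
    - by move=> z; rewrite (le_trans (lg _ _))// opprD addrACA subrr addr0 addrAC subrr add0r.
  have h2 : `|heat_dxx g t x * y| <= `|y|.
    by rewrite normrM ler_piMl ?heat_dxx_bound.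
  have h3 : `|y| <= y ^+ 2 / r.
    by rewrite ler_pdivlMr// -[y ^+ 2]real_normK ?num_real// expr2 ler_wpM2l.
  rewrite (le_trans (ler_normB _ _))//.
  apply: (@le_trans _ _ (2 * (y ^+ 2 / r))); first lra.
  by rewrite ler_wpM2r// shift_cst_ge2.
set a := y / r; have ya : y = r * a by rewrite /a mulrC divfK ?gt_eqF.
have a1 : `|a| <= 1.
  by rewrite /a normrM normfV (gtr0_norm r0) ler_pdivrMr// mul1r ltW.
pose k z := g (x + r * z) - g x.
have mk : measurable_fun setT k.
  by apply: measurable_funB => //; exact: mlip.
have kz z : `|k z| <= r * `|z|.
  rewrite (le_trans (lg _ _))// addrAC subrr add0r normrM.
  by rewrite (gtr0_norm r0).
have ik : rint gam k by apply: rintB; [exact: lip1_rint|exact: rint_cst].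
have ikz : rint gam (fun z => k z * z) := rint_heat_dxx t x lg.
have ikr : rint gam (fun z => k z * (shift_density a z - 1 - a * z)).
  apply: rint_le (rintZl (r * a ^+ 2) (rint_shift_bound 1)).
    by apply: measurable_funM => //; exact: measurable_shift_density_rest.
  move=> z; rewrite normrM expr1.
  apply: (@le_trans _ _ ((r * `|z|) * (a ^+ 2 * shift_bound z))).
    by apply: ler_pM => //; exact: shift_density_taylor.
  by rewrite le_eqVlt; apply/orP; left; apply/eqP; ring.
have e1 : heat g t (x + y) - g x = \int[gam]_z (k z * shift_density a z).
  rewrite -Rintegral_shift// /heat -[in LHS](Rintegral_prob_cst gam (g x)).
  rewrite -RintegralB//; [|exact: lip1_rint|exact: rint_cst].
  apply: eq_Rintegral => z _; rewrite /k -/r; congr (g _ - _).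
  by rewrite ya; ring.
have e2 : heat g t x - g x = \int[gam]_z k z.
  rewrite /heat -[in LHS](Rintegral_prob_cst gam (g x)).
  by rewrite -RintegralB//; [exact: lip1_rint|exact: rint_cst].
have e3 : heat_dxx g t x * y = a * \int[gam]_z (k z * z).
  by rewrite /heat_dxx -/r -/(k _) /a; ring.
have -> : heat g t (x + y) - heat g t x - heat_dxx g t x * y =
    \int[gam]_z (k z * (shift_density a z - 1 - a * z)).
  have -> : heat g t (x + y) - heat g t x =
    (heat g t (x + y) - g x) - (heat g t x - g x) by ring.
  rewrite e1 e2 e3.
  have -> : \int[gam]_z (k z * shift_density a z) =
      \int[gam]_z (k z + a * (k z * z) + k z * (shift_density a z - 1 - a * z)).
    by apply: eq_Rintegral => z _; ring.
  have iakz := rintZl a ikz.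
  rewrite RintegralD//; last exact: rintD.
  by rewrite RintegralD// RintegralZl//; ring.
apply: (le_trans (le_normr_Rintegral _ _)) => //.
apply: (@le_trans _ _ (\int[gam]_z (r * a ^+ 2 * (`|z| ^+ 1 * shift_bound z)))).
  apply: le_Rint; [exact: rint_norm|exact/rintZl/rint_shift_bound|].
  move=> z; rewrite normrM expr1.
  apply: (@le_trans _ _ ((r * `|z|) * (a ^+ 2 * shift_bound z))).
    by apply: ler_pM => //; exact: shift_density_taylor.
  by rewrite le_eqVlt; apply/orP; left; apply/eqP; ring.
rewrite RintegralZl//; last exact: rint_shift_bound.
have -> : y ^+ 2 / r = r * a ^+ 2 by rewrite ya; field; rewrite gt_eqF.
rewrite mulrC; apply: ler_wpM2r; first by rewrite mulr_ge0 ?sqr_ge0 ?ltW.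
by rewrite /shift_cst lerDl.
Qed.

Definition lindeberg t y := y ^+ 2 * Num.min 1 (`|y| / Num.sqrt t).

Lemma lindeberg_ge0 t y : 0 <= lindeberg t y.
Proof. by rewrite mulr_ge0 ?sqr_ge0// le_min ler01 divr_ge0. Qed.

(** For [|y| >= sqrt t] the first-order remainder and the second-order term are each at most
    [y ^+ 2 / 2]. For smaller [y] the expansion of the derivative, [heat_dx_taylor], is integrated
    from [x] to [x + y]. *)
Lemma heat_taylor f f' t x y : 0 < t -> smooth1 f f' ->
  `|heat f t (x + y) - heat f t x - heat f' t x * y - heat_dxx f' t x * y ^+ 2 / 2|
  <= shift_cst * lindeberg t y.
Proof.
move=> t0 sf; have [lf _] := sf; have su := heat_smooth1 t sf.
have r0 : 0 < Num.sqrt t by rewrite sqrtr_gt0.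
have c2 := shift_cst_ge2.
rewrite /lindeberg; case: (lerP 1 (`|y| / Num.sqrt t)) => ry.
  rewrite mulr1.
  have := su.2 x (x + y); rewrite (_ : x + y - x = y); last by ring.
  have := heat_dxx_bound t x lf.
  set H := heat_dxx f' t x => hH h.
  have : `|H * y ^+ 2 / 2| <= y ^+ 2 / 2.
    rewrite normrM normrM (ger0_norm (sqr_ge0 y)) normfV (ger0_norm (ler0n _ 2)).
    by rewrite ler_pM2r ?invr_gt0// ler_piMl ?sqr_ge0.
  have := sqr_ge0 y; have := ler_normB (heat f t (x + y) - heat f t x - heat f' t x * y) (H * y ^+ 2 / 2).
  nra.
pose K := shift_cst / Num.sqrt t / 3.
(* The vanishing term [(x - x) ^+ 2] presents the remainder as an increment of a single function, as
   [derive_dist_le] requires. *)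
have -> : heat f t (x + y) - heat f t x - heat f' t x * y - heat_dxx f' t x * y ^+ 2 / 2 =
   (heat f t (x + y) - heat f' t x * (x + y) - heat_dxx f' t x / 2 * (x + y - x) ^+ 2) -
   (heat f t x - heat f' t x * x - heat_dxx f' t x / 2 * (x - x) ^+ 2) by field.
apply: (@le_trans _ _ (K * `|y| ^+ 3 - K * 0 ^+ 3)); last first.
  rewrite expr0n/= mulr0 subr0 exprS real_normK ?num_real// /K.
  have -> : shift_cst / Num.sqrt t / 3 * (`|y| * y ^+ 2) =
    (shift_cst * (y ^+ 2 * (`|y| / Num.sqrt t))) / 3 by field; rewrite gt_eqF.
  have : 0 <= shift_cst * (y ^+ 2 * (`|y| / Num.sqrt t)).
    by rewrite mulr_ge0 ?(le_trans _ c2)// mulr_ge0 ?sqr_ge0// divr_ge0.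
  lra.
apply: (derive_dist_le
  (f := fun r => heat f t r - heat f' t x * r - heat_dxx f' t x / 2 * (r - x) ^+ 2)
  (f' := fun r => heat f' t r - heat f' t x - heat_dxx f' t x * (r - x))
  (b := fun r => K * r ^+ 3) (b' := fun r => shift_cst * (r ^+ 2 / Num.sqrt t))) => [r|r|h].
- have h := smooth1_is_derive r su.
  have h2 (c : R) : is_derive r 1 (fun r : R => c * r) c.
    by apply: is_derive_eq; rewrite [_ *: 1]mulr1.
  have h3 (c : R) : is_derive r 1 (fun r : R => c / 2 * (r - x) ^+ 2) (c * (r - x)).
    by apply: is_derive_eq; rewrite /GRing.scale/=; field.
  exact: is_deriveB (is_deriveB h (h2 _)) (h3 _).
- by apply: is_derive_eq; rewrite /K /GRing.scale/=; field; rewrite gt_eqF.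
- rewrite (_ : x + h - x = h); last by ring.
  by rewrite real_normK ?num_real//; exact: heat_dx_taylor.
Qed.

Lemma heat_semigroup f f' t s x : 0 < t -> 0 <= s -> smooth1 f f' ->
  heat f (t + s) x = \int[gam]_z heat f t (x + Num.sqrt s * z).
Proof.
move=> t0 s0 sf; rewrite /heat.
set r := Num.sqrt (t + s); have r0 : 0 < r by rewrite sqrtr_gt0 ltr_wpDr.
have r2 : r ^+ 2 = t + s by rewrite sqr_sqrtr// addr_ge0// ltW.
have b0 : 0 < Num.sqrt t / r by rewrite divr_gt0// sqrtr_gt0.
have ab : (Num.sqrt s / r) ^+ 2 + (Num.sqrt t / r) ^+ 2 = 1.
  rewrite !exprMn !exprVn r2 !sqr_sqrtr ?(ltW t0)// -mulrDl [s + t]addrC divff//.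
  by rewrite -r2 gt_eqF// exprn_gt0.
rewrite -(@Rintegral_rotation _ _ _ b0 ab (fun z => f (x + r * z))).
- apply: eq_Rintegral => z _; apply: eq_Rintegral => w _; congr (f _).
  by field; rewrite gt_eqF.
- exact: smooth1_rint_normal sf.
- move=> z; apply: rint_eq (smooth1_rint_normal (x + Num.sqrt s * z) (Num.sqrt t) sf) => w.
  by congr (f _); field; rewrite gt_eqF.
Qed.

Lemma smooth1_heat_dist f f' s x : 0 <= s -> smooth1 f f' ->
  `|\int[gam]_z f (x + Num.sqrt s * z) - f x| <= s / 2.
Proof.
move=> s0 sf; have i1 := smooth1_rint_normal x (Num.sqrt s) sf.
have i2 := rintZl (f' x * Num.sqrt s) (@rint_id_normal R).
have i3 : rint gam (fun z => s / 2 * z ^+ 2) by apply: rintZl; exact: rint_sqr_normal.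
have -> : \int[gam]_z f (x + Num.sqrt s * z) - f x =
    \int[gam]_z (f (x + Num.sqrt s * z) - f x - f' x * Num.sqrt s * z).
  rewrite RintegralB//; last by apply: rintB => //; exact: rint_cst.
  rewrite RintegralB//; last exact: rint_cst.
  by rewrite RintegralZl ?Rintegral_id_normal ?mulr0 ?subr0 ?Rintegral_prob_cst//; exact: rint_id_normal.
have i4 : rint gam (fun z => f (x + Num.sqrt s * z) - f x - f' x * Num.sqrt s * z).
  by apply: rintB => //; apply: rintB => //; exact: rint_cst.
apply: (le_trans (le_normr_Rintegral _ _)) => //.
apply: (@le_trans _ _ (\int[gam]_z (s / 2 * z ^+ 2))); last first.
  by rewrite RintegralZl ?Rintegral_sqr_normal ?mulr1//; exact: rint_sqr_normal.
apply: le_Rint => //; first exact: rint_norm.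
move=> z; have := sf.2 x (x + Num.sqrt s * z).
rewrite (_ : x + Num.sqrt s * z - x = Num.sqrt s * z); last by ring.
by rewrite exprMn sqr_sqrtr// mulrA [s / 2 * _]mulrAC.
Qed.

(** The summands 1 and E|N|^3 come from averaging [s * z ^+ 2] and [s * sqrt (s / t) * |z| ^+ 3],
    the two branches of [lindeberg t (sqrt s * z)]. *)
Definition heat_cst : R := shift_cst * (1 + \int[gam]_z (`|z| ^+ 3)).

(** By the semigroup property a time increment [s] is a Gaussian space increment [sqrt s * z].
    Averaging [heat_taylor] over [z] kills the linear term and replaces [y ^+ 2] by [s]: the heat
    equation is obtained without a time derivative, and with the same second-order coefficient as in
    space. *)
Lemma heat_time_taylor f f' t s x : 0 < t -> 0 <= s -> smooth1 f f' ->
  `|heat f (t + s) x - heat f t x - heat_dxx f' t x * s / 2| <=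
  heat_cst * (s * Num.min 1 (Num.sqrt (s / t))).
Proof.
move=> t0 s0 sf; have [lf _] := sf; have su := heat_smooth1 t sf.
rewrite (heat_semigroup x t0 s0 sf).
set H := heat_dxx f' t x; set D := heat f' t x.
have i1 := smooth1_rint_normal x (Num.sqrt s) su.
have i0 := rint_cst gam (heat f t x).
have i2 := rintZl (D * Num.sqrt s) (@rint_id_normal R).
have i3 := rintZl (H * s / 2) (@rint_sqr_normal R).
pose k z := heat f t (x + Num.sqrt s * z) - heat f t x - D * Num.sqrt s * z - H * s / 2 * z ^+ 2.
have ik : rint gam k by do 3!apply: rintB => //.
have -> : \int[gam]_z heat f t (x + Num.sqrt s * z) - heat f t x - H * s / 2 = \int[gam]_z k z.
  rewrite /k RintegralB//; last by do 2!apply: rintB => //.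
  rewrite RintegralB//; last by apply: rintB.
  rewrite RintegralB// !RintegralZl ?Rintegral_id_normal ?Rintegral_sqr_normal ?Rintegral_prob_cst//;
    [ring|exact: rint_sqr_normal|exact: rint_id_normal].
have c0 : 0 <= shift_cst := le_trans (ler0n _ 2) shift_cst_ge2.
have kz z : `|k z| <= shift_cst * lindeberg t (Num.sqrt s * z).
  have := heat_taylor x (Num.sqrt s * z) t0 sf; rewrite /k -/H -/D.
  by rewrite exprMn sqr_sqrtr// (_ : H * (s * z ^+ 2) / 2 = H * s / 2 * z ^+ 2) ?[D * (_ * _)]mulrA//; ring.
have k1 z : `|k z| <= shift_cst * s * z ^+ 2.
  rewrite (le_trans (kz z))// /lindeberg exprMn sqr_sqrtr// -[leRHS]mulrA ler_wpM2l//.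
  apply: ler_piMr; first by rewrite mulr_ge0 ?sqr_ge0.
  by rewrite ge_min lexx.
have k2 z : `|k z| <= shift_cst * s * Num.sqrt (s / t) * `|z| ^+ 3.
  rewrite (le_trans (kz z))// /lindeberg exprMn sqr_sqrtr// -[leRHS]mulrA -[leRHS]mulrA ler_wpM2l//.
  rewrite -[leLHS]mulrA ler_wpM2l// [`|z| ^+ 3]exprSr real_normK ?num_real//.
  rewrite mulrCA ler_wpM2l ?sqr_ge0// normrM (ger0_norm (sqrtr_ge0 s)).
  rewrite sqrtrM//; by rewrite sqrtrV ?(ltW t0)// mulrAC ge_min lexx orbT.
apply: (le_trans (le_normr_Rintegral _ _)) => //.
rewrite /heat_cst; set c3 := \int[gam]_z (`|z| ^+ 3).
have c30 : 0 <= c3 by apply: Rintegral_ge0 => z _; rewrite exprn_ge0.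
have b1 : \int[gam]_z `|k z| <= shift_cst * s.
  have i := rintZl (shift_cst * s) (@rint_sqr_normal R).
  have := le_Rint (rint_norm ik) i k1.
  by rewrite RintegralZl ?Rintegral_sqr_normal ?mulr1//; exact: rint_sqr_normal.
have b2 : \int[gam]_z `|k z| <= shift_cst * s * Num.sqrt (s / t) * c3.
  have i := rintZl (shift_cst * s * Num.sqrt (s / t)) (@rint_normX R 3).
  have := le_Rint (rint_norm ik) i k2.
  by rewrite RintegralZl//; exact: rint_normX.
have cs0 : 0 <= shift_cst * s by rewrite mulr_ge0.
have e q : shift_cst * (1 + c3) * (s * q) = shift_cst * s * q + shift_cst * s * q * c3 by ring.
rewrite e.
case: (lerP 1 (Num.sqrt (s / t))) => h1.
  rewrite !mulr1 (le_trans b1)// lerDl mulr_ge0//.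
by rewrite (le_trans b2)// lerDr mulr_ge0// sqrtr_ge0.
Qed.

End heat.

(** * Predictable time change and the Lindeberg argument *)

Section parametric.
Context d (T : measurableType d) d' (T' : measurableType d') (R : realType).
Variable m : {sigma_finite_measure set T' -> \bar R}.

Lemma measurable_Rintegral_param (F : T * T' -> R) : measurable_fun setT F ->
  measurable_fun setT (fun w => \int[m]_z F (w, z)).
Proof.
move=> mF; have mEF : measurable_fun setT (EFin \o F) by exact/measurable_EFinP.
rewrite /Rintegral; apply: measurableT_comp => //.
rewrite (_ : (fun w => _) = (fun w => \int[m]_z (EFin \o F)^\+%E (w, z) -
    \int[m]_z (EFin \o F)^\-%E (w, z))%E).
  apply: emeasurable_funB.
    apply: (measurable_fun_fubini_tonelli_F (m2 := m) (EFin \o F)^\+%E) => //.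
    exact: measurable_funepos.
  apply: (measurable_fun_fubini_tonelli_F (m2 := m) (EFin \o F)^\-%E) => //.
  exact: measurable_funeneg.
apply/funext => w; rewrite integralE; congr (_ - _)%E.
  by apply: eq_integral => z _; rewrite !funeposE.
by apply: eq_integral => z _; rewrite !funenegE.
Qed.

End parametric.

(** * Measurability and conditioning with respect to a sub-sigma-algebra *)

Section measurable_wrt.
Context d (T : measurableType d) (R : realType).
Implicit Types (G H : set (set T)) (a : T -> R).

(** Stated on the type whose sigma-algebra is generated by [G], so that the closure properties of
    measurable functions apply verbatim; for a sigma-algebra [G] nothing is added by generation. *)
Definition measurable_wrt G a := measurable_fun [set: g_sigma_algebraType G] a.

Lemma measurable_wrt_sub G H a : G `<=` H -> measurable_wrt G a -> measurable_wrt H a.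
Proof. by move=> GH ma mT A mA; apply: (sub_sigma_algebra2 GH); exact: ma. Qed.

Lemma measurable_wrtT G a : G `<=` measurable -> measurable_wrt G a -> measurable_fun setT a.
Proof.
move=> GH ma mT A mA; have := ma measurableT A mA.
by apply: smallest_sub => //; exact: sigma_algebra_measurable.
Qed.

Lemma preimage_measurable_wrt G a : g_sigma_algebra_preimage a `<=` G ->
  measurable_wrt G a.
Proof.
move=> aG mT A mA; apply: sub_sigma_algebra; apply: aG.
exists A => //.
Qed.

Lemma measurable_sqrt (D : set T) a : measurable_fun D a ->
  measurable_fun D (fun w => Num.sqrt (a w)).
Proof.
move=> ma; apply: measurableT_comp ma; apply: continuous_measurable_fun.
exact: sqrt_continuous.
Qed.

Lemma measurable_sqrt_inv (D : set T) a : measurable_fun D a ->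
  measurable_fun D (fun w => (Num.sqrt (a w))^-1).
Proof.
move=> ma; rewrite (_ : (fun w => _) = (fun w => Num.sqrt (a w) `^ (-1))).
  apply: (measurableT_comp (measurable_powR _)).
  exact: measurable_sqrt.
by apply/funext => w; rewrite powR_inv1 ?sqrtr_ge0.
Qed.

End measurable_wrt.

Section conditional.
Context d (T : measurableType d) (R : realType) (P : probability T R).
Variables (G : set (set T)) (sG : sigma_algebra setT G) (GT : G `<=` measurable).
Variables (X Z : T -> R).
Hypotheses (iX : rint P X) (iZ : rint P Z).
Hypothesis XZ : forall A, G A -> (\int[P]_(w in A) (Z w)%:E = \int[P]_(w in A) (X w)%:E)%E.

Let GE (A : set T) : (<<s G >>) A -> G A.
Proof. by rewrite sigma_algebra_id. Qed.

Let indicXZ A : G A -> \int[P]_w (\1_A w * X w) = \int[P]_w (\1_A w * Z w).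
Proof.
move=> GA; congr fine.
transitivity (\int[P]_(w in A) (X w)%:E)%E.
  rewrite [RHS]integral_mkcond; apply: eq_integral => w _.
  by rewrite patchE indicE; case: ifP; rewrite ?mul1r ?mul0r.
rewrite -XZ// [LHS]integral_mkcond; apply: eq_integral => w _.
by rewrite patchE indicE; case: ifP; rewrite ?mul1r ?mul0r.
Qed.

Import HBNNSimple.

Let nnsfunXZ (h : {nnsfun g_sigma_algebraType G >-> R}) :
  \int[P]_w (h w * X w) = \int[P]_w (h w * Z w).
Proof.
have Gh r : G (h @^-1` [set r]).
  by apply: GE; rewrite -[_ @^-1` _]setTI; exact: (measurable_funP h).
have iI (A : set T) (V : T -> R) r : G A -> rint P V -> rint P (fun w => r * (\1_A w * V w)).
  move=> GA iV; apply: rintZl; apply: (@rint_le _ _ _ P (fun w => `|V w|)).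
  - apply: measurable_funM; [exact: measurable_indic (GT GA)|exact: rint_meas iV].
  - by move=> w; rewrite normrM indicE ger0_norm// ler_piMl// lern1; case: (_ \in _).
  - exact: rint_norm.
have hE (V : T -> R) : rint P V -> \int[P]_w (h w * V w) =
    \sum_(r <- finmap.enum_fset (fset_set (range h))) r * \int[P]_w (\1_(h @^-1` [set r]) w * V w).
  move=> iV.
  transitivity (\int[P]_w (\sum_(r <- finmap.enum_fset (fset_set (range h))) r * (\1_(h @^-1` [set r]) w * V w))).
    apply: eq_Rintegral => w _; rewrite fimfunE fsbig_finite//= mulr_suml.
    by apply: eq_bigr => r _; rewrite mulrA.
  rewrite Rintegral_sum; last by move=> r _; exact: iI.
  apply: eq_bigr => r _; rewrite RintegralZl//.
  by apply: rint_eq (iI _ V 1 (Gh r) iV) => w; rewrite mul1r.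
by rewrite !hE//; apply: eq_bigr => r _; rewrite indicXZ.
Qed.

Let ge0XZ (a : T -> R) : measurable_wrt G a -> (forall w, 0 <= a w) ->
  rint P (fun w => a w * X w) -> rint P (fun w => a w * Z w) ->
  \int[P]_w (a w * X w) = \int[P]_w (a w * Z w).
Proof.
move=> ma a0 iaX iaZ.
have mEa : measurable_fun [set: g_sigma_algebraType G] (EFin \o a).
  exact/measurable_EFinP.
pose h := nnsfun_approx measurableT mEa.
have hm n : measurable_fun [set: T] (h n : T -> R).
  exact: measurable_wrtT GT (measurable_funP (h n)).
have cvgh w : h n w @[n --> \oo] --> a w.
  have a0' x : setT x -> (0 <= (EFin \o a) x)%E by move=> _; rewrite lee_fin.
  exact: (fine_cvg (cvg_nnsfun_approx measurableT mEa a0' (x := w) I)).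
have ha n w : h n w <= a w.
  rewrite -(cvg_lim _ (cvgh w))//; apply: nondecreasing_cvgn_le.
    by move=> i j ij; exact/lefP/nd_nnsfun_approx.
  by apply/cvg_ex; exists (a w).
have lim (V : T -> R) : rint P V -> rint P (fun w => a w * V w) ->
    (\int[P]_w (h n w * V w)%:E @[n --> \oo] --> \int[P]_w (a w * V w)%:E)%E.
  move=> iV iaV; apply: (@dominated_cvg _ _ _ P setT measurableT
    (fun n w => (h n w * V w)%:E) (fun w => (a w * V w)%:E) (fun w => `|a w * V w|%:E)).
  - by move=> n; apply/measurable_EFinP; apply: measurable_funM => //; exact: rint_meas iV.
  - by move=> w _; apply: cvg_EFin; [exact: nearW|apply: cvgM => //; exact: cvg_cst].
  - by [].
  - exact: rint_norm iaV.
  - move=> n w _; rewrite lee_fin !normrM ler_wpM2r// !ger0_norm//.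
have ihV n (V : T -> R) : rint P V -> rint P (fun w => a w * V w) ->
    rint P (fun w => h n w * V w).
  move=> iV iaV; apply: rint_le (rint_norm iaV).
    by apply: measurable_funM => //; exact: rint_meas iV.
  by move=> w; rewrite !normrM ler_wpM2r// !ger0_norm.
congr fine; apply: (cvg_unique _ (lim X iX iaX)) => //.
rewrite (_ : (fun n => _) = (fun n => \int[P]_w (h n w * Z w)%:E)%E); first exact: lim.
apply/funext => n; rewrite -!EFin_Rintegral; [|exact: ihV..].
by rewrite nnsfunXZ.
Qed.

(** Indicators, then simple functions, then dominated convergence with the dominating function
    [|a * V|], then positive and negative parts. The integrability of the products is assumed in
    place of a bound on [a], since the coefficient of the martingale increment in [step_le] is
    unbounded. *)
Lemma conditional_mul (a : T -> R) : measurable_wrt G a ->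
  rint P (fun w => a w * X w) -> rint P (fun w => a w * Z w) ->
  \int[P]_w (a w * X w) = \int[P]_w (a w * Z w).
Proof.
move=> ma iaX iaZ.
pose p w := Num.max (a w) 0; pose q w := Num.max (- a w) 0.
have aE w : a w = p w - q w.
  by rewrite /p /q; case: (lerP (a w) 0) => h; case: (lerP (- a w) 0) => h'; lra.
have p0 w : 0 <= p w by rewrite /p le_max lexx orbT.
have q0 w : 0 <= q w by rewrite /q le_max lexx orbT.
have mp : measurable_wrt G p by apply: measurable_maxr.
have mq : measurable_wrt G q by apply: measurable_maxr => //; exact: measurable_funN.
have ile (V b : T -> R) : rint P V -> measurable_wrt G b -> (forall w, `|b w| <= `|a w|) ->
    rint P (fun w => a w * V w) -> rint P (fun w => b w * V w).
  move=> iV mb ba iaV; apply: rint_le (rint_norm iaV).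
    by apply: measurable_funM; [exact: measurable_wrtT mb|exact: rint_meas iV].
  by move=> w; rewrite !normrM ler_wpM2r.
have pa w : `|p w| <= `|a w|.
  by rewrite ger0_norm// /p; have := normr_ge0 (a w); have := ler_norm (a w); case: (lerP (a w) 0); lra.
have qa w : `|q w| <= `|a w|.
  by rewrite ger0_norm// /q -normrN; have := normr_ge0 (- a w); have := ler_norm (- a w); case: (lerP (- a w) 0); lra.
have e V : rint P V -> rint P (fun w => a w * V w) -> \int[P]_w (a w * V w) =
    \int[P]_w (p w * V w) - \int[P]_w (q w * V w).
  move=> iV iaV; rewrite -RintegralB//; [|exact: ile..].
  by apply: eq_Rintegral => w _; rewrite -mulrBl -aE.
by rewrite !e//; congr (_ - _); apply: ge0XZ => //; exact: ile.
Qed.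

End conditional.

Section heat_measurable.
Context {R : realType}.
Local Notation gam := (normal_prob (0 : R) 1).

Lemma measurable_heat d (T : measurableType d) (g : R -> R) (t S : T -> R) :
  measurable_fun setT g -> measurable_fun setT t -> measurable_fun setT S ->
  measurable_fun setT (fun w => heat g (t w) (S w)).
Proof.
move=> mg mt mS.
apply: (@measurable_Rintegral_param _ _ _ _ _ gam
  (fun p : T * measurableTypeR R => g (S p.1 + Num.sqrt (t p.1) * p.2))).
apply: (measurableT_comp mg); apply: measurable_funD.
  exact: (measurableT_comp mS).
apply: measurable_funM => //.
exact: measurable_sqrt (measurableT_comp mt _).
Qed.

Lemma measurable_heat_dxx d (T : measurableType d) (g : R -> R) (t S : T -> R) :
  measurable_fun setT g -> measurable_fun setT t -> measurable_fun setT S ->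
  measurable_fun setT (fun w => heat_dxx g (t w) (S w)).
Proof.
move=> mg mt mS; apply: measurable_funM; first exact: measurable_sqrt_inv.
apply: (@measurable_Rintegral_param _ _ _ _ _ gam
  (fun p : T * measurableTypeR R =>
     (g (S p.1 + Num.sqrt (t p.1) * p.2) - g (S p.1)) * p.2)).
apply: measurable_funM => //; apply: measurable_funB; last first.
  by apply: (measurableT_comp mg); exact: (measurableT_comp mS).
apply: (measurableT_comp mg); apply: measurable_funD.
  exact: (measurableT_comp mS).
apply: measurable_funM => //.
exact: measurable_sqrt (measurableT_comp mt _).
Qed.

Lemma measurable_lindeberg d (T : measurableType d) (t S : T -> R) :
  measurable_fun setT t -> measurable_fun setT S ->
  measurable_fun setT (fun w => lindeberg (t w) (S w)).
Proof.
move=> mt mS; apply: measurable_funM; first exact: measurable_funX.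
apply: measurable_minr => //; apply: measurable_funM; last exact: measurable_sqrt_inv.
exact: measurableT_comp.
Qed.

Lemma heat_lip1_dist (g : R -> R) t x : lip1 g ->
  `|heat g t x - g x| <= Num.sqrt t * \int[gam]_z `|z| ^+ 1.
Proof.
move=> lg; have i0 := rint_cst gam (g x).
have i1 := lip1_rint x (Num.sqrt t) lg.
have -> : heat g t x - g x = \int[gam]_z (g (x + Num.sqrt t * z) - g x).
  by rewrite RintegralB// Rintegral_prob_cst.
apply: (le_trans (le_normr_Rintegral _ _)) => //; first exact: rintB.
rewrite -RintegralZl//; last exact: rint_normX.
apply: le_Rint; [exact/rint_norm/rintB|exact/rintZl/rint_normX|].
move=> z; rewrite (le_trans (lg _ _))// addrAC subrr add0r normrM expr1.
by rewrite (ger0_norm (sqrtr_ge0 t)).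
Qed.

Lemma lindeberg_le (t y : R) : lindeberg t y <= y ^+ 2.
Proof. by rewrite ler_piMr ?sqr_ge0// ge_min lexx. Qed.

Lemma shift_cst_le_heat_cst : @shift_cst R <= @heat_cst R.
Proof.
have := @shift_cst_ge2 R => c2; rewrite /heat_cst mulrDr mulr1 lerDl mulr_ge0 ?(le_trans _ c2)//.
by apply: Rintegral_ge0 => z _; rewrite exprn_ge0.
Qed.

End heat_measurable.

(** * Comparison of truncations at neighbouring times *)

Section truncation_arithmetic.
Context {R : realType}.
Implicit Types t v y tau : R.

Lemma min1_double (x z : R) : 0 <= z -> x <= 2 * z -> Num.min 1 x <= 2 * Num.min 1 z.
Proof.
by move=> z0 xz; case: (lerP 1 z) => h1; case: (lerP 1 x) => h2; lra.
Qed.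

Lemma sqrt_le_double t v : 0 <= t -> v <= 4 * t -> Num.sqrt v <= 2 * Num.sqrt t.
Proof.
move=> t0 vt; have -> : 2 * Num.sqrt t = Num.sqrt (4 * t).
  have -> : (4 : R) = 2 ^+ 2 by ring.
  by rewrite sqrtrM ?sqr_ge0// sqrtr_sqr ger0_norm.
by rewrite ler_wsqrtr.
Qed.

(** If [y ^+ 2 <= v / 4] the first term suffices. Otherwise [sqrt v < 2 * |y|], so the truncation by
    [v] is at most twice the one by [y]. A coefficient below 1 in front of [v] is what allows the
    absorption in [err_le]. *)
Lemma sqr_truncation_le t v y : 0 < t -> 0 <= v ->
  y ^+ 2 * Num.min 1 (Num.sqrt (v / t)) <=
  v * Num.min 1 (Num.sqrt (v / t)) / 4 + 2 * lindeberg t y.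
Proof.
move=> t0 v0; have b0 : 0 <= Num.min 1 (Num.sqrt (v / t)).
  by rewrite le_min ler01 sqrtr_ge0.
have l0 := lindeberg_ge0 t y.
case: (lerP (y ^+ 2) (v / 4)) => [h|h]; first by nra.
have s0 : 0 < Num.sqrt t by rewrite sqrtr_gt0.
have hb : Num.min 1 (Num.sqrt (v / t)) <= 2 * Num.min 1 (`|y| / Num.sqrt t).
  apply: min1_double; first by rewrite divr_ge0.
  rewrite sqrtrM// sqrtrV ?(ltW t0)// mulrA ler_pM2r ?invr_gt0//.
  by rewrite -sqrtr_sqr; apply: sqrt_le_double; [exact: sqr_ge0|lra].
have : y ^+ 2 * Num.min 1 (Num.sqrt (v / t)) <= 2 * lindeberg t y.
  by rewrite /lindeberg mulrCA ler_wpM2l ?sqr_ge0.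
have := mulr_ge0 v0 b0; lra.
Qed.

Lemma half_le_min1_sqrt t v : 0 < t -> t / 2 <= v ->
  2^-1 <= Num.min 1 (Num.sqrt (v / t)).
Proof.
move=> t0 tv; rewrite le_min invf_le1 ?ltr0n// ler1n/=.
have : Num.sqrt 1 <= 2 * Num.sqrt (v / t).
  apply: sqrt_le_double; first by rewrite divr_ge0 ?(ltW t0)//; lra.
  by rewrite mulrA ler_pdivlMr//; lra.
by rewrite sqrtr1; lra.
Qed.

Lemma lindeberg_shift_le t tau y : 0 < t -> tau < t ->
  lindeberg (t - tau) y <= 2 * lindeberg t y + (if t / 2 < tau then 1 else 0) * y ^+ 2.
Proof.
move=> t0 taut; have l0 := lindeberg_ge0 t y.
case: ifPn => [_|].
  by rewrite mul1r (le_trans (lindeberg_le _ _))// lerDr mulr_ge0.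
rewrite -leNgt => h; rewrite mul0r addr0 /lindeberg mulrCA ler_wpM2l ?sqr_ge0//.
have t'0 : 0 < t - tau by rewrite subr_gt0.
have s0 : 0 < Num.sqrt t by rewrite sqrtr_gt0.
have s'0 : 0 < Num.sqrt (t - tau) by rewrite sqrtr_gt0.
apply: min1_double; first by rewrite divr_ge0.
have -> : 2 * (`|y| / Num.sqrt t) = `|y| * (2 / Num.sqrt t) by ring.
rewrite ler_wpM2l// ler_pdivlMr// mulrC ler_pdivrMr//.
by apply: sqrt_le_double; [exact: ltW|lra].
Qed.

Lemma time_truncation_le t v tau : 0 < t -> 0 <= tau <= v -> tau < t ->
  tau * Num.min 1 (Num.sqrt (tau / (t - tau))) <=
  2 * (v * Num.min 1 (Num.sqrt (v / t))).
Proof.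
move=> t0 /andP[tau0 tauv] taut; have v0 := le_trans tau0 tauv.
have t'0 : 0 < t - tau by rewrite subr_gt0.
have b0 : 0 <= Num.min 1 (Num.sqrt (v / t)) by rewrite le_min ler01 sqrtr_ge0.
case: (lerP tau (t / 2)) => h; last first.
  have := half_le_min1_sqrt t0 (le_trans (ltW h) tauv).
  have : tau * Num.min 1 (Num.sqrt (tau / (t - tau))) <= tau.
    by rewrite ler_piMr// ge_min lexx.
  nra.
have : Num.min 1 (Num.sqrt (tau / (t - tau))) <= 2 * Num.min 1 (Num.sqrt (v / t)).
  apply: min1_double; first exact: sqrtr_ge0.
  apply: sqrt_le_double; first by rewrite divr_ge0// ltW.
  rewrite ler_pdivrMr// mulrAC mulrA ler_pdivlMr//; nra.
have : 0 <= Num.min 1 (Num.sqrt (tau / (t - tau))) by rewrite le_min ler01 sqrtr_ge0.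
nra.
Qed.

End truncation_arithmetic.

(** * Telescoping of square roots *)

Section telescoping.
Context {R : realType}.
Variables (t : nat -> R) (n : nat).
Hypotheses (t0 : forall i, 0 < t i) (tS : forall i, t i.+1 <= t i).

Let step_sqrt i : (t i - t i.+1) / Num.sqrt (t i) <=
  2 * (Num.sqrt (t i) - Num.sqrt (t i.+1)).
Proof.
have s0 : 0 < Num.sqrt (t i) by rewrite sqrtr_gt0.
have s1 : 0 <= Num.sqrt (t i.+1) := sqrtr_ge0 _.
have s2 : Num.sqrt (t i.+1) <= Num.sqrt (t i) by rewrite ler_wsqrtr.
rewrite ler_pdivrMr// -{1}(sqr_sqrtr (ltW (t0 i))) -{1}(sqr_sqrtr (ltW (t0 i.+1))).
nra.
Qed.

Lemma sum_step_sqrt_le : \sum_(0 <= i < n) (t i - t i.+1) / Num.sqrt (t i) <=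
  2 * (Num.sqrt (t 0) - Num.sqrt (t n)).
Proof.
apply: (@le_trans _ _ (\sum_(0 <= i < n) 2 * (Num.sqrt (t i) - Num.sqrt (t i.+1)))).
  by apply: ler_sum => i _; exact: step_sqrt.
rewrite -mulr_sumr (telescope_sumr_eq (fun i => - Num.sqrt (t i)))//.
  by rewrite opprK addrC.
by move=> i _; rewrite opprK addrC.
Qed.

(** Telescopes [min (sqrt t) l] in place of [sqrt t]: its total decrease is at most [l], and it
    equals [sqrt t] on the steps that are counted. *)
Lemma sum_step_sqrt_lt (l : R) : 0 <= l ->
  \sum_(0 <= i < n) (t i - t i.+1) / Num.sqrt (t i) * (Num.sqrt (t i) < l)%R%:R <= 2 * l.
Proof.
move=> l0; pose g i := Num.min (Num.sqrt (t i)) l.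
have gS i : g i.+1 <= g i.
  by rewrite /g le_min !ge_min lexx orbT andbT ler_wsqrtr.
apply: (@le_trans _ _ (\sum_(0 <= i < n) 2 * (g i - g i.+1))).
  apply: ler_sum => i _; have s2 : Num.sqrt (t i.+1) <= Num.sqrt (t i) by rewrite ler_wsqrtr.
  case: (ltP (Num.sqrt (t i)) l) => h.
    rewrite mulr1 /g (min_idPl (ltW h)) (min_idPl (le_trans s2 (ltW h))).
    exact: step_sqrt.
  by rewrite mulr0 mulr_ge0// subr_ge0.
rewrite -mulr_sumr (telescope_sumr_eq (fun i => - g i))//; last first.
  by move=> i _; rewrite opprK addrC.
have g0 : g 0%N <= l by rewrite /g ge_min lexx orbT.
have gn : 0 <= g n by rewrite /g le_min sqrtr_ge0.
lra.
Qed.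

End telescoping.

(** * The Lindeberg argument for increments with predictable variances *)

Section lindeberg_argument.
Context d (T : measurableType d) (R : realType) (P : probability T R).
Local Notation gam := (normal_prob (0 : R) 1).
Local Notation E f := (Rintegral P setT f).
Variables (n : nat) (F : nat -> set (set T)) (Y v : nat -> T -> R).
Hypothesis FT : forall i, (i <= n)%N -> F i `<=` measurable.
Hypothesis FF : forall i j, (i <= j <= n)%N -> F i `<=` F j.
Hypothesis mY : forall k, (k < n)%N -> measurable_wrt (F k.+1) (Y k.+1).
Hypothesis mv : forall k, (k < n)%N -> measurable_wrt (F k) (v k.+1).
Hypothesis Y2 : forall k, (k < n)%N -> rint P (fun w => Y k.+1 w ^+ 2).
Hypothesis iv : forall k, (k < n)%N -> rint P (v k.+1).
Hypothesis v0 : forall k w, 0 <= v k w.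
Hypothesis EY : forall k a, (k < n)%N -> measurable_wrt (F k) a ->
  rint P (fun w => a w * Y k.+1 w) -> E (fun w => a w * Y k.+1 w) = 0.
Hypothesis EY2 : forall k a (c : R), (k < n)%N -> measurable_wrt (F k) a ->
  (forall w, `|a w| <= c) ->
  E (fun w => a w * Y k.+1 w ^+ 2) = E (fun w => a w * v k.+1 w).

Definition partial_sum (X : nat -> T -> R) k w := \sum_(1 <= i < k.+1) X i w.

Lemma partial_sumS X k w : partial_sum X k.+1 w = partial_sum X k w + X k.+1 w.
Proof. by rewrite /partial_sum big_nat_recr. Qed.

Lemma partial_sum0 X w : partial_sum X 0 w = 0.
Proof. by rewrite /partial_sum big_geq. Qed.

Local Notation S := (partial_sum Y).
Local Notation q := (partial_sum v).

Variables (kappa : R) (kappa0 : 0 < kappa).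

(* A predictable clock for the heat flow: the conditional variance that is still to
   come, were the total exactly 1, above the base level [kappa ^+ 2]. *)
Definition time_left k w := kappa ^+ 2 + Num.max 0 (1 - q k w).
Local Notation t := time_left.
Definition time_step k w := t k w - t k.+1 w.
Local Notation tau := time_step.

Let mwT k (a : T -> R) : (k <= n)%N -> measurable_wrt (F k) a -> measurable_fun setT a.
Proof. by move=> kn; apply: measurable_wrtT; exact: FT. Qed.

Let mwS k (a : T -> R) : (k < n)%N -> measurable_wrt (F k) a -> measurable_wrt (F k.+1) a.
Proof. by move=> kn; apply: measurable_wrt_sub; apply: FF; rewrite leqnSn. Qed.

Let mS k : (k <= n)%N -> measurable_wrt (F k) (S k).
Proof.
elim: k => [_|k ih kn].
  rewrite (_ : S 0 = cst 0); first exact: measurable_cst.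
  by apply/funext => w; rewrite partial_sum0.
rewrite (_ : S k.+1 = (fun w => S k w + Y k.+1 w)); last first.
  by apply/funext => w; rewrite partial_sumS.
by apply: measurable_funD; [exact: mwS (ih (ltnW kn))|exact: mY].
Qed.

Let mq k : (k < n)%N -> measurable_wrt (F k) (q k) /\ measurable_wrt (F k) (q k.+1).
Proof.
have mS1 j : (j < n)%N -> measurable_wrt (F j) (q j) -> measurable_wrt (F j) (q j.+1).
  move=> jn h; rewrite (_ : q j.+1 = (fun w => q j w + v j.+1 w)); last first.
    by apply/funext => w; rewrite partial_sumS.
  by apply: measurable_funD => //; exact: mv.
elim: k => [kn|k ih kn].
  have h : measurable_wrt (F 0%N) (q 0).
    rewrite (_ : q 0 = cst 0); first exact: measurable_cst.
    by apply/funext => w; rewrite partial_sum0.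
  by split=> //; exact: mS1.
have [_ h] := ih (ltnW kn).
have h' : measurable_wrt (F k.+1) (q k.+1) by apply: mwS => //; exact: ltnW.
by split=> //; exact: mS1.
Qed.

(** The clock is predictable: [t k.+1] is known before the increment [Y k.+1]. Step k can thus be
    expanded at the later time [t k.+1], with coefficients independent of that increment in the
    conditional sense. *)
Let mt k : (k < n)%N -> measurable_wrt (F k) (t k) /\ measurable_wrt (F k) (t k.+1).
Proof.
move=> /mq[h1 h2].
by split; apply: measurable_funD => //; apply: measurable_maxr => //; exact: measurable_funB.
Qed.

Let mtau k : (k < n)%N -> measurable_wrt (F k) (tau k).
Proof. by move=> /mt[h1 h2]; exact: measurable_funB. Qed.

Let mtn k : (k <= n)%N -> measurable_fun setT (t k).
Proof.
case: k => [_|k kn].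
  apply: measurable_funD => //; apply: measurable_maxr => //; apply: measurable_funB => //.
  rewrite (_ : q 0 = cst 0); first exact: measurable_cst.
  by apply/funext => w; rewrite partial_sum0.
by apply: (@mwT k); [exact: ltnW|exact: (mt kn).2].
Qed.

Lemma partial_sum_le k w : q k w <= q k.+1 w.
Proof. by rewrite partial_sumS lerDl v0. Qed.

Lemma partial_sum_ge0 k w : 0 <= q k w.
Proof. by rewrite /partial_sum; apply: sumr_ge0 => i _; exact: v0. Qed.

Lemma time_left_ge k w : kappa ^+ 2 <= t k w.
Proof. by rewrite /t lerDl le_max lexx. Qed.

Lemma time_left_gt0 k w : 0 < t k w.
Proof. by apply: lt_le_trans (time_left_ge k w); rewrite exprn_gt0. Qed.

Lemma time_left_le k w : t k w <= kappa ^+ 2 + 1.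
Proof. by rewrite /t lerD2l ge_max ler01/= gerBl partial_sum_ge0. Qed.

Lemma time_step_ge0 k w : 0 <= tau k w.
Proof.
have := partial_sum_le k w; rewrite /tau /t => h.
by case: (lerP 0 (1 - q k w)); case: (lerP 0 (1 - q k.+1 w)); lra.
Qed.

Lemma time_step_le k w : tau k w <= v k.+1 w.
Proof.
rewrite /tau /t partial_sumS; have := v0 k.+1 w.
by case: (lerP 0 (1 - q k w)); case: (lerP 0 (1 - (q k w + v k.+1 w))); lra.
Qed.

Let iY k : (k < n)%N -> rint P (Y k.+1).
Proof. by move=> kn; apply: rint_sqr (Y2 kn); apply: (mwT kn (mY kn)). Qed.

Let iS2 k : (k <= n)%N -> rint P (fun w => S k w ^+ 2).
Proof.
elim: k => [_|k ih kn].
  by apply: rint_eq (rint_cst P 0) => w; rewrite partial_sum0 expr0n.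
apply: (@rint_eq _ _ _ _ (fun w => (S k w + Y k.+1 w) ^+ 2)).
  by move=> w; rewrite partial_sumS.
apply: rint_sqrD; [exact: (mwT (ltnW kn) (mS (ltnW kn)))|exact: (mwT kn (mY kn))|exact: ih (ltnW kn)|exact: Y2].
Qed.

Let it k : (k <= n)%N -> rint P (t k).
Proof.
move=> kn; apply: (@rint_bounded _ _ _ _ (kappa ^+ 2 + 1)); first exact: mtn.
by move=> w; rewrite gtr0_norm ?time_left_gt0// time_left_le.
Qed.

Let itau k : (k < n)%N -> rint P (tau k).
Proof. by move=> kn; apply: rintB; apply: it => //; exact: ltnW. Qed.

Let ilind k j : (k < n)%N -> (j <= n)%N -> rint P (fun w => lindeberg (t j w) (Y k.+1 w)).
Proof.
move=> kn jn; apply: rint_le (Y2 kn).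
  by apply: measurable_lindeberg; [exact: mtn|exact: (mwT kn (mY kn))].
by move=> w; rewrite ger0_norm ?lindeberg_ge0 ?lindeberg_le.
Qed.

Let rho k w := tau k w * Num.min 1 (Num.sqrt (tau k w / t k.+1 w)).

Let irho k : (k < n)%N -> rint P (rho k).
Proof.
move=> kn; apply: rint_le (itau kn); last first.
  move=> w; rewrite /rho ger0_norm ?mulr_ge0 ?time_step_ge0 ?le_min ?ler01 ?sqrtr_ge0//.
  by rewrite ler_piMr ?time_step_ge0// ge_min lexx.
have mta : measurable_fun setT (tau k) by exact: (mwT (ltnW kn) (mtau kn)).
apply: measurable_funM => //; apply: measurable_minr => //.
rewrite (_ : (fun w => _) = (fun w => Num.sqrt (tau k w) * (Num.sqrt (t k.+1 w))^-1)).
  apply: measurable_funM; last by apply: measurable_sqrt_inv; exact: mtn.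
  exact: measurable_sqrt.
by apply/funext => w; rewrite sqrtrM ?time_step_ge0// sqrtrV ?(ltW (time_left_gt0 _ _)).
Qed.

Let iheat (f f' : R -> R) j : smooth1 f f' -> (j <= n)%N ->
  rint P (fun w => heat f (t j w) (S j w)).
Proof.
move=> sf jn; have mSj := mwT jn (mS jn).
apply: (@rint_le _ _ _ _ (fun w => `|f (S j w)| + t j w / 2)).
- by apply: measurable_heat; [exact: smooth1_measurable sf|exact: mtn|].
- move=> w; have := smooth1_heat_dist (S j w) (ltW (time_left_gt0 j w)) sf.
  rewrite -/(heat f (t j w) (S j w)).
  have := ler_normD (heat f (t j w) (S j w) - f (S j w)) (f (S j w)).
  by rewrite subrK; lra.
- apply: rintD; last by apply: rintZr; exact: it.
  by apply: rint_norm; apply: smooth1_rint sf mSj (iS2 jn).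
Qed.

(** The space increment and the time increment are both expanded around time [t k.+1] and position
    [S k], so they share the predictable coefficient [H]. In [H * (Y ^+ 2 - tau)] the part
    [H * (Y ^+ 2 - v)] has mean 0, while [H * (v - tau) <= v - tau] since [|H| <= 1] and
    [tau <= v]. *)
Let step_le (f f' : R -> R) k : smooth1 f f' -> (k < n)%N ->
  E (fun w => heat f (t k.+1 w) (S k.+1 w)) - E (fun w => heat f (t k w) (S k w)) <=
  (E (v k.+1) - E (tau k)) / 2 +
  heat_cst * (E (fun w => lindeberg (t k.+1 w) (Y k.+1 w)) + E (rho k)).
Proof.
move=> sf kn; have kn' := ltnW kn; have [lf _] := sf.
have mf := smooth1_measurable sf; have mf' := lip1_measurable lf.
have f'le x : `|f' x| <= `|x| + `|f' 0|.
  have := ler_normD (f' x - f' 0) (f' 0); have := lf x 0.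
  by rewrite subr0 subrK; lra.
pose D w := heat f' (t k.+1 w) (S k w); pose H w := heat_dxx f' (t k.+1 w) (S k w).
have mD : measurable_wrt (F k) D.
  by apply: measurable_heat => //; [exact: (mt kn).2|exact: mS].
have mH : measurable_wrt (F k) H.
  by apply: measurable_heat_dxx => //; [exact: (mt kn).2|exact: mS].
have mSk : measurable_fun setT (S k) := mwT kn' (mS kn').
have mYk : measurable_fun setT (Y k.+1) := mwT kn (mY kn).
have iheatf := iheat sf.
have iDY : rint P (fun w => D w * Y k.+1 w).
  (* The coefficient [D] grows like [|S k|]: it is bounded by [c + |S k|], and square-integrability
     makes its product with [Y] integrable. *)
  pose c := `|f' 0| + Num.sqrt (kappa ^+ 2 + 1) * \int[gam]_z `|z| ^+ 1.
  apply: (@rint_le _ _ _ _ (fun w => `|(c + `|S k w|) * Y k.+1 w|)).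
  - by apply: measurable_funM => //; exact: (mwT kn' mD).
  - move=> w; rewrite !normrM ler_wpM2r//.
    have c0 : 0 <= c.
      by rewrite addr_ge0// mulr_ge0 ?sqrtr_ge0//; apply: Rintegral_ge0.
    rewrite [leRHS]ger0_norm; last exact: addr_ge0 c0 _.
    have h1 := heat_lip1_dist (t k.+1 w) (S k w) lf.
    have h3 : Num.sqrt (t k.+1 w) * \int[gam]_z `|z| ^+ 1 <=
        Num.sqrt (kappa ^+ 2 + 1) * \int[gam]_z `|z| ^+ 1.
      rewrite ler_wpM2r//; first by apply: Rintegral_ge0.
      by rewrite ler_sqrt ?time_left_le// addr_ge0// sqr_ge0.
    have -> : c + `|S k w| = Num.sqrt (kappa ^+ 2 + 1) * \int[gam]_z `|z| ^+ 1 +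
        (`|S k w| + `|f' 0|) by rewrite /c; ring.
    have -> : D w = (D w - f' (S k w)) + f' (S k w) by rewrite subrK.
    rewrite (le_trans (ler_normD _ _))//; apply: lerD; first exact: le_trans h1 h3.
    exact: f'le.
  - apply: rint_norm; apply: rint_mul => //; last exact: Y2.
      by apply: measurable_funD => //; exact: measurableT_comp.
    apply: rint_sqrD => //; [exact: measurableT_comp|exact: rint_cst|].
    by apply: rint_eq (iS2 kn') => w; rewrite real_normK ?num_real.
have H1 w : `|H w| <= 1 by exact: heat_dxx_bound.
have iHV (V : T -> R) : rint P V -> rint P (fun w => H w * V w).
  move=> iV; apply: rint_le (rint_norm iV).
    by apply: measurable_funM; [exact: (mwT kn' mH)|exact: rint_meas iV].
  by move=> w; rewrite normrM ler_piMl.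
have pw w : heat f (t k.+1 w) (S k.+1 w) - heat f (t k w) (S k w) <=
  D w * Y k.+1 w + (H w * Y k.+1 w ^+ 2 - H w * v k.+1 w) / 2 + (v k.+1 w - tau k w) / 2 +
  heat_cst * (lindeberg (t k.+1 w) (Y k.+1 w) + rho k w).
  rewrite partial_sumS.
  have h1 := heat_taylor (S k w) (Y k.+1 w) (time_left_gt0 k.+1 w) sf.
  have h2 := heat_time_taylor (S k w) (time_left_gt0 k.+1 w) (time_step_ge0 k w) sf.
  have e : t k.+1 w + tau k w = t k w by rewrite /tau; ring.
  rewrite e in h2.
  have l0 := lindeberg_ge0 (t k.+1 w) (Y k.+1 w).
  have h3 : shift_cst * lindeberg (t k.+1 w) (Y k.+1 w) <=
      heat_cst * lindeberg (t k.+1 w) (Y k.+1 w).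
    by rewrite ler_wpM2r// shift_cst_le_heat_cst.
  have h4 := time_step_le k w.
  have h5 : H w * (v k.+1 w - tau k w) <= v k.+1 w - tau k w.
    by rewrite ler_piMl ?subr_ge0// (le_trans (ler_norm _)).
  move: h1 h2; rewrite -/(D w) -/(H w) -/(rho k w) !ler_norml => /andP[_ h1] /andP[h2 _].
  lra.
have iY2 := Y2 kn; have ivk := iv kn; have itk := itau kn.
have il : rint P (fun w => lindeberg (t k.+1 w) (Y k.+1 w)) by exact: ilind.
have ir := irho kn.
have i1 := iheatf _ kn; have i2 := iheatf _ kn'.
have i3 := iHV _ iY2; have i4 := iHV _ ivk.
have i5 := rintZr 2^-1 (rintB i3 i4); have i6 := rintZr 2^-1 (rintB ivk itk).
have i7 := rintZl heat_cst (rintD il ir).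
rewrite -RintegralB//.
apply: (le_trans (le_Rint (rintB i1 i2) (rintD (rintD (rintD iDY i5) i6) i7) pw)).
rewrite RintegralD//; last by do 2!apply: rintD => //.
rewrite RintegralD//; last by apply: rintD.
rewrite RintegralD// EY// add0r.
rewrite (RintegralZr _ measurableT (rintB i3 i4)) (RintegralB measurableT i3 i4).
rewrite (EY2 kn mH H1) subrr mul0r add0r.
rewrite (RintegralZr _ measurableT (rintB ivk itk)) (RintegralB measurableT ivk itk).
rewrite RintegralZl//; last exact: (rintD il ir).
by rewrite RintegralD.
Qed.

(* The errors of step k, measured at the later time [t k.+1], are controlled by the
   one at time [t k], which is measurable before step k. With [b] the predictable
   truncation [Num.min 1 (Num.sqrt (v / t))], [E (b * v) = E (b * Y ^+ 2)] and
   [b * Y ^+ 2 <= b * v / 4 + 2 * lindeberg t Y], so [E (b * v)] absorbs itself. *)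
Let err_le k : (k < n)%N ->
  E (fun w => lindeberg (t k.+1 w) (Y k.+1 w)) + E (rho k) <=
  13 * E (fun w => lindeberg (t k w) (Y k.+1 w)).
Proof.
move=> kn; have kn' := ltnW kn.
pose b w := Num.min 1 (Num.sqrt (v k.+1 w / t k w)).
have b01 w : 0 <= b w <= 1 by rewrite /b le_min ler01 sqrtr_ge0 ge_min lexx.
have mb : measurable_wrt (F k) b.
  rewrite (_ : b = (fun w => Num.min 1 (Num.sqrt (v k.+1 w) * (Num.sqrt (t k w))^-1))).
    apply: measurable_minr => //; apply: measurable_funM.
      by apply: measurable_sqrt; exact: mv.
    by apply: measurable_sqrt_inv; exact: (mt kn).1.
  by apply/funext => w; rewrite /b sqrtrM// sqrtrV// ltW// time_left_gt0.
(* Marks the steps that use more than half of the time left; there [b >= 1 / 2], so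
   [a * v <= 2 * b * v]. *)
pose a w : R := if t k w / 2 < tau k w then 1 else 0.
have a01 w : `|a w| <= 1 by rewrite /a; case: ifP; rewrite ?normr1 ?normr0.
have ma : measurable_wrt (F k) a.
  apply: measurable_fun_ifT => //; apply: measurable_fun_ltr; last exact: mtau.
  by apply: measurable_funM => //; exact: (mt kn).1.
have b1 w : `|b w| <= 1 by have /andP[? ?] := b01 w; rewrite ger0_norm.
have imul (c V : T -> R) : measurable_wrt (F k) c -> (forall w, `|c w| <= 1) ->
    rint P V -> rint P (fun w => c w * V w).
  move=> mc c1 iV; apply: rint_le (rint_norm iV).
    by apply: measurable_funM; [exact: mwT mc|exact: rint_meas iV].
  by move=> w; rewrite normrM ler_piMl.
have ibY := imul _ _ mb b1 (Y2 kn); have ibv := imul _ _ mb b1 (iv kn).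
have iaY := imul _ _ ma a01 (Y2 kn); have iav := imul _ _ ma a01 (iv kn).
have il := ilind kn kn'; have il' := ilind kn kn; have ir := irho kn.
have tE w : t k.+1 w = t k w - tau k w by rewrite /tau; ring.
have taut w : tau k w < t k w by rewrite -subr_gt0 -tE time_left_gt0.
have e1 := EY2 kn mb b1; have e2 := EY2 kn ma a01.
have h1 : E (fun w => b w * Y k.+1 w ^+ 2) <=
    E (fun w => b w * v k.+1 w) / 4 + 2 * E (fun w => lindeberg (t k w) (Y k.+1 w)).
  rewrite -(RintegralZr _ measurableT ibv) -(RintegralZl _ measurableT il).
  rewrite -RintegralD//; [|exact: rintZr|exact: rintZl].
  apply: le_Rint => //; first by apply: rintD; [exact: rintZr|exact: rintZl].
  move=> w; rewrite mulrC [b w * _]mulrC.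
  exact: (sqr_truncation_le (Y k.+1 w) (time_left_gt0 k w) (v0 k.+1 w)).
have h2 : E (fun w => lindeberg (t k.+1 w) (Y k.+1 w)) <=
    2 * E (fun w => lindeberg (t k w) (Y k.+1 w)) + E (fun w => a w * Y k.+1 w ^+ 2).
  rewrite -(RintegralZl _ measurableT il) -RintegralD//; last exact: rintZl.
  apply: le_Rint => //; first by apply: rintD => //; exact: rintZl.
  by move=> w; rewrite tE; exact: lindeberg_shift_le (time_left_gt0 k w) (taut w).
have h3 : E (fun w => a w * v k.+1 w) <= 2 * E (fun w => b w * v k.+1 w).
  rewrite -(RintegralZl _ measurableT ibv); apply: le_Rint => //; first exact: rintZl.
  move=> w; rewrite /a; have := v0 k.+1 w; have /andP[bw0 _] := b01 w.
  case: ifPn => [tt vw0|_ vw0]; last by rewrite mul0r mulr_ge0// mulr_ge0.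
  have := half_le_min1_sqrt (time_left_gt0 k w) (le_trans (ltW tt) (time_step_le k w)).
  rewrite -/(b w) mul1r => bw2; have : 2^-1 * v k.+1 w <= b w * v k.+1 w by rewrite ler_wpM2r.
  by lra.
have h4 : E (rho k) <= 2 * E (fun w => b w * v k.+1 w).
  rewrite -(RintegralZl _ measurableT ibv); apply: le_Rint => //; first exact: rintZl.
  move=> w; rewrite /rho tE [b w * _]mulrC; apply: time_truncation_le => //.
    exact: time_left_gt0.
  by rewrite time_step_ge0 time_step_le.
rewrite e1 in h1; rewrite e2 in h2.
have : 0 <= E (fun w => lindeberg (t k w) (Y k.+1 w)).
  by apply: Rintegral_ge0 => w _; exact: lindeberg_ge0.
(* Absorption gives [E (b * v) <= 8 / 3 * E lindeberg]; with the two factors 2 of [h3] and [h4] the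
   total is [2 + 4 * 8 / 3 = 38 / 3], rounded up to 13. *)
move: h1 h2 h3 h4.
move: (E (fun w => lindeberg (t k.+1 w) (Y k.+1 w))) (E (rho k))
  (E (fun w => lindeberg (t k w) (Y k.+1 w))) (E (fun w => b w * v k.+1 w))
  (E (fun w => a w * v k.+1 w)) => A B C D G.
lra.
Qed.

Let total_le (f f' : R -> R) k : smooth1 f f' -> (k <= n)%N ->
  E (fun w => heat f (t k w) (S k w)) <= heat f (kappa ^+ 2 + 1) 0 +
  \sum_(0 <= i < k) (E (v i.+1) - E (tau i)) / 2 +
  13 * heat_cst * \sum_(0 <= i < k) E (fun w => lindeberg (t i w) (Y i.+1 w)).
Proof.
move=> sf; elim: k => [_|k ih kn].
  rewrite !big_geq// mulr0 !addr0 le_eqVlt; apply/orP; left; apply/eqP.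
  rewrite -[RHS](Rintegral_prob_cst P); apply: eq_Rintegral => w _.
  rewrite partial_sum0 /t partial_sum0 subr0; congr (heat _ (_ + _) _).
  by apply/max_idPr.
rewrite !big_nat_recr//=; have := ih (ltnW kn); have := step_le sf kn.
have := err_le kn; have : 0 <= @heat_cst R.
  by have := @shift_cst_le_heat_cst R; have := @shift_cst_ge2 R; lra.
move: (E (fun w => heat f (t k w) (S k w))) (E (fun w => heat f (t k.+1 w) (S k.+1 w))).
move: (E (fun w => lindeberg (t k.+1 w) (Y k.+1 w))) (E (rho k)) => A B x y.
move: (E (fun w => lindeberg (t k w) (Y k.+1 w))) (\sum_(0 <= i < k) _) => C D.
move: (\sum_(0 <= i < k) _) ((E (v k.+1) - E (tau k)) / 2) (@heat_cst R) => G H K K0 h1 h2 h3.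
have : K * (A + B) <= K * (13 * C) by rewrite ler_wpM2l.
lra.
Qed.

(** The sum of [v - tau] is the positive part of [q n - 1], and the time left at the end is
    [kappa ^+ 2] plus the positive part of [1 - q n]; together they make [|q n - 1|]. One half of
    [kappa ^+ 2] is spent at the start, where the clock shows [kappa ^+ 2 + 1] instead of 1, and one
    half at the end, where the smoothing is removed. *)
Lemma lindeberg_smooth_le (f f' : R -> R) : smooth1 f f' ->
  E (fun w => f (S n w)) - Rintegral gam setT f <=
  kappa ^+ 2 + E (fun w => `|q n w - 1|) / 2 +
  13 * heat_cst * \sum_(0 <= i < n) E (fun w => lindeberg (t i w) (Y i.+1 w)).
Proof.
move=> sf; have mf := smooth1_measurable sf.
have mSn : measurable_fun setT (S n) := mwT (leqnn n) (mS (leqnn n)).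
have iheatn := iheat sf (leqnn n).
have h1 : E (fun w => f (S n w)) <= E (fun w => heat f (t n w) (S n w)) + E (t n) / 2.
  have itn := it (leqnn n).
  rewrite -(RintegralZr _ measurableT itn) -RintegralD//; last exact: rintZr.
  apply: le_Rint; [exact: smooth1_rint sf mSn (iS2 (leqnn n))|by apply: rintD => //; exact: rintZr|].
  move=> w; have := smooth1_heat_dist (S n w) (ltW (time_left_gt0 n w)) sf.
  by rewrite -/(heat f (t n w) (S n w)) ler_norml => /andP[]; lra.
have h2 := total_le sf (leqnn n).
have h3 : heat f (kappa ^+ 2 + 1) 0 <= Rintegral gam setT f + kappa ^+ 2 / 2.
  rewrite addrC (heat_semigroup 0 ltr01 (sqr_ge0 kappa) sf).
  have := smooth1_heat_dist 0 (sqr_ge0 kappa) (heat_smooth1 1 sf).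
  have -> : heat f 1 0 = Rintegral gam setT f.
    by apply: eq_Rintegral => z _; rewrite sqrtr1 mul1r add0r.
  by rewrite ler_norml => /andP[]; lra.
have h4 : \sum_(0 <= i < n) (E (v i.+1) - E (tau i)) / 2 + E (t n) / 2 <=
   kappa ^+ 2 / 2 + E (fun w => `|q n w - 1|) / 2.
  have sumE k w : (k <= n)%N -> \sum_(0 <= i < k) (v i.+1 w - tau i w) / 2 =
      (q k w - (kappa ^+ 2 + 1) + t k w) / 2.
    elim: k => [_|k ih kn].
      rewrite big_geq// /t partial_sum0 subr0 (max_idPr _) ?ler01//; lra.
    by rewrite big_nat_recr//= ih 1?ltnW// partial_sumS /tau; field.
  have ivt i : (i < n)%N -> rint P (fun w => (v i.+1 w - tau i w) / 2).
    by move=> ik; apply: rintZr; apply: rintB; [exact: iv|exact: itau].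
  have -> : \sum_(0 <= i < n) (E (v i.+1) - E (tau i)) / 2 =
      E (fun w => \sum_(0 <= i < n) (v i.+1 w - tau i w) / 2).
    rewrite !big_mkord.
    under [in RHS]eq_Rintegral do rewrite big_mkord.
    rewrite Rintegral_sum; last by move=> i _; exact: ivt.
    apply: eq_bigr => i _.
    by rewrite (RintegralZr _ measurableT (rintB (iv (ltn_ord i)) (itau (ltn_ord i))))
      (RintegralB measurableT (iv (ltn_ord i)) (itau (ltn_ord i))).
  have iq : rint P (q n).
    apply: (@rint_eq _ _ _ P (fun w => \sum_(i < n) v i.+1 w)).
      by move=> w; rewrite /partial_sum big_add1/= big_mkord.
    by apply: rint_sum => i _; exact: iv.
  have iq1 : rint P (fun w => `|q n w - 1|).
    by apply: rint_norm; apply: rintB => //; exact: rint_cst.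
  have itn := it (leqnn n).
  have i1 : rint P (fun w => \sum_(0 <= i < n) (v i.+1 w - tau i w) / 2).
    apply: (@rint_eq _ _ _ P (fun w => (q n w - (kappa ^+ 2 + 1) + t n w) / 2)).
      by move=> w; rewrite sumE.
    by apply: rintZr; apply: rintD => //; apply: rintB => //; exact: rint_cst.
  rewrite -(RintegralZr _ measurableT itn) -(RintegralZr _ measurableT iq1).
  rewrite -[kappa ^+ 2 / 2](Rintegral_prob_cst P).
  rewrite -!RintegralD//; [|exact: rint_cst|exact: rintZr|exact: rintZr].
  apply: le_Rint.
  - by apply: rintD => //; exact: rintZr.
  - by apply: rintD; [exact: rint_cst|exact: rintZr].
  move=> w; rewrite sumE// /t.
  have := ler_norm (q n w - 1); have := ler_norm (- (q n w - 1)); rewrite normrN.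
  by case: (lerP 0 (1 - q n w)); case: (ger0P (q n w - 1)); lra.
have aux (a b c g k2 e X p s : R) : a <= b + c / 2 -> b <= p + s + X ->
  p <= g + k2 / 2 -> s + c / 2 <= k2 / 2 + e / 2 -> a - g <= k2 + e / 2 + X by lra.
exact: aux h1 h2 h3 h4.
Qed.

(** The truncation level [M] depends only on the clock, hence is predictable, and [b * Y ^+ 2] may
    be replaced by [b * v]. Splitting [v] into [v - tau] and [tau], the first part costs the
    positive part of [q n - 1], and the second telescopes. A level in force only below [l]
    contributes [l]; a permanent one contributes 1, because [sqrt t] falls from at most [kappa + 1]
    to at least [kappa]. *)
Lemma lindeberg_sum_le (A1 A2 A3 l1 l2 K : R) (psi : R -> R) :
  0 <= A1 -> 0 <= A2 -> 0 <= A3 -> 0 <= l1 -> 0 <= l2 ->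
  (forall i, (i < n)%N -> rint P (fun w => psi (Y i.+1 w))) ->
  (forall lam y, kappa <= lam -> y ^+ 2 * Num.min 1 (`|y| / lam) <=
    y ^+ 2 * Num.min 1 ((A1 * (lam < l1)%R%:R + A2 * (lam < l2)%R%:R + A3) / lam) +
    K * psi y) ->
  \sum_(0 <= i < n) E (fun w => lindeberg (t i w) (Y i.+1 w)) <=
  E (fun w => `|q n w - 1|) + 2 * (A1 * l1 + A2 * l2 + A3) +
  K * \sum_(0 <= i < n) E (fun w => psi (Y i.+1 w)).
Proof.
move=> A10 A20 A30 l10 l20 ipsi hM.
pose M lam : R := A1 * (lam < l1)%R%:R + A2 * (lam < l2)%R%:R + A3.
have M0 lam : 0 <= M lam by rewrite !addr_ge0// mulr_ge0.
have lam_gt0 i w : 0 < Num.sqrt (t i w) by rewrite sqrtr_gt0 time_left_gt0.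
pose b i w := Num.min 1 (M (Num.sqrt (t i w)) / Num.sqrt (t i w)).
have b0 i w : 0 <= b i w by rewrite /b le_min ler01 divr_ge0// ltW.
have b1 i w : `|b i w| <= 1 by rewrite ger0_norm// ge_min lexx.
have mb i : (i < n)%N -> measurable_wrt (F i) (b i).
  move=> kn; have [mti _] := mt kn.
  have msq : measurable_wrt (F i) (fun w => Num.sqrt (t i w)) by exact: measurable_sqrt.
  have mind (l : R) : measurable_wrt (F i) (fun w => (Num.sqrt (t i w) < l)%R%:R : R).
    rewrite (_ : (fun w => _) = (fun w => if Num.sqrt (t i w) < l then 1 else 0)).
      by apply: measurable_fun_ifT => //; apply: measurable_fun_ltr.
    by apply/funext => w; case: ifP.
  apply: measurable_minr => //; apply: measurable_funM; last exact: measurable_sqrt_inv.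
  apply: measurable_funD; last exact: measurable_cst.
  by apply: measurable_funD; (apply: measurable_funM; [exact: measurable_cst|exact: mind]).
have imul i (V : T -> R) : (i < n)%N -> rint P V -> rint P (fun w => b i w * V w).
  move=> kn iV; apply: rint_le (rint_norm iV).
    apply: measurable_funM; [exact: (mwT (ltnW kn) (mb _ kn))|exact: rint_meas iV].
  by move=> w; rewrite normrM ler_piMl.
pose G i w := (v i.+1 w - tau i w) + tau i w * (M (Num.sqrt (t i w)) / Num.sqrt (t i w)).
have bG i w : b i w * v i.+1 w <= G i w.
  have h1 : b i w <= 1 by rewrite ge_min lexx.
  have h2 : b i w <= M (Num.sqrt (t i w)) / Num.sqrt (t i w) by rewrite ge_min lexx orbT.
  have h3 := time_step_ge0 i w; have h4 := time_step_le i w; rewrite /G.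
  have h5 : b i w * (v i.+1 w - tau i w) <= v i.+1 w - tau i w.
    by rewrite ler_piMl// subr_ge0.
  have h6 : b i w * tau i w <= tau i w * (M (Num.sqrt (t i w)) / Num.sqrt (t i w)).
    by rewrite mulrC ler_wpM2l.
  lra.
have sumG w : \sum_(0 <= i < n) b i w * v i.+1 w <=
    `|q n w - 1| + 2 * (A1 * l1 + A2 * l2 + A3).
  apply: (@le_trans _ _ (\sum_(0 <= i < n) G i w)); first by apply: ler_sum => i _.
  rewrite big_split/=; apply: lerD.
    have qtE k : \sum_(0 <= i < k) (v i.+1 w - tau i w) = q k w - t 0 w + t k w.
      elim: k => [|k ih]; first by rewrite big_geq// partial_sum0; ring.
      by rewrite big_nat_recr//= ih partial_sumS /tau; ring.
    rewrite qtE.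
    rewrite /t partial_sum0 subr0 (max_idPr _) ?ler01//.
    have := ler_norm (q n w - 1); have := normr_ge0 (q n w - 1).
    by case: (lerP 0 (1 - q n w)); lra.
  have t0' i : 0 < t i w := time_left_gt0 i w.
  have tS i : t i.+1 w <= t i w by have := time_step_ge0 i w; rewrite /tau subr_ge0.
  have s1 := sum_step_sqrt_lt n t0' tS l10; have s2 := sum_step_sqrt_lt n t0' tS l20.
  have s3 := sum_step_sqrt_le n t0' tS.
  have s4 : Num.sqrt (t 0 w) - Num.sqrt (t n w) <= 1.
    have h1 : kappa <= Num.sqrt (t n w).
      by rewrite -[leLHS](ger0_norm (ltW kappa0)) -sqrtr_sqr ler_wsqrtr ?time_left_ge.
    have h2 : Num.sqrt (t 0 w) <= kappa + 1.
      rewrite -[leRHS]ger0_norm; last by rewrite addr_ge0 ?ltW.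
      by rewrite -sqrtr_sqr ler_wsqrtr// (le_trans (time_left_le _ _))//; have := kappa0; nra.
    lra.
  have -> : \sum_(0 <= i < n) tau i w * (M (Num.sqrt (t i w)) / Num.sqrt (t i w)) =
      A1 * (\sum_(0 <= i < n) (t i w - t i.+1 w) / Num.sqrt (t i w) * (Num.sqrt (t i w) < l1)%R%:R) +
      A2 * (\sum_(0 <= i < n) (t i w - t i.+1 w) / Num.sqrt (t i w) * (Num.sqrt (t i w) < l2)%R%:R) +
      A3 * (\sum_(0 <= i < n) (t i w - t i.+1 w) / Num.sqrt (t i w)).
    rewrite !mulr_sumr -!big_split/=; apply: eq_bigr => i _.
    by rewrite /tau /M; ring.
  have h1 := ler_wpM2l A10 s1; have h2 := ler_wpM2l A20 s2.
  have h3 := ler_wpM2l A30 (le_trans s3 (ler_wpM2l (ler0n _ 2) s4)).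
  lra.
have step i : (i < n)%N -> E (fun w => lindeberg (t i w) (Y i.+1 w)) <=
    E (fun w => b i w * v i.+1 w) + K * E (fun w => psi (Y i.+1 w)).
  move=> kn; have iib := imul i _ kn (Y2 kn); have iK := rintZl K (ipsi _ kn).
  rewrite -(EY2 kn (mb _ kn) (b1 i)) -(RintegralZl _ measurableT (ipsi _ kn)).
  rewrite -RintegralD//; apply: le_Rint; [exact: ilind (ltnW kn)|exact: rintD|].
  move=> w; rewrite [b i w * _]mulrC; apply: hM.
  by rewrite -[leLHS](ger0_norm (ltW kappa0)) -sqrtr_sqr ler_wsqrtr ?time_left_ge.
apply: (@le_trans _ _ (\sum_(0 <= i < n) (E (fun w => b i w * v i.+1 w) +
    K * E (fun w => psi (Y i.+1 w))))).
  by rewrite !big_mkord; apply: ler_sum => i _; exact: step.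
rewrite big_split/= -mulr_sumr lerD2r !big_mkord.
rewrite -Rintegral_sum; last by move=> i _; apply: imul => //; exact: iv.
have ibv i : (i < n)%N -> rint P (fun w => b i w * v i.+1 w).
  by move=> kn; apply: imul => //; exact: iv.
have iq1 : rint P (fun w => `|q n w - 1|).
  apply: rint_norm; apply: rintB; last exact: rint_cst.
  apply: (@rint_eq _ _ _ P (fun w => \sum_(i < n) v i.+1 w)).
    by move=> w; rewrite /partial_sum big_add1/= big_mkord.
  by apply: rint_sum => i _; exact: iv.
rewrite -[2 * _](Rintegral_prob_cst P) -RintegralD//; last exact: rint_cst.
apply: le_Rint.
- by apply: rint_sum => i _; exact: ibv.
- by apply: rintD => //; exact: rint_cst.
- by move=> w; have := sumG w; rewrite big_mkord.
Qed.

End lindeberg_argument.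

Section identity_variable.
Context {R : realType}.
(* The standard normal law is the distribution of this variable. *)
Definition idR : measurableTypeR R -> R := idfun.
HB.instance Definition _ :=
  @isMeasurableFun.Build _ _ _ _ idR (@measurable_id _ _ setT).
End identity_variable.

(** * Martingale differences scaled to total variance 1 *)

Section martingale.
Context d (T : measurableType d) (R : realType) (P : probability T R).
Local Notation gam := (normal_prob (0 : R) 1).
Local Notation E f := (Rintegral P setT f).
Variables (n : nat) (F : nat -> set (set T)) (Y : nat -> {RV P >-> R})
  (sigma2 : nat -> T -> R).
Hypothesis martY : martingale_difference n F Y.
Hypothesis Y2 : square_integrable n Y.
Hypothesis sigma2E : forall i, (1 <= i <= n)%N ->
  is_cond_exp P (F i.-1) (fun w => Y i w ^+ 2) (sigma2 i).
Hypothesis s_gt0 : 0 < std_sum n Y.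
Local Notation s := (std_sum n Y).

Definition scaled_increment i w := s^-1 * Y i w.
(* A version of a conditional variance may be negative on a null set. *)
Definition scaled_variance i w := (s ^+ 2)^-1 * Num.max (sigma2 i w) 0.
Local Notation Yn := scaled_increment.
Local Notation vn := scaled_variance.

Let iY2 k : (k < n)%N -> rint P (fun w => Y k.+1 w ^+ 2).
Proof. by move=> kn; apply: Lfun2_integrable_sqr; exact: Y2. Qed.

Let is2 k : (k < n)%N -> rint P (sigma2 k.+1).
Proof. by move=> kn; have [_ /Lfun1_integrable] := @sigma2E k.+1 kn. Qed.

Let FT i : (i <= n)%N -> F i `<=` measurable.
Proof. by move=> ni; have [[h _] _ _ _] := martY; exact: (h i ni).2. Qed.

Let sF i : (i <= n)%N -> sigma_algebra setT (F i).
Proof. by move=> ni; have [[h _] _ _ _] := martY; exact: (h i ni).1. Qed.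

Let FF i j : (i <= j <= n)%N -> F i `<=` F j.
Proof. by have [[_ h] _ _ _] := martY; exact: h. Qed.

Let mY k : (k < n)%N -> measurable_wrt (F k.+1) (Y k.+1).
Proof.
by move=> kn; have [_ _ h _] := martY; apply: preimage_measurable_wrt; exact: h.
Qed.

Let ms2 k : (k < n)%N -> measurable_wrt (F k) (sigma2 k.+1).
Proof.
by move=> kn; have [_ _ h _] := @sigma2E k.+1 kn; apply: preimage_measurable_wrt.
Qed.

Let mYn k : (k < n)%N -> measurable_wrt (F k.+1) (Yn k.+1).
Proof. by move=> kn; apply: measurable_funM => //; exact: mY. Qed.

Let mvn k : (k < n)%N -> measurable_wrt (F k) (vn k.+1).
Proof.
move=> kn; apply: measurable_funM => //; apply: measurable_maxr => //; exact: ms2.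
Qed.

Let iYn2 k : (k < n)%N -> rint P (fun w => Yn k.+1 w ^+ 2).
Proof. by move=> kn; apply: rint_sqrZ; exact: iY2. Qed.

Let neg k w := Num.min (sigma2 k w) 0.

Let negE k w : Num.max (sigma2 k w) 0 = sigma2 k w - neg k w.
Proof. by rewrite /neg; case: (lerP (sigma2 k w) 0); lra. Qed.

Let ineg k : (k < n)%N -> rint P (neg k.+1).
Proof.
move=> kn; apply: rint_le (rint_norm (is2 kn)).
  by apply: measurable_minr => //; exact: rint_meas (is2 kn).
move=> w; rewrite /neg; case: (lerP (sigma2 k.+1 w) 0) => // _.
by rewrite normr0.
Qed.

Let imulb k (a c : T -> R) (K : R) : (k < n)%N -> measurable_wrt (F k) a ->
  (forall w, `|a w| <= K) -> rint P c -> rint P (fun w => a w * c w).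
Proof.
move=> kn ma aK ic; apply: rint_le (rintZl K (rint_norm ic)).
  apply: measurable_funM; last exact: rint_meas ic.
  exact: measurable_wrtT (FT (ltnW kn)) ma.
by move=> w; rewrite normrM ler_wpM2r.
Qed.

Let EY2s k (a : T -> R) (K : R) : (k < n)%N -> measurable_wrt (F k) a ->
  (forall w, `|a w| <= K) ->
  E (fun w => a w * Y k.+1 w ^+ 2) = E (fun w => a w * sigma2 k.+1 w).
Proof.
move=> kn ma aK; have [_ _ _ h] := @sigma2E k.+1 kn.
apply: (conditional_mul (sF (ltnW kn)) (FT (ltnW kn)) (iY2 kn) (is2 kn)) => //.
  exact: (imulb kn ma aK (iY2 kn)).
exact: (imulb kn ma aK (is2 kn)).
Qed.

(** The set where [sigma2] is negative is predictable, and on it [sigma2] integrates like [Y ^+ 2],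
    which is nonnegative. *)
Let Eneg k : (k < n)%N -> E (fun w => `|neg k.+1 w|) = 0.
Proof.
move=> kn; pose a w : R := if sigma2 k.+1 w < 0 then 1 else 0.
have a1 w : `|a w| <= 1 by rewrite /a; case: ifP; rewrite ?normr1 ?normr0.
have ma : measurable_wrt (F k) a.
  apply: measurable_fun_ifT => //; apply: measurable_fun_ltr => //; exact: ms2.
have aE w : `|neg k.+1 w| = - (a w * sigma2 k.+1 w).
  rewrite /neg /a; case: (ltP (sigma2 k.+1 w) 0) => h.
    by rewrite mul1r ltr0_norm.
  by rewrite normr0 mul0r oppr0.
have e : E (fun w => `|neg k.+1 w|) = - E (fun w => a w * sigma2 k.+1 w).
  rewrite -mulN1r -RintegralZl//; last exact: (imulb kn ma a1 (is2 kn)).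
  by apply: eq_Rintegral => w _; rewrite aE mulN1r.
apply/eqP; rewrite eq_le Rintegral_ge0// andbT e -(EY2s kn ma a1) oppr_le0.
by apply: Rintegral_ge0 => w _; rewrite mulr_ge0 ?sqr_ge0// /a; case: ifP.
Qed.

Let ivn k : (k < n)%N -> rint P (vn k.+1).
Proof.
move=> kn; apply: rintZl; apply: (@rint_eq _ _ _ P (fun w => sigma2 k.+1 w - neg k.+1 w)).
  by move=> w; rewrite negE.
by apply: rintB; [exact: is2|exact: ineg].
Qed.

Let vn0 k w : 0 <= vn k w.
Proof. by rewrite mulr_ge0 ?invr_ge0 ?sqr_ge0// le_max lexx orbT. Qed.

Let EYn k (a : T -> R) : (k < n)%N -> measurable_wrt (F k) a ->
  rint P (fun w => a w * Yn k.+1 w) -> E (fun w => a w * Yn k.+1 w) = 0.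
Proof.
move=> kn ma iaY; have [_ _ _ /(_ k.+1 kn) [iY iZ _ h]] := martY.
move/Lfun1_integrable in iY; move/Lfun1_integrable in iZ.
have iaY' : rint P (fun w => a w * Y k.+1 w).
  apply: rint_eq (rintZl s iaY) => w; rewrite /Yn; field; rewrite gt_eqF//.
have -> : E (fun w => a w * Yn k.+1 w) = s^-1 * E (fun w => a w * Y k.+1 w).
  by rewrite -RintegralZl//; apply: eq_Rintegral => w _; rewrite /Yn mulrCA.
rewrite (conditional_mul (Z := cst 0) (sF (ltnW kn)) (FT (ltnW kn)) iY iZ h ma)//.
  rewrite (_ : (fun w => _) = fun=> 0) ?Rintegral_prob_cst ?mulr0//.
  by apply/funext => w; rewrite mulr0.
by apply: rint_eq (rint_cst P 0) => w; rewrite mulr0.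
Qed.

Let EYn2 k (a : T -> R) (K : R) : (k < n)%N -> measurable_wrt (F k) a ->
  (forall w, `|a w| <= K) ->
  E (fun w => a w * Yn k.+1 w ^+ 2) = E (fun w => a w * vn k.+1 w).
Proof.
move=> kn ma aK.
have i1 := imulb kn ma aK (iY2 kn); have i2 := imulb kn ma aK (is2 kn).
have i3 := imulb kn ma aK (ineg kn).
have -> : E (fun w => a w * Yn k.+1 w ^+ 2) = (s ^+ 2)^-1 * E (fun w => a w * Y k.+1 w ^+ 2).
  rewrite -RintegralZl//; apply: eq_Rintegral => w _.
  by rewrite /Yn exprMn exprVn mulrCA.
have -> : E (fun w => a w * vn k.+1 w) =
    (s ^+ 2)^-1 * (E (fun w => a w * sigma2 k.+1 w) - E (fun w => a w * neg k.+1 w)).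
  rewrite -RintegralB// -RintegralZl//; last exact: rintB.
  by apply: eq_Rintegral => w _; rewrite /vn negE; ring.
rewrite (EY2s kn ma aK); congr (_ * _); rewrite -[LHS]subr0; congr (_ - _).
apply/esym/eqP; rewrite -normr_le0 (le_trans (le_normr_Rintegral _ i3))//.
have -> : 0 = K * E (fun w => `|neg k.+1 w|) by rewrite Eneg ?mulr0.
rewrite -RintegralZl//; last exact: rint_norm (ineg kn).
apply: le_Rint; [exact: rint_norm|exact: rintZl (rint_norm (ineg kn))|].
by move=> w; rewrite normrM ler_wpM2r.
Qed.

Lemma std_sum_sqr : s ^+ 2 = \sum_(0 <= i < n) E (fun w => Y i.+1 w ^+ 2).
Proof.
rewrite /std_sum sqr_sqrtr; last first.
  apply: fine_ge0; apply: sume_ge0 => i _; apply: expectation_ge0 => w.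
  exact: sqr_ge0.
rewrite big_add1/= !big_mkord.
rewrite (eq_bigr (fun i : 'I_n => (E (fun w => Y i.+1 w ^+ 2))%:E)) ?sumEFin//.
by move=> i _; rewrite unlock EFin_Rintegral//; exact: iY2.
Qed.

Lemma scaled_increment_sqr : \sum_(0 <= i < n) E (fun w => Yn i.+1 w ^+ 2) = 1.
Proof.
have -> : \sum_(0 <= i < n) E (fun w => Yn i.+1 w ^+ 2) =
    (s ^+ 2)^-1 * \sum_(0 <= i < n) E (fun w => Y i.+1 w ^+ 2).
  rewrite !big_mkord mulr_sumr; apply: eq_bigr => i _.
  rewrite -RintegralZl//; last exact: iY2.
  by apply: eq_Rintegral => w _; rewrite /Yn exprMn exprVn.
by rewrite -std_sum_sqr mulVf// gt_eqF// exprn_gt0.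
Qed.

Lemma normalized_sumE w : normalized_sum n Y w = partial_sum Yn n w.
Proof.
rewrite /normalized_sum /partial_sum /=.
rewrite (@big_morph _ _ (fun f : {mfun T >-> R} => f w) 0 +%R) // mulr_suml.
by apply: eq_bigr => i _; rewrite /Yn mulrC.
Qed.

Local Notation D1 := (E (fun w => `|normalized_cond_var n Y sigma2 w - 1|)).

Lemma rint_variance_dist : rint P (fun w => normalized_cond_var n Y sigma2 w - 1).
Proof.
apply: rintB; last exact: rint_cst.
apply: rintZl; apply: (@rint_eq _ _ _ P (fun w => \sum_(i < n) sigma2 i.+1 w)).
  by move=> w; rewrite big_add1/= big_mkord.
by apply: rint_sum => i _; exact: is2.
Qed.

Lemma scaled_variance_dist : E (fun w => `|partial_sum vn n w - 1|) <= D1.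
Proof.
have pE w : partial_sum vn n w = normalized_cond_var n Y sigma2 w -
    (s ^+ 2)^-1 * \sum_(i < n) neg i.+1 w.
  rewrite /partial_sum /normalized_cond_var !big_add1/= !big_mkord -mulrBr -sumrB mulr_sumr.
  by apply: eq_bigr => i _; rewrite /vn negE.
have i1 := rint_variance_dist.
have i2 : rint P (fun w => (s ^+ 2)^-1 * \sum_(i < n) neg i.+1 w).
  by apply: rintZl; apply: rint_sum => i _; exact: ineg.
have i3 : rint P (fun w => (s ^+ 2)^-1 * \sum_(i < n) `|neg i.+1 w|).
  by apply: rintZl; apply: rint_sum => i _; apply: rint_norm; exact: ineg.
apply: (@le_trans _ _ (D1 + E (fun w => (s ^+ 2)^-1 * \sum_(i < n) `|neg i.+1 w|))).
  rewrite -RintegralD//; last exact: rint_norm.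
  apply: le_Rint.
  - apply: rint_norm; apply: (@rint_eq _ _ _ P (fun w => (normalized_cond_var n Y sigma2 w - 1) -
      (s ^+ 2)^-1 * \sum_(i < n) neg i.+1 w)); last exact: rintB.
    by move=> w; rewrite pE; ring.
  - by apply: rintD => //; exact: rint_norm.
  move=> w; rewrite pE addrAC (le_trans (ler_normB _ _))// lerD2l normrM.
  rewrite [X in X * _]ger0_norm ?invr_ge0 ?sqr_ge0// ler_wpM2l ?invr_ge0 ?sqr_ge0//.
  exact: ler_norm_sum.
rewrite RintegralZl//; last by apply: rint_sum => i _; apply: rint_norm; exact: ineg.
rewrite Rintegral_sum; last by move=> i _; apply: rint_norm; exact: ineg.
by rewrite big1 ?mulr0 ?addr0// => i _; exact: Eneg.
Qed.

Lemma wasserstein_levels (kappa A1 A2 A3 l1 l2 K : R) (psi : R -> R) : 0 < kappa ->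
  0 <= A1 -> 0 <= A2 -> 0 <= A3 -> 0 <= l1 -> 0 <= l2 ->
  (forall i, (i < n)%N -> rint P (fun w => psi (Yn i.+1 w))) ->
  (forall lam y, kappa <= lam -> y ^+ 2 * Num.min 1 (`|y| / lam) <=
    y ^+ 2 * Num.min 1 ((A1 * (lam < l1)%R%:R + A2 * (lam < l2)%R%:R + A3) / lam) +
    K * psi y) ->
  (wasserstein 2 (distribution P (normalized_sum n Y)) (normal_prob 0%R 1%R) <=
  (Num.sqrt (4 * (kappa ^+ 2 + D1 / 2 + 13 * heat_cst *
    (D1 + 2 * (A1 * l1 + A2 * l2 + A3) +
     K * \sum_(0 <= i < n) E (fun w => psi (Yn i.+1 w))))))%:E)%E.
Proof.
move=> k0 A10 A20 A30 l10 l20 ipsi hM.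
have iX2 : rint P (fun w => normalized_sum n Y w ^+ 2).
  apply: (@rint_eq _ _ _ P (fun w => (\sum_(i < n) Yn i.+1 w) ^+ 2)).
    by move=> w; rewrite normalized_sumE /partial_sum big_add1/= big_mkord.
  apply: rint_sqr_sum => i _; last exact: iYn2.
  exact: measurable_wrtT (FT (ltn_ord i)) (mYn (ltn_ord i)).
have [f [f' [sf fW]]] := wasserstein_le_smooth
  (Z := (@idR R : {mfun measurableTypeR R >-> R})) iX2 (@rint_sqr_normal R).
apply: (le_trans fW); rewrite lee_fin.
have h1 := lindeberg_smooth_le FT FF mYn mvn iYn2 ivn vn0 EYn EYn2 k0 sf.
have h2 := lindeberg_sum_le FT FF mYn mvn iYn2 ivn vn0 EYn2 k0 A10 A20 A30 l10 l20 ipsi hM.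
have e : E (fun w => f (normalized_sum n Y w)) = E (fun w => f (partial_sum Yn n w)).
  by apply: eq_Rintegral => w _; rewrite normalized_sumE.
rewrite -e in h1; apply: ler_wsqrtr; rewrite ler_wpM2l//.
have hc : 0 <= @heat_cst R.
  by have := @shift_cst_le_heat_cst R; have := @shift_cst_ge2 R; lra.
have h3 := scaled_variance_dist.
have aux (a g k2 D D' H S S' L : R) : a - g <= k2 + D' / 2 + 13 * H * S -> D' <= D ->
    S <= D' + S' + L -> 0 <= H -> a - g <= k2 + D / 2 + 13 * H * (D + S' + L).
  move=> b1 b2 b3 b4; have : 13 * H * S <= 13 * H * (D + S' + L).
    by rewrite ler_wpM2l ?mulr_ge0//; lra.
  lra.
exact: aux h1 h3 h2 hc.
Qed.

End martingale.

(** * Truncation levels *)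

Section constants.
Context {R : realType}.

(** The 2 is the root of the factor 4 in the coupling inequality, the 13 comes from [err_le], and
    [k] bounds the error terms in units of [kappa ^+ 2 + D + Q]. *)
Definition wasserstein_cst (k : R) : R := 2 * Num.sqrt (1 + 13 * heat_cst * k).

Lemma heat_cst_ge0 : 0 <= @heat_cst R.
Proof. by have := @shift_cst_le_heat_cst R; have := @shift_cst_ge2 R; lra. Qed.

Lemma wasserstein_cst_gt0 k : 0 <= k -> 0 < wasserstein_cst k.
Proof.
move=> k0; rewrite mulr_gt0// sqrtr_gt0 ltr_wpDr//.
by rewrite mulr_ge0// mulr_ge0// heat_cst_ge0.
Qed.

Lemma sqrtD_le (x y : R) : 0 <= x -> 0 <= y ->
  Num.sqrt (x + y) <= Num.sqrt x + Num.sqrt y.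
Proof.
move=> x0 y0; rewrite -[leRHS]ger0_norm ?addr_ge0 ?sqrtr_ge0//.
rewrite -sqrtr_sqr ler_wsqrtr// sqrrD !sqr_sqrtr//.
by rewrite lerD2r lerDl mulrn_wge0// mulr_ge0 ?sqrtr_ge0.
Qed.

Lemma sqrt_levels_le (kappa D Q k L S : R) : 0 <= kappa -> 0 <= D -> 0 <= Q -> 1 <= k ->
  D + L + S <= k * (kappa ^+ 2 + D + Q) ->
  Num.sqrt (4 * (kappa ^+ 2 + D / 2 + 13 * heat_cst * (D + L + S))) <=
  wasserstein_cst k * (kappa + Num.sqrt Q + Num.sqrt D).
Proof.
move=> kap0 D0 Q0 k1 hL; have H0 := heat_cst_ge0.
set V := kappa ^+ 2 + D + Q.
have V0 : 0 <= V by rewrite !addr_ge0// sqr_ge0.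
have h1 : 4 * (kappa ^+ 2 + D / 2 + 13 * heat_cst * (D + L + S)) <=
    2 ^+ 2 * ((1 + 13 * heat_cst * k) * V).
  have : 13 * heat_cst * (D + L + S) <= 13 * heat_cst * (k * V).
    by apply: ler_wpM2l => //; rewrite mulr_ge0.
  have := sqr_ge0 kappa; rewrite /V in V0 *; lra.
apply: (le_trans (ler_wsqrtr h1)).
have c0 : 0 <= 1 + 13 * heat_cst * k.
  by rewrite addr_ge0// mulr_ge0 ?(le_trans ler01 k1)// mulr_ge0.
rewrite sqrtrM ?sqr_ge0// sqrtr_sqr ger0_norm// sqrtrM// mulrA ler_wpM2l//.
rewrite /V addrAC (le_trans (sqrtD_le _ _))//; first by rewrite addr_ge0 ?sqr_ge0.
rewrite lerD2r (le_trans (sqrtD_le _ _)) ?sqr_ge0//.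
by rewrite sqrtr_sqr ger0_norm.
Qed.

End constants.

(** * Truncation estimates for functions compared with the square and the cube *)

Section young_functions.
Context {R : realType}.
Variables (psi : R -> R).
Hypotheses (psi_gt0 : forall u, 0 < u -> 0 < psi u) (psi0 : 0 <= psi 0).

Let psi_ge0 u : 0 <= u -> 0 <= psi u.
Proof. by rewrite le_eqVlt => /predU1P[<-//|/psi_gt0/ltW]. Qed.

(** The two branches of the minimum meet at [|y| = kappa], that is [u = x], where the right-hand
    side is exactly [kappa ^+ 2]. Below, the cubic branch is controlled by the decrease of
    [psi u / u ^+ 3]; above, the quadratic one by the increase of [psi u / u ^+ 2]. *)
Lemma truncation_between (x kappa lam y : R) :
  (forall u v, 0 < u -> u <= v -> psi u / u ^+ 2 <= psi v / v ^+ 2) ->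
  (forall u v, 0 < u -> u <= v -> psi v / v ^+ 3 <= psi u / u ^+ 3) ->
  0 < x -> 0 < kappa -> kappa <= lam ->
  y ^+ 2 * Num.min 1 (`|y| / lam) <= kappa ^+ 2 / psi x * psi (`|y| * x / kappa).
Proof.
move=> psi2 psi3 x0 kap0 kl; set u := `|y| * x / kappa.
have yE : `|y| = u * kappa / x by rewrite /u; field; rewrite !gt_eqF.
have px := psi_gt0 x0; have lam0 : 0 < lam by exact: lt_le_trans kl.
have y2 : y ^+ 2 = (u * kappa / x) ^+ 2 by rewrite -yE real_normK ?num_real.
have [y0|y0] := eqVneq `|y| 0.
  have -> : u = 0 by rewrite /u y0 !mul0r.
  by rewrite y2 -yE y0 expr0n/= mul0r mulr_ge0// divr_ge0 ?sqr_ge0 ?(ltW px).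
have u0 : 0 < u by rewrite /u divr_gt0// mulr_gt0// lt_neqAle eq_sym y0/=.
case: (lerP u x) => ux.
  have h := psi3 _ _ u0 ux.
  apply: (@le_trans _ _ (y ^+ 2 * (`|y| / kappa))).
    rewrite ler_wpM2l ?sqr_ge0// ge_min; apply/orP; right.
    by rewrite ler_wpM2l// lef_pV2.
  have -> : y ^+ 2 * (`|y| / kappa) = kappa ^+ 2 * u ^+ 3 / psi x * (psi x / x ^+ 3).
    by rewrite y2 {1}yE; field; rewrite !gt_eqF.
  have -> : kappa ^+ 2 / psi x * psi u = kappa ^+ 2 * u ^+ 3 / psi x * (psi u / u ^+ 3).
    by field; rewrite !gt_eqF.
  by rewrite ler_wpM2l// divr_ge0 ?(ltW px)// mulr_ge0 ?sqr_ge0// exprn_ge0// ltW.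
have h := psi2 _ _ x0 (ltW ux).
apply: (@le_trans _ _ (y ^+ 2)).
  by rewrite ler_piMr ?sqr_ge0// ge_min lexx.
have -> : y ^+ 2 = kappa ^+ 2 * u ^+ 2 / psi x * (psi x / x ^+ 2).
  by rewrite y2; field; rewrite !gt_eqF.
have -> : kappa ^+ 2 / psi x * psi u = kappa ^+ 2 * u ^+ 2 / psi x * (psi u / u ^+ 2).
  by field; rewrite !gt_eqF.
by rewrite ler_wpM2l// divr_ge0 ?(ltW px)// mulr_ge0 ?sqr_ge0.
Qed.

Hypothesis psi3 : forall u v, 0 < u -> u <= v -> psi u / u ^+ 3 <= psi v / v ^+ 3.

Lemma truncation_above (c m M k lam y : R) : 0 < c -> 0 < m -> 0 < lam ->
  c * m <= M -> c ^+ 3 * m ^+ 3 / (lam * psi m) <= k ->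
  y ^+ 2 * Num.min 1 (`|y| / lam) <=
  y ^+ 2 * Num.min 1 (M / lam) + k * psi (`|y| / c).
Proof.
move=> c0 m0 lam0 cmM hk; have pm := psi_gt0 m0; set u := `|y| / c.
have yE : `|y| = u * c by rewrite /u divfK ?gt_eqF.
have u0 : 0 <= u by rewrite divr_ge0// ltW.
have k0 : 0 <= k.
  by apply: le_trans hk; rewrite divr_ge0 ?mulr_ge0 ?exprn_ge0// ltW.
case: (lerP u m) => um.
  rewrite ler_wpDr ?mulr_ge0 ?psi_ge0// ler_wpM2l ?sqr_ge0//.
  rewrite le_min !ge_min lexx/=; apply/orP; right.
  by rewrite ler_pM2r ?invr_gt0// (le_trans _ cmM)// yE mulrC ler_pM2l.
have M0 : 0 <= M by rewrite (le_trans _ cmM)// mulr_ge0// ltW.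
rewrite ler_wpDl//.
  by rewrite mulr_ge0 ?sqr_ge0// le_min ler01 divr_ge0// ltW.
have up := lt_trans m0 um.
apply: (@le_trans _ _ (c ^+ 3 * m ^+ 3 / (lam * psi m) * psi u)); last first.
  by rewrite ler_wpM2r// psi_ge0.
apply: (@le_trans _ _ (y ^+ 2 * (`|y| / lam))).
  by rewrite ler_wpM2l ?sqr_ge0// ge_min lexx orbT.
rewrite -[y ^+ 2]real_normK ?num_real// yE.
have -> : (u * c) ^+ 2 * (u * c / lam) = c ^+ 3 * m ^+ 3 / (lam * psi m) * u ^+ 3 * (psi m / m ^+ 3).
  by field; rewrite !gt_eqF.
have -> : c ^+ 3 * m ^+ 3 / (lam * psi m) * psi u =
    c ^+ 3 * m ^+ 3 / (lam * psi m) * u ^+ 3 * (psi u / u ^+ 3).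
  by field; rewrite !gt_eqF.
rewrite ler_wpM2l//; last by apply: psi3 => //; exact: ltW.
by rewrite mulr_ge0 ?exprn_ge0// divr_ge0 ?mulr_ge0 ?exprn_ge0// ltW.
Qed.

Lemma cube_le1 u : 0 < u -> u <= 1 -> psi u <= psi 1 * u ^+ 3.
Proof.
move=> u0 u1; have := psi3 u0 u1.
by rewrite expr1n divr1 ler_pdivrMr ?exprn_gt0.
Qed.

Lemma cube_ge1 u : 1 <= u -> psi 1 * u ^+ 3 <= psi u.
Proof.
move=> u1; have u0 : 0 < u by exact: lt_le_trans u1.
by have := psi3 ltr01 u1; rewrite expr1n divr1 ler_pdivlMr ?exprn_gt0.
Qed.

(** Serves to bound the scale from below: total variance 1 prevents [c ^+ 2 * n] from being
    small. *)
Lemma sqr_le_young (c y : R) : 0 < c -> y ^+ 2 <= c ^+ 2 * (1 + psi (`|y| / c) / psi 1).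
Proof.
move=> c0; set u := `|y| / c; have p1 := psi_gt0 ltr01.
have yE : `|y| = u * c by rewrite /u divfK ?gt_eqF.
have u0 : 0 <= u by rewrite divr_ge0// ltW.
rewrite -[y ^+ 2]real_normK ?num_real// yE exprMn mulrC ler_wpM2l ?sqr_ge0//.
case: (lerP u 1) => u1.
  rewrite ler_wpDr ?divr_ge0 ?psi_ge0 ?(ltW p1)//.
  by rewrite -[leRHS](expr1n _ 2) lerXn2r ?nnegrE.
rewrite ler_wpDl// ler_pdivlMr//; apply: le_trans (cube_ge1 (ltW u1)).
by rewrite mulrC ler_pM2l// ler_eXn2l.
Qed.

(* Dominates all the occurrences of [psi 1] in [level_bounds] and
   [wasserstein_le_above]. *)
Definition young_cst (a : R) : R := 2 + a + a ^+ 2 + a^-1.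
Local Notation G := (young_cst (psi 1)).

Lemma young_cst_ge2 a : 0 < a -> 2 <= young_cst a.
Proof.
move=> a0; have : 0 < a^-1 by rewrite invr_gt0.
by have := sqr_ge0 a; rewrite /young_cst; lra.
Qed.

(** Comparing [psi m = m * x ^+ 2] with [psi 1 * m ^+ 3] relates [m ^+ 2] to [x ^+ 2], from above if
    [m >= 1] and from below if [m <= 1]. The missing directions follow from
    [(1 + psi 1) * x ^+ 2 >= 1], a consequence of [psi x >= 1]. *)
Lemma level_bounds (x m N : R) : 0 < x -> 0 < m -> 1 <= N -> psi x = N ->
  psi m = m * x ^+ 2 -> 1 <= G * m ^+ 2 /\ m ^+ 2 <= G * x ^+ 2.
Proof.
move=> x0 m0 N1 px pm; have a0 := psi_gt0 ltr01.
set a := psi 1 in a0 *.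
have ai : 0 < a^-1 by rewrite invr_gt0.
have aV : a * a^-1 = 1 by rewrite divff// gt_eqF.
have x2 : 0 < x ^+ 2 by rewrite exprn_gt0.
have m2 : 0 < m ^+ 2 by rewrite exprn_gt0.
have hx : 1 <= (1 + a) * x ^+ 2.
  case: (lerP x 1) => x1.
    have := cube_le1 x0 x1; rewrite px -/a => h.
    have : x ^+ 3 <= x ^+ 2 by rewrite exprS ler_piMl// ltW.
    nra.
  have : 1 <= x ^+ 2 by rewrite exprn_ege1// ltW.
  nra.
rewrite /young_cst; case: (lerP m 1) => m1.
  have := cube_le1 m0 m1; rewrite pm -/a => h.
  have {}h : x ^+ 2 <= a * m ^+ 2.
    have : m * x ^+ 2 <= m * (a * m ^+ 2) by rewrite (le_trans h)//; rewrite exprS; lra.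
    by rewrite ler_pM2l.
  split.
    have : (1 + a) * x ^+ 2 <= (1 + a) * (a * m ^+ 2) by rewrite ler_pM2l//; lra.
    nra.
  have : m ^+ 2 <= 1 by rewrite exprn_ile1// ltW.
  have := sqr_ge0 a; nra.
have := cube_ge1 (ltW m1); rewrite pm -/a => h.
have {}h : a * m ^+ 2 <= x ^+ 2.
  have : m * (a * m ^+ 2) <= m * x ^+ 2 by rewrite (le_trans _ h)//; rewrite exprS; lra.
  by rewrite ler_pM2l.
have m1' : 1 <= m ^+ 2 by rewrite exprn_ege1// ltW.
split; first by have := sqr_ge0 a; nra.
have : a^-1 * (a * m ^+ 2) <= a^-1 * x ^+ 2 by rewrite ler_pM2l.
rewrite mulKf ?gt_eqF// => h'.
have := sqr_ge0 a; nra.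
Qed.

End young_functions.

(** * Bounds at a fixed admissible scale, for N-functions and powers alike *)

Section martingale_bounds.
Context d (T : measurableType d) (R : realType) (P : probability T R).
Local Notation E f := (Rintegral P setT f).
Variables (n : nat) (F : nat -> set (set T)) (Y : nat -> {RV P >-> R})
  (sigma2 : nat -> T -> R).
Hypothesis n_gt0 : (1 <= n)%N.
Hypothesis martY : martingale_difference n F Y.
Hypothesis Y2 : square_integrable n Y.
Hypothesis sigma2E : forall i, (1 <= i <= n)%N ->
  is_cond_exp P (F i.-1) (fun w => Y i w ^+ 2) (sigma2 i).
Hypothesis s_gt0 : 0 < std_sum n Y.
Local Notation s := (std_sum n Y).
Local Notation D1 := (E (fun w => `|normalized_cond_var n Y sigma2 w - 1|)).
Local Notation W2 :=
  (wasserstein 2 (distribution P (normalized_sum n Y)) (normal_prob 0%R 1%R)).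

Variables (psi : R -> R) (x c : R).
Hypotheses (psi_gt0 : forall u, 0 < u -> 0 < psi u) (psi0 : 0 <= psi 0).
Hypotheses (x_gt0 : 0 < x) (psix : psi x = n%:R) (c_gt0 : 0 < c).
Hypothesis ipsi : forall i, (i < n)%N -> rint P (fun w => psi (`|Y i.+1 w| / c)).
Hypothesis psi_le : \sum_(0 <= i < n) E (fun w => psi (`|Y i.+1 w| / c)) <= n%:R.

Let n0 : 0 < n%:R :> R. Proof. by rewrite ltr0n. Qed.
Let n1 : 1 <= n%:R :> R. Proof. by rewrite ler1n. Qed.
Let D0 : 0 <= D1. Proof. exact: Rintegral_ge0. Qed.
Let kappa := s^-1 * c * x.
Let kappa0 : 0 < kappa. Proof. by rewrite !mulr_gt0// invr_gt0. Qed.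
Let cs := s^-1 * c.
Let cs0 : 0 < cs. Proof. by rewrite mulr_gt0// invr_gt0. Qed.

Let psi_scaled i w : psi (`|scaled_increment n Y i w| / cs) = psi (`|Y i w| / c).
Proof.
congr psi; rewrite /scaled_increment normrM gtr0_norm ?invr_gt0// /cs.
by field; rewrite !gt_eqF.
Qed.

Let ipsi_scaled i : (i < n)%N ->
  rint P (fun w => psi (`|scaled_increment n Y i.+1 w| / cs)).
Proof. by move=> ni; apply: rint_eq (ipsi ni) => w; rewrite psi_scaled. Qed.

Let psi_scaled_le (K : R) : 0 <= K ->
  K / n%:R * \sum_(0 <= i < n) E (fun w => psi (`|scaled_increment n Y i.+1 w| / cs)) <= K.
Proof.
move=> K0.
have -> : \sum_(0 <= i < n) E (fun w => psi (`|scaled_increment n Y i.+1 w| / cs)) =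
    \sum_(0 <= i < n) E (fun w => psi (`|Y i.+1 w| / c)).
  by apply: eq_bigr => i _; apply: eq_Rintegral => w _; rewrite psi_scaled.
rewrite -mulrA ler_piMr// mulrC ler_pdivrMr// mul1r.
exact: psi_le.
Qed.

(** All truncation levels are 0: each Lindeberg term is at most [kappa ^+ 2 / n * psi], and
    admissibility of [c] bounds their sum by [kappa ^+ 2]. *)
Lemma wasserstein_le_between :
  (forall u v, 0 < u -> u <= v -> psi u / u ^+ 2 <= psi v / v ^+ 2) ->
  (forall u v, 0 < u -> u <= v -> psi v / v ^+ 3 <= psi u / u ^+ 3) ->
  (W2 <= (wasserstein_cst 1 * (s^-1 * c * x + Num.sqrt D1))%:E)%E.
Proof.
rewrite -/kappa => psi2 psi3.
have hM lam y : kappa <= lam -> y ^+ 2 * Num.min 1 (`|y| / lam) <=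
    y ^+ 2 * Num.min 1 ((0 * (lam < 0)%R%:R + 0 * (lam < 0)%R%:R + 0) / lam) +
    kappa ^+ 2 / n%:R * psi (`|y| / cs).
  have min10 : Num.min 1 0 = 0 :> R by apply/min_idPr.
  move=> kl; rewrite !mul0r !addr0 mul0r min10 mulr0 add0r -psix.
  have -> : `|y| / cs = `|y| * x / kappa.
    by rewrite /kappa /cs; field; rewrite !gt_eqF.
  exact: truncation_between.
have := wasserstein_levels martY Y2 sigma2E s_gt0 kappa0 (lexx 0) (lexx 0) (lexx 0)
  (lexx 0) (lexx 0) ipsi_scaled hM.
move/le_trans; apply; rewrite lee_fin.
set L := 2 * _; set S := kappa ^+ 2 / n%:R * _.
have hL : D1 + L + S <= 1 * (kappa ^+ 2 + D1 + 0).
  rewrite /L !mul0r !addr0 mulr0 addr0 mul1r addrC lerD2r.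
  by apply: psi_scaled_le; exact: sqr_ge0.
have := sqrt_levels_le (ltW kappa0) D0 (lexx 0) (lexx 1) hL.
by rewrite sqrtr0 addr0.
Qed.

Lemma wasserstein_le_above (m : R) :
  (forall u v, 0 < u -> u <= v -> psi u / u ^+ 3 <= psi v / v ^+ 3) ->
  0 < m -> psi m = m * x ^+ 2 ->
  (W2 <= (wasserstein_cst (7 * young_cst (psi 1)) *
    (s^-1 * c * x + s^-1 * c * (n%:R * m) `^ 4^-1 + Num.sqrt D1))%:E)%E.
Proof.
rewrite -/kappa -/cs => psi3 m0 pm; set G := young_cst (psi 1).
have a0 := psi_gt0 ltr01; have G2 : 2 <= G by exact: young_cst_ge2.
have G0 : 0 <= G := le_trans (ler0n R 2) G2.
(* Chosen from the cost of the middle level, [cs * m * l2 = Q ^+ 2 / (psi 1 * K)], which is at most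
   [Q / psi 1] as soon as [K >= Q]; the root of [Q] is the fourth-root term of the bound. *)
pose Q := cs ^+ 2 * Num.sqrt (n%:R * m).
have nm0 : 0 < n%:R * m by rewrite mulr_gt0.
have Q0 : 0 < Q by rewrite mulr_gt0 ?exprn_gt0// sqrtr_gt0.
have Q2 : Q ^+ 2 = cs ^+ 4 * (n%:R * m).
  by rewrite /Q exprMn sqr_sqrtr ?(ltW nm0)//; ring.
have sQ : Num.sqrt Q = cs * (n%:R * m) `^ 4^-1.
  rewrite /Q sqrtrM ?sqr_ge0// sqrtr_sqr gtr0_norm//; congr (_ * _).
  rewrite -(powR12_sqrt (ltW nm0)) -powR12_sqrt ?powR_ge0// -powRrM.
  by congr (_ `^ _); field.
rewrite -sQ.
pose K := kappa ^+ 2 + Q.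
have K0 : 0 < K by rewrite ltr_wpDl ?sqr_ge0.
have KQ : Q <= K by rewrite lerDr sqr_ge0.
have Kk : kappa ^+ 2 <= K by rewrite lerDl ltW.
(* Increments are cut at [cs * x] below the level [l1], at [cs * m] below [l2] and at
   [cs] above; these levels make the excess at most [K / n%:R * psi (`|y| / cs)]. *)
pose l1 := n%:R * cs ^+ 3 * m ^+ 2 / (x ^+ 2 * K).
pose l2 := n%:R * cs ^+ 3 / (psi 1 * K).
have c30 : 0 < cs ^+ 3 by rewrite exprn_gt0.
have x20 : 0 < x ^+ 2 by rewrite exprn_gt0.
have m20 : 0 < m ^+ 2 by rewrite exprn_gt0.
have l10 : 0 <= l1.
  by apply/ltW; apply: divr_gt0; [apply: mulr_gt0 => //; exact: mulr_gt0|exact: mulr_gt0].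
have l20 : 0 <= l2.
  by apply/ltW; apply: divr_gt0; exact: mulr_gt0.
have [mG mx] := level_bounds psi_gt0 psi3 x_gt0 m0 n1 psix pm.
rewrite -/G in mG mx.
have A10 : 0 <= cs * x by apply/ltW/mulr_gt0.
have A20 : 0 <= cs * m by apply/ltW/mulr_gt0.
have A30 : 0 <= cs by rewrite ltW.
have hM lam y : kappa <= lam -> y ^+ 2 * Num.min 1 (`|y| / lam) <=
    y ^+ 2 * Num.min 1 ((cs * x * (lam < l1)%R%:R + cs * m * (lam < l2)%R%:R + cs) / lam) +
    K / n%:R * psi (`|y| / cs).
  move=> kl; have lam0 : 0 < lam by exact: lt_le_trans kl.
  have above m' : 0 < m' ->
    cs * m' <= cs * x * (lam < l1)%R%:R + cs * m * (lam < l2)%R%:R + cs ->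
    cs ^+ 3 * m' ^+ 3 / (lam * psi m') <= K / n%:R ->
    y ^+ 2 * Num.min 1 (`|y| / lam) <=
    y ^+ 2 * Num.min 1 ((cs * x * (lam < l1)%R%:R + cs * m * (lam < l2)%R%:R + cs) / lam) +
    K / n%:R * psi (`|y| / cs).
    by move=> m'0; exact: truncation_above.
  have /orP[h1|h1] : (lam < l1) || (l1 <= lam) by case: ltP.
    apply: (above x) => //; first by rewrite h1 mulr1 -addrA lerDl addr_ge0// mulr_ge0.
    rewrite psix ler_pdivlMr//.
    have -> : cs ^+ 3 * x ^+ 3 / (lam * n%:R) * n%:R = kappa ^+ 2 * (kappa / lam).
      by rewrite /kappa -/cs; field; rewrite !gt_eqF.
    apply: le_trans Kk; rewrite ler_piMr ?sqr_ge0//.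
    by rewrite ler_pdivrMr// mul1r.
  have /orP[h2|h2] : (lam < l2) || (l2 <= lam) by case: ltP.
    apply: (above m) => //.
      by rewrite h2 mulr1 -addrA addrCA lerDl addr_ge0// mulr_ge0.
    rewrite pm ler_pdivlMr//.
    have -> : cs ^+ 3 * m ^+ 3 / (lam * (m * x ^+ 2)) * n%:R = l1 * (K / lam).
      by rewrite /l1; field; rewrite !gt_eqF.
    by rewrite mulrA ler_pdivrMr// mulrC ler_pM2l.
  apply: (above 1) => //.
    by rewrite mulr1 lerDr addr_ge0// mulr_ge0.
  rewrite expr1n mulr1 ler_pdivlMr//.
  have -> : cs ^+ 3 / (lam * psi 1) * n%:R = l2 * (K / lam).
    by rewrite /l2; field; rewrite !gt_eqF.
  by rewrite mulrA ler_pdivrMr// mulrC ler_pM2l.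
have := wasserstein_levels martY Y2 sigma2E s_gt0 kappa0 A10 A20 A30 l10 l20 ipsi_scaled hM.
move/le_trans; apply; rewrite lee_fin.
have hS := psi_scaled_le (ltW K0).
have b1 : cs * x * l1 <= G * Q.
  have -> : cs * x * l1 = Q * (Q / K) * (m / x).
    have -> : Q * (Q / K) * (m / x) = Q ^+ 2 / K * (m / x) by ring.
    by rewrite Q2 /l1; field; rewrite !gt_eqF.
  have mxG : m / x <= G.
    rewrite ler_pdivrMr// -[leLHS]ger0_norm ?(ltW m0)// -[leRHS]ger0_norm; last first.
      by rewrite mulr_ge0 ?(ltW x_gt0)//; lra.
    rewrite -!sqrtr_sqr ler_wsqrtr// exprMn (le_trans mx)// ler_wpM2r ?sqr_ge0//.
    nra.
  have QK : Q / K <= 1 by rewrite ler_pdivrMr// mul1r.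
  rewrite mulrC; apply: ler_pM => //; first by rewrite divr_ge0 ?ltW.
    by rewrite mulr_ge0 ?divr_ge0 ?ltW.
  by rewrite ler_piMr ?(ltW Q0).
have aG : (psi 1)^-1 <= G.
  by rewrite /G /young_cst lerDr !addr_ge0 ?sqr_ge0 ?(ltW a0).
have b2 : cs * m * l2 <= G * Q.
  have -> : cs * m * l2 = (psi 1)^-1 * (Q * (Q / K)).
    have -> : (psi 1)^-1 * (Q * (Q / K)) = Q ^+ 2 / K / psi 1 by ring.
    by rewrite Q2 /l2; field; rewrite !gt_eqF.
  have QK : Q / K <= 1 by rewrite ler_pdivrMr// mul1r.
  apply: ler_pM => //; first by rewrite invr_ge0 ltW.
    by rewrite mulr_ge0 ?divr_ge0 ?ltW.
  by rewrite ler_piMr ?(ltW Q0).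
(* The scaled variances sum to 1, while [sqr_le_young] and admissibility bound this sum by a
   multiple of [cs ^+ 2 * n]. *)
have cn : 1 <= G * (cs ^+ 2 * n%:R).
  have : 1 <= cs ^+ 2 * (n%:R + n%:R / psi 1).
    apply: (@le_trans _ _ (\sum_(0 <= i < n) E (fun w => scaled_increment n Y i.+1 w ^+ 2))).
      by rewrite scaled_increment_sqr.
    have i1 i : (i < n)%N -> rint P (fun w => scaled_increment n Y i.+1 w ^+ 2).
      by move=> ni; apply: rint_sqrZ; apply: Lfun2_integrable_sqr; exact: Y2.
    have i2 i : (i < n)%N -> rint P (fun w => cs ^+ 2 *
        (1 + psi (`|scaled_increment n Y i.+1 w| / cs) / psi 1)).
      move=> ni; apply: rintZl; apply: rintD; first exact: rint_cst.
      by apply: rintZr; exact: ipsi_scaled.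
    apply: (@le_trans _ _ (\sum_(i < n) cs ^+ 2 *
        (1 + E (fun w => psi (`|scaled_increment n Y i.+1 w| / cs)) / psi 1))).
      rewrite big_mkord; apply: ler_sum => i _.
      have ip := ipsi_scaled (ltn_ord i).
      apply: (le_trans (le_Rint (i1 _ (ltn_ord i)) (i2 _ (ltn_ord i)) _)).
        by move=> w; exact: sqr_le_young.
      rewrite RintegralZl//; last first.
        by apply: rintD; [exact: rint_cst|exact: rintZr].
      rewrite RintegralD//; [|exact: rint_cst|exact: rintZr].
      by rewrite Rintegral_prob_cst RintegralZr.
    rewrite -mulr_sumr ler_wpM2l ?sqr_ge0// big_split/= sumr_const card_ord.
    rewrite lerD2l -mulr_suml ler_pM2r ?invr_gt0//.
    apply: le_trans psi_le; rewrite big_mkord.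
    by apply: ler_sum => i _; apply: le_Rint; [exact: ipsi_scaled|exact: ipsi|move=> w; rewrite psi_scaled].
  move/le_trans; apply.
  have -> : cs ^+ 2 * (n%:R + n%:R / psi 1) = (1 + (psi 1)^-1) * (cs ^+ 2 * n%:R) by ring.
  apply: ler_wpM2r; first by apply: mulr_ge0; [exact: sqr_ge0|exact: ltW].
  by rewrite /G /young_cst; have := sqr_ge0 (psi 1); lra.
(* In [Q ^+ 2 = cs ^+ 2 * (cs ^+ 2 * n) * m] both [cs ^+ 2 * n] and [m] are at least [G^-1], so even
   the permanent level [cs] costs no more than [G * Q]. *)
have b3 : cs <= G * Q.
  have h : cs ^+ 2 <= (G * Q) ^+ 2.
    have mG' : 1 <= G * m.
      have : 1 <= (G * m) ^+ 2.
        rewrite exprMn (le_trans mG)// ler_wpM2r ?sqr_ge0//; nra.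
      have Gm0 : 0 <= G * m := mulr_ge0 G0 (ltW m0).
      by rewrite -[leLHS](expr1n _ 2) ler_sqr ?nnegrE.
    rewrite [leRHS]exprMn Q2.
    have -> : G ^+ 2 * (cs ^+ 4 * (n%:R * m)) = cs ^+ 2 * (G * (cs ^+ 2 * n%:R) * (G * m)) by ring.
    by rewrite ler_peMr ?sqr_ge0// mulr_ege1.
  have GQ0 : 0 <= G * Q := mulr_ge0 G0 (ltW Q0).
  by rewrite -ler_sqr ?nnegrE.
(* The three levels cost [6 * G * Q] in total and the excess [K = kappa ^+ 2 + Q]; the seventh [G]
   pays for the latter and for [D1]. *)
have k7 : 1 <= 7 * G by lra.
apply: (sqrt_levels_le (ltW kappa0) D0 (ltW Q0) k7).
have hk : 0 <= kappa ^+ 2 := sqr_ge0 _.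
apply: (@le_trans _ _ (D1 + 6 * (G * Q) + K)); first by rewrite lerD//; lra.
have : 0 <= G * D1 := mulr_ge0 G0 D0.
have : 0 <= G * Q := mulr_ge0 G0 (ltW Q0).
have : 2 * kappa ^+ 2 <= G * kappa ^+ 2 by rewrite ler_wpM2r.
have : 2 * D1 <= G * D1 by rewrite ler_wpM2r.
have : 2 * Q <= G * Q by rewrite ler_wpM2r ?(ltW Q0).
rewrite /K; lra.
Qed.

End martingale_bounds.

(** * N-functions and Orlicz norms *)

Section ge0_inverse.
Context {R : realType}.
Implicit Types (f : R -> R) (a b k v : R).

Lemma ge0_invP f v : (exists2 u, 0 <= u & f u = v) ->
  0 <= ge0_inv f v /\ f (ge0_inv f v) = v.
Proof.
move=> [u u0 fu].
have sf : set_surj `[0, +oo[ [set v] f.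
  by move=> _ ->; exists u => //=; rewrite in_itv/= u0.
split.
  have : [set` `[0, +oo[] (ge0_inv f v).
    by apply: (surjpinv_image_sub sf); exists v.
  by rewrite /= in_itv/= andbT.
by apply: pinvK; rewrite inE; exists u => //=; rewrite in_itv/= u0.
Qed.

(** Clamping the argument to [[a, b]] extends [f] to a Lipschitz function on the line, hence a
    continuous one. Scaling by [k + 1] instead of [k] covers [k = 0]. *)
Lemma lipschitz_IVT f a b k v : a <= b -> 0 <= k ->
  (forall x y, a <= x -> x <= y -> y <= b -> `|f y - f x| <= k * (y - x)) ->
  f a <= v <= f b -> exists2 u, a <= u <= b & f u = v.
Proof.
move=> ab k0 lf fv; pose clamp (u : R) := Num.max a (Num.min b u).
have clampE u : a <= u <= b -> clamp u = u.
  by move=> /andP[au ub]; rewrite /clamp min_r// max_r.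
have lg : lip1 (fun u => (k + 1)^-1 * f (clamp u)).
  have k1 : 0 < k + 1 by rewrite ltr_wpDl.
  have main x y : x <= y -> `|(k + 1)^-1 * f (clamp y) - (k + 1)^-1 * f (clamp x)| <= y - x.
    move=> xy; rewrite -mulrBr normrM gtr0_norm ?invr_gt0// mulrC ler_pdivrMr//.
    have ca z : a <= clamp z by rewrite /clamp le_max lexx.
    have cb z : clamp z <= b by rewrite /clamp ge_max ab ge_min lexx.
    have [cxy cd] : clamp x <= clamp y /\ clamp y - clamp x <= y - x.
      by rewrite /clamp /Num.max /Num.min; split; do ![case: ifPn]; rewrite -?leNgt; lra.
    apply: le_trans (lf _ _ (ca x) cxy (cb y)) _.
    by rewrite mulrC ler_pM ?subr_ge0// lerDl.
  move=> x y; have [xy|/ltW xy] := leP x y; last by rewrite (le_trans (main _ _ xy))// ler_norm.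
  by rewrite distrC [leRHS]distrC (le_trans (main _ _ xy))// ler_norm.
pose g (u : R) := f (clamp u).
have cg : {within `[a, b], continuous g}.
  apply: continuous_subspaceT => u.
  have -> : g = (fun u => (k + 1) * ((k + 1)^-1 * f (clamp u))).
    by apply/funext => w; rewrite mulrA divff ?mul1r// gt_eqF// ltr_wpDl.
  by apply: cvgM; [exact: cvg_cst|exact: (lip1_continuous lg)].
have gab u : a <= u <= b -> g u = f u by move=> /clampE; rewrite /g => ->.
have [|u] := IVT ab cg (v := v).
  by rewrite !gab ?lexx ?ab// ge_min le_max; case/andP: fv => -> ->; rewrite orbT.
rewrite in_itv/= => uab <-; exists u => //; by rewrite gab.
Qed.

End ge0_inverse.

(** * Convexity, growth and inverses of N-functions *)

Section N_function_properties.
Context {R : realType}.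
Implicit Types (psi : R -> R) (u v t : R).

Lemma convex_functionE psi u v t : convex_function (`[0, +oo[ : set R^o) psi ->
  0 <= u -> 0 <= v -> 0 <= t <= 1 ->
  psi (t * u + (1 - t) * v) <= t * psi u + (1 - t) * psi v.
Proof.
move=> cpsi u0 v0 /andP[t0 t1]; have := cpsi (Itv01 t0 t1) u v.
by rewrite !inE/= !in_itv/= !andbT !convRE/= => /(_ u0 v0).
Qed.

Lemma convex0_ratio_le psi u v : convex_function (`[0, +oo[ : set R^o) psi ->
  psi 0 = 0 -> 0 < u -> u <= v -> psi u / u <= psi v / v.
Proof.
move=> cpsi psi0 u0 uv; have v0 := lt_le_trans u0 uv.
have uv1 : 0 <= u / v <= 1.
  by apply/andP; split; [exact: divr_ge0 (ltW u0) (ltW v0)|rewrite ler_pdivrMr// mul1r].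
have := convex_functionE cpsi (ltW v0) (lexx 0) uv1.
rewrite mulr0 addr0 psi0 mulr0 addr0 divfK ?gt_eqF// => h.
by rewrite ler_pdivrMr// mulrAC [psi v * u]mulrC mulrAC.
Qed.

Section N_function.
Variable psi : R -> R.
Hypothesis Npsi : N_function psi.

Lemma N_function0 : psi 0 = 0. Proof. by case: Npsi. Qed.

Lemma N_function_gt0 u : 0 < u -> 0 < psi u.
Proof. by case: Npsi => _ _ h _ _; exact: h. Qed.

Lemma N_function_ge0 u : 0 <= u -> 0 <= psi u.
Proof.
by rewrite le_eqVlt => /predU1P[<-|/N_function_gt0/ltW//]; rewrite N_function0.
Qed.

Lemma N_function_ratio_le u v : 0 < u -> u <= v -> psi u / u <= psi v / v.
Proof. by case: Npsi => cpsi psi0 _ _ _; exact: convex0_ratio_le. Qed.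

Lemma N_function_le u v : 0 <= u -> u <= v -> psi u <= psi v.
Proof.
rewrite le_eqVlt => /predU1P[<- v0|u0 uv]; first by rewrite N_function0 N_function_ge0.
have v0 := lt_le_trans u0 uv.
have := N_function_ratio_le u0 uv; rewrite ler_pdivrMr// => /le_trans; apply.
by rewrite mulrAC ler_pdivrMr// ler_wpM2l// ltW// N_function_gt0.
Qed.

(** By convexity the slope on [[u, v]] is at most the slope on [[u, b + 1]]. Going one unit beyond
    [b] keeps the length of that interval at least 1. *)
Lemma N_function_lipschitz b u v : 0 <= u -> u <= v -> v <= b ->
  psi v - psi u <= psi (b + 1) * (v - u).
Proof.
move=> u0 uv vb; have bu : 0 < b + 1 - u by lra.
have b0 : 0 <= b + 1 by lra.
have t01 : 0 <= (b + 1 - v) / (b + 1 - u) <= 1.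
  by apply/andP; split; [apply: divr_ge0; lra|rewrite ler_pdivrMr// mul1r; lra].
have cpsi : convex_function (`[0, +oo[ : set R^o) psi by case: Npsi.
have := convex_functionE cpsi u0 b0 t01.
have -> : 1 - (b + 1 - v) / (b + 1 - u) = (v - u) / (b + 1 - u).
  by field; rewrite gt_eqF.
have -> : (b + 1 - v) / (b + 1 - u) * u + (v - u) / (b + 1 - u) * (b + 1) = v.
  by field; rewrite gt_eqF.
have pu := N_function_ge0 u0; have pb := N_function_ge0 b0.
have : (b + 1 - v) / (b + 1 - u) * psi u <= psi u.
  by rewrite ler_piMl//; case/andP: t01.
have : (v - u) / (b + 1 - u) * psi (b + 1) <= psi (b + 1) * (v - u).
  rewrite mulrC ler_wpM2l// ler_pdivrMr// ler_peMr ?subr_ge0//; lra.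
lra.
Qed.

Lemma N_function_ratio_unbounded k : exists2 b, 1 <= b & k <= psi b / b.
Proof.
case: Npsi => _ _ _ _ /cvgryPge/(_ k) h.
near (pinfty_nbhs R) => b; exists b; near: b; last exact: h.
exact: nbhs_pinfty_ge.
Unshelve. all: by end_near. Qed.

Lemma N_function_ratio_small k : 0 < k -> exists2 a, 0 < a <= 1 & psi a / a <= k.
Proof.
case: Npsi => _ _ _ h _ k0; have hk := cvgr_le _ h _ k0.
near (0 : R)^'+ => a; exists a; last near: a.
  by apply/andP; split; near: a; [exact: nbhs_right_gt|exact: nbhs_right_le].
exact: hk.
Unshelve. all: by end_near. Qed.

Lemma N_function_invP v : 0 <= v -> 0 <= ge0_inv psi v /\ psi (ge0_inv psi v) = v.
Proof.
move=> v0; have [b b1 vb] := N_function_ratio_unbounded v.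
have b0 : 0 <= b by lra.
have [| | |u ub <-] := @lipschitz_IVT _ psi 0 b (psi (b + 1)) v b0.
- by apply: N_function_ge0; lra.
- move=> x y x0 xy yb; rewrite ger0_norm; first exact: N_function_lipschitz.
  by rewrite subr_ge0 N_function_le.
- rewrite N_function0 v0/= (le_trans vb)// ler_pdivrMr; last by lra.
  by rewrite ler_peMr// N_function_ge0.
by apply: ge0_invP; exists u => //; case/andP: ub.
Qed.

Lemma N_function_ratio_invP v : 0 < v -> let m := ge0_inv (fun x => psi x / x) v in
  0 <= m /\ psi m / m = v.
Proof.
move=> v0; have [b b1 vb] := N_function_ratio_unbounded v.
have [a /andP[a0 a1] av] := N_function_ratio_small v0.
have b0 : 0 <= b by lra.
have pb : 0 <= psi (b + 1) by apply: N_function_ge0; lra.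
have ab : a <= b by lra.
have [| | |u ub e] := @lipschitz_IVT _ (fun x => psi x / x) a b (psi (b + 1) / a) v ab.
- by rewrite divr_ge0// ltW.
- move=> x y ax xy yb; have x0 : 0 < x by lra.
  have y0 : 0 < y by lra.
  rewrite ger0_norm ?subr_ge0 ?N_function_ratio_le//.
  apply: (@le_trans _ _ ((psi y - psi x) / y)).
    rewrite mulrBl lerB// ler_pM2l ?N_function_gt0// lef_pV2// posrE.
  apply: (@le_trans _ _ (psi (b + 1) * (y - x) / y)).
    by rewrite ler_pM2r ?invr_gt0// N_function_lipschitz// ltW.
  rewrite mulrAC ler_wpM2r ?subr_ge0// ler_wpM2l// lef_pV2// ?posrE//; lra.
- by rewrite av vb.
by apply: ge0_invP; exists u => //; rewrite (le_trans (ltW a0))//; case/andP: ub.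
Qed.

Lemma measurable_N_function d (T : measurableType d) (f : T -> R) c :
  0 < c -> measurable_fun setT f -> measurable_fun setT (fun w => psi (`|f w| / c)).
Proof.
move=> c0 mf; pose h u := psi (Num.max 0 u).
have -> : (fun w => psi (`|f w| / c)) = h \o (fun w => `|f w| / c).
  by apply/funext => w; rewrite /h/= max_r// divr_ge0// ltW.
apply: measurableT_comp.
  apply: nondecreasing_measurable => // u v uv; apply: N_function_le.
    by rewrite le_max lexx.
  by rewrite ge_max le_max lexx/= le_max uv orbT.
by apply: measurable_funM => //; exact: measurableT_comp.
Qed.

Lemma prec_cube_ratio_ge u v : prec psi (fun x => x ^+ 3) -> 0 < u -> u <= v ->
  psi v / v ^+ 3 <= psi u / u ^+ 3.
Proof.
move=> h u0 uv; have v0 := lt_le_trans u0 uv.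
have := h u v; rewrite !in_itv/= u0 v0 => /(_ isT isT uv).
rewrite -lef_pV2 ?posrE ?divr_gt0 ?exprn_gt0 ?N_function_gt0//.
by rewrite !invf_div.
Qed.

Lemma prec_cube_ratio_le u v : prec (fun x => x ^+ 3) psi -> 0 < u -> u <= v ->
  psi u / u ^+ 3 <= psi v / v ^+ 3.
Proof.
move=> h u0 uv; have v0 := lt_le_trans u0 uv.
by have := h u v; rewrite !in_itv/= u0 v0 => /(_ isT isT uv).
Qed.

Lemma convex_sqrt_ratio_le u v :
  convex_function (`[0, +oo[ : set R^o) (psi \o Num.sqrt) ->
  0 < u -> u <= v -> psi u / u ^+ 2 <= psi v / v ^+ 2.
Proof.
move=> h u0 uv; have v0 := lt_le_trans u0 uv.
have u20 : 0 < u ^+ 2 by rewrite exprn_gt0.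
have uv2 : u ^+ 2 <= v ^+ 2 by rewrite ler_sqr// nnegrE ltW.
have sqrtK w : 0 < w -> Num.sqrt (w ^+ 2) = w by move=> w0; rewrite sqrtr_sqr gtr0_norm.
have := convex0_ratio_le h _ u20 uv2.
by rewrite /= !sqrtK// sqrtr0; apply; exact: N_function0.
Qed.

End N_function.
End N_function_properties.

(** * Passing to the infimum over scales *)

Section ereal_bounds.
Context {R : realType}.
Local Open Scope ereal_scope.
Implicit Types (W : \bar R) (k q d c : R).

(** Scales must be positive whereas a power or supremum norm may vanish; the bound at the norm
    itself is reached from larger scales. *)
Lemma le_affine_limit W k q d c : (forall c', (0 < c')%R -> (c <= c')%R ->
    W <= (k * (q * c' + d))%:E) -> (0 <= c)%R -> (0 <= k)%R -> (0 <= q)%R ->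
  W <= (k * (q * c + d))%:E.
Proof.
move=> h c0 k0 q0; apply/lee_addgt0Pr => e e0.
have kq : (0 < k * q + 1)%R by rewrite ltr_wpDl// mulr_ge0.
have e1 : (0 < e / (k * q + 1))%R by rewrite divr_gt0.
apply: le_trans (h (c + e / (k * q + 1))%R _ _) _.
- by rewrite ltr_wpDl.
- by rewrite lerDl ltW.
rewrite -EFinD lee_fin.
have -> : (k * (q * (c + e / (k * q + 1)) + d) =
  k * (q * c + d) + e * (k * q / (k * q + 1)))%R by field; rewrite gt_eqF.
by rewrite lerD2l ler_piMr ?(ltW e0)// ler_pdivrMr// mul1r lerDl.
Qed.

(** When no scale is admissible the infimum is [+oo] and the bound is trivial; this is where [q > 0]
    and [C > 0] enter. *)
Lemma le_affine_ereal_inf (A : set R) W (C k q d : R) :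
  (0 < k)%R -> (k <= C)%R -> (0 < q)%R -> (0 <= d)%R ->
  (forall c, A c -> (0 < c)%R /\ W <= (k * (q * c + d))%:E) ->
  W <= C%:E * (ereal_inf [set c%:E | c in A] * q%:E + d%:E).
Proof.
move=> k0 kC q0 d0 h; have C0 := lt_le_trans k0 kC.
set o := ereal_inf _.
have o0 : 0 <= o by apply: le_ereal_inf_tmp => _ [c /h[c0 _] <-]; rewrite lee_fin ltW.
have ho : W <= (k * q)%:E * o + (k * d)%:E.
  rewrite -leeBlDr// -lee_pdivrMl ?mulr_gt0//.
  apply: le_ereal_inf_tmp => _ [c /h[_ hc] <-].
  rewrite lee_pdivrMl ?mulr_gt0// leeBlDr// (le_trans hc)//.
  by rewrite -EFinM -EFinD lee_fin mulrDr mulrA.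
apply: (le_trans ho); clearbody o; clear ho h; case: o o0 => [z| |]// z0.
  change ((k * q * z + k * d)%:E <= (C * (z * q + d))%:E).
  rewrite lee_fin -mulrA -mulrDr [(z * q)%R]mulrC.
  by rewrite ler_wpM2r// addr_ge0// mulr_ge0 ?(ltW q0).
by rewrite gt0_mulye ?lte_fin// addye// !gt0_muley ?lte_fin ?mulr_gt0// leey.
Qed.

End ereal_bounds.

Section expectations.
Context d (T : measurableType d) (R : realType) (P : probability T R).
Local Notation E f := (Rintegral P setT f).
Local Open Scope ereal_scope.

Lemma sum_expectation_le (n : nat) (f : nat -> T -> R) (K : R) :
  (forall i, measurable_fun setT (f i)) -> (forall i w, (0 <= f i w)%R) ->
  \sum_(1 <= i < n.+1) 'E_P[f i] <= K%:E ->
  (forall i, (i < n)%N -> rint P (f i.+1)) /\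
  (\sum_(0 <= i < n) E (f i.+1) <= K)%R.
Proof.
move=> mf f0; rewrite big_add1/= => hK.
have E0 i : 0 <= 'E_P[f i].
  by rewrite unlock; apply: integral_ge0 => w _; rewrite lee_fin.
have fi i : (i < n)%N -> rint P (f i.+1).
  move=> ni; apply/integrableP; split; first exact/measurable_EFinP.
  apply: le_lt_trans (ltry K); apply: le_trans hK.
  rewrite big_mkord (bigD1 (Ordinal ni))//= -[leLHS]adde0.
  apply: leeD; last by apply: sume_ge0.
  by rewrite unlock; under eq_integral do rewrite /= ger0_norm//.
split => //; rewrite -lee_fin; apply: le_trans hK.
rewrite !big_mkord -sumEFin; apply: lee_sum => i _.
by rewrite unlock (EFin_Rintegral (fi _ (ltn_ord i))).
Qed.

End expectations.

(** * Orlicz bounds *)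

Section wasserstein_bounds.
Context d (T : measurableType d) (R : realType) (P : probability T R).
Local Notation E f := (Rintegral P setT f).
Variables (n : nat) (F : nat -> set (set T)) (Y : nat -> {RV P >-> R})
  (sigma2 : nat -> T -> R).
Hypothesis n_gt0 : (1 <= n)%N.
Hypothesis martY : martingale_difference n F Y.
Hypothesis Y2 : square_integrable n Y.
Hypothesis sigma2E : forall i, (1 <= i <= n)%N ->
  is_cond_exp P (F i.-1) (fun w => Y i w ^+ 2) (sigma2 i).
Hypothesis s_gt0 : 0 < std_sum n Y.
Local Notation s := (std_sum n Y).
Local Notation D1 := (E (fun w => `|normalized_cond_var n Y sigma2 w - 1|)).
Local Notation W2 :=
  (wasserstein 2 (distribution P (normalized_sum n Y)) (normal_prob 0%R 1%R)).
Local Notation K0 := (@wasserstein_cst R 1).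
Local Notation K1 a := (@wasserstein_cst R (7 * young_cst a)).

Let n0 : 0 < n%:R :> R. Proof. by rewrite ltr0n. Qed.
Let sV0 : 0 < s^-1. Proof. by rewrite invr_gt0. Qed.

Lemma Lnorm_variance_dist :
  ('N[P]_1[(fun w => (normalized_cond_var n Y sigma2 w - 1)%:E)] `^ 2^-1 =
   (Num.sqrt D1)%:E)%E.
Proof.
have i1 := rint_norm (rint_variance_dist sigma2E).
rewrite Lnorm1 -(EFin_Rintegral i1) poweR_EFin powR12_sqrt//.
exact: Rintegral_ge0.
Qed.

Lemma orlicz_norm_admissible psi c : N_function psi -> 0 < c ->
  ((n%:R^-1)%:E * \sum_(1 <= i < n.+1) 'E_P[fun w => psi (`|Y i w| / c)%R]
      <= 1)%E ->
  (forall i, (i < n)%N -> rint P (fun w => psi (`|Y i.+1 w| / c))) /\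
  \sum_(0 <= i < n) E (fun w => psi (`|Y i.+1 w| / c)) <= n%:R.
Proof.
move=> Npsi c0; rewrite lee_pdivrMl// mule1 => h.
apply: sum_expectation_le h => i; first exact: measurable_N_function.
by move=> w; apply: N_function_ge0 => //; rewrite divr_ge0// ltW.
Qed.

Lemma wasserstein_orlicz_between (C : R) psi : K0 <= C -> N_function psi ->
  prec psi (fun x => x ^+ 3) ->
  convex_function (`[0, +oo[ : set R^o) (psi \o Num.sqrt) ->
  (W2 <= C%:E * (lyapunov_orlicz n Y psi + (Num.sqrt D1)%:E))%E.
Proof.
move=> hC Npsi psi3 psi2.
have [x0 px] := N_function_invP Npsi (ltW n0).
set x := ge0_inv psi n%:R in x0 px.
have xp : 0 < x.
  rewrite lt_neqAle x0 andbT; apply/eqP => xE.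
  by move: n0; rewrite -px -xE N_function0// ltxx.
have -> : (lyapunov_orlicz n Y psi = orlicz_norm n Y psi * (s^-1 * x)%:E)%E.
  by rewrite /lyapunov_orlicz muleAC muleC -EFinM.
apply: (@le_affine_ereal_inf _ _ _ _ K0) => //.
- exact: wasserstein_cst_gt0.
- exact: mulr_gt0.
move=> c [c0 hc]; split=> //.
have [ip pl] := orlicz_norm_admissible Npsi c0 hc.
have -> : s^-1 * x * c = s^-1 * c * x by ring.
apply: (@wasserstein_le_between _ _ _ P n F Y sigma2 _ _ _ _ _ psi) => //.
- by move=> u; exact: N_function_gt0.
- by rewrite N_function0.
- by move=> u v; exact: (convex_sqrt_ratio_le Npsi psi2).
- by move=> u v; exact: (prec_cube_ratio_ge Npsi psi3).
Qed.

Lemma wasserstein_orlicz_above psi : N_function psi ->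
  prec (fun x => x ^+ 3) psi ->
  (W2 <= (K1 (psi 1))%:E * (lyapunov_orlicz n Y psi
      + (s^-1)%:E * orlicz_norm n Y psi
        * ((n%:R * ge0_inv (fun x => psi x / x) (ge0_inv psi n%:R ^+ 2)) `^ 4^-1)%:E
      + (Num.sqrt D1)%:E))%E.
Proof.
move=> Npsi psi3.
have [x0 px] := N_function_invP Npsi (ltW n0).
rewrite /lyapunov_orlicz; set x := ge0_inv psi n%:R in x0 px *.
have xp : 0 < x.
  rewrite lt_neqAle x0 andbT; apply/eqP => xE.
  by move: n0; rewrite -px -xE N_function0// ltxx.
have x20 : 0 < x ^+ 2 by rewrite exprn_gt0.
have [m0 pm] := N_function_ratio_invP Npsi x20.
set m := ge0_inv _ (x ^+ 2) in m0 pm *.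
have mp : 0 < m.
  rewrite lt_neqAle m0 andbT; apply/eqP => mE.
  by move: x20; rewrite -pm -mE invr0 mulr0 ltxx.
have a0 : 0 < psi 1 by exact: N_function_gt0.
set t := (n%:R * m) `^ 4^-1.
have t0 : 0 <= t by exact: powR_ge0.
have -> : ((s^-1)%:E * orlicz_norm n Y psi * x%:E + (s^-1)%:E * orlicz_norm n Y psi * t%:E =
    orlicz_norm n Y psi * (s^-1 * (x + t))%:E)%E.
  rewrite -ge0_muleDr ?lee_fin//.
  by rewrite -EFinD muleAC muleC -EFinM.
apply: (@le_affine_ereal_inf _ _ _ _ (K1 (psi 1))) => //.
- apply: wasserstein_cst_gt0; apply: mulr_ge0 => //.
  by apply: le_trans (young_cst_ge2 a0).
- by apply: mulr_gt0 => //; exact: ltr_wpDr.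
move=> c [c0 hc]; split=> //.
have [ip pl] := orlicz_norm_admissible Npsi c0 hc.
have -> : s^-1 * (x + t) * c = s^-1 * c * x + s^-1 * c * t by ring.
apply: (@wasserstein_le_above _ _ _ P n F Y sigma2 _ _ _ _ _ psi) => //.
- by move=> u; exact: N_function_gt0.
- by rewrite N_function0.
- by move=> u v; exact: (prec_cube_ratio_le psi3).
- by rewrite -pm mulrC divfK// gt_eqF.
Qed.

End wasserstein_bounds.

(** * Power and supremum bounds *)

Section power_bounds.
Context d (T : measurableType d) (R : realType) (P : probability T R).
Local Notation E f := (Rintegral P setT f).
Variables (n : nat) (F : nat -> set (set T)) (Y : nat -> {RV P >-> R})
  (sigma2 : nat -> T -> R).
Hypothesis n_gt0 : (1 <= n)%N.
Hypothesis martY : martingale_difference n F Y.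
Hypothesis Y2 : square_integrable n Y.
Hypothesis sigma2E : forall i, (1 <= i <= n)%N ->
  is_cond_exp P (F i.-1) (fun w => Y i w ^+ 2) (sigma2 i).
Hypothesis s_gt0 : 0 < std_sum n Y.
Local Notation s := (std_sum n Y).
Local Notation D1 := (E (fun w => `|normalized_cond_var n Y sigma2 w - 1|)).
Local Notation W2 :=
  (wasserstein 2 (distribution P (normalized_sum n Y)) (normal_prob 0%R 1%R)).
Local Notation K0 := (@wasserstein_cst R 1).
Local Notation K1 a := (@wasserstein_cst R (7 * young_cst a)).

Let n0 : 0 < n%:R :> R. Proof. by rewrite ltr0n. Qed.
Let n1 : 1 <= n%:R :> R. Proof. by rewrite ler1n. Qed.
Let sV0 : 0 < s^-1. Proof. by rewrite invr_gt0. Qed.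

Lemma powR_admissible p c : 0 < p -> 0 < c ->
  (forall i, (i < n)%N -> rint P (fun w => `|Y i.+1 w| `^ p)) ->
  \sum_(0 <= i < n) E (fun w => `|Y i.+1 w| `^ p) <= n%:R * c `^ p ->
  (forall i, (i < n)%N -> rint P (fun w => (`|Y i.+1 w| / c) `^ p)) /\
  \sum_(0 <= i < n) E (fun w => (`|Y i.+1 w| / c) `^ p) <= n%:R.
Proof.
move=> p0 c0 ip hp; have cp := powR_gt0 p c0.
have YE i w : (`|Y i w| / c) `^ p = `|Y i w| `^ p / c `^ p.
  have h : 0 <= `|Y i w| / c by rewrite divr_ge0// ltW.
  by rewrite -{2}(divfK (lt0r_neq0 c0) `|Y i w|) (powRM _ h (ltW c0)) mulfK ?(lt0r_neq0 cp).
split=> [i ni|].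
  by apply: (@rint_eq _ _ _ P (fun w => `|Y i.+1 w| `^ p / c `^ p)) => //; apply: rintZr; exact: ip.
apply: (@le_trans _ _ ((\sum_(0 <= i < n) E (fun w => `|Y i.+1 w| `^ p)) / c `^ p)).
  rewrite !big_mkord mulr_suml; apply: ler_sum => i _.
  rewrite -RintegralZr//; last exact: ip.
  by rewrite le_eqVlt; apply/orP; left; apply/eqP; apply: eq_Rintegral.
by rewrite ler_pdivrMr.
Qed.

Let powR_divX (p : R) (k : nat) u : 0 < u -> u `^ p / u ^+ k = u `^ (p - k%:R).
Proof. by move=> u0; rewrite powRB ?(gt_eqF u0) ?implybT// powR_mulrn// ltW. Qed.

Lemma wasserstein_powR_between p c : 2 < p <= 3 -> 0 < c ->
  (forall i, (i < n)%N -> rint P (fun w => `|Y i.+1 w| `^ p)) ->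
  \sum_(0 <= i < n) E (fun w => `|Y i.+1 w| `^ p) <= n%:R * c `^ p ->
  (W2 <= (K0 * (s^-1 * n%:R `^ p^-1 * c + Num.sqrt D1))%:E)%E.
Proof.
move=> /andP[p2 p3] c0 ip hp; have p0 : 0 < p by lra.
have [ip' hp'] := powR_admissible p0 c0 ip hp.
rewrite [s^-1 * _ * c]mulrAC.
apply: (@wasserstein_le_between _ _ _ P n F Y sigma2 _ _ _ _ _ (fun y => y `^ p)) => //.
- by move=> u u0; exact: powR_gt0.
- exact: powR_gt0.
- by rewrite -powRrM mulVf ?gt_eqF// powRr1// ltW.
- move=> u v u0 uv; have v0 := lt_le_trans u0 uv.
  rewrite !powR_divX//; apply: ge0_ler_powR => //; rewrite ?nnegrE ?(ltW u0) ?(ltW v0)//; lra.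
move=> u v u0 uv; have v0 := lt_le_trans u0 uv.
rewrite !powR_divX// -[p - _]opprB !powRN lef_pV2 ?posrE ?powR_gt0//.
apply: ge0_ler_powR => //; rewrite ?nnegrE ?(ltW u0) ?(ltW v0)//; lra.
Qed.

Lemma wasserstein_powR_above p c : 3 < p -> 0 < c ->
  (forall i, (i < n)%N -> rint P (fun w => `|Y i.+1 w| `^ p)) ->
  \sum_(0 <= i < n) E (fun w => `|Y i.+1 w| `^ p) <= n%:R * c `^ p ->
  (W2 <= (2 * K1 1 *
    (n%:R `^ (4^-1 + (2 * p ^+ 2 - 2 * p)^-1) * s^-1 * c + Num.sqrt D1))%:E)%E.
Proof.
move=> p3 c0 ip hp; have p0 : 0 < p by lra.
have [ip' hp'] := powR_admissible p0 c0 ip hp.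
have pp : 0 < p * (p - 1) by apply: mulr_gt0; lra.
have p1 : p - 1 != 0 by rewrite gt_eqF//; lra.
have pn0 : p != 0 by rewrite gt_eqF.
have e0 : 2 * p ^+ 2 - 2 * p = 2 * (p * (p - 1)) by ring.
set e := 4^-1 + _.
have ne0 : 0 <= n%:R `^ e by exact: powR_ge0.
have K10 : 0 < K1 1 by apply: wasserstein_cst_gt0; rewrite mulr_ge0// (le_trans _ (young_cst_ge2 ltr01)).
(* The difference of the exponents is [(p - 2) * (p - 3) / (4 * p * (p - 1))], so the Lyapunov term
   is absorbed by the fourth-root term; this is the origin of the factor 2. *)
have xe : n%:R `^ p^-1 <= n%:R `^ e.
  apply: ler_powR => //; rewrite -subr_ge0 /e e0.
  have -> : 4^-1 + (2 * (p * (p - 1)))^-1 - p^-1 = (p - 2) * (p - 3) / (4 * (p * (p - 1))).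
    by field; rewrite pn0 p1.
  by apply: divr_ge0; apply: mulr_ge0; lra.
(* The solution of [m ^ p = m * x ^+ 2] for [x = n ^ (1 / p)]. As [psi 1 = 1] for every power, the
   constant is independent of [p]. *)
pose m := n%:R `^ (2 / (p * (p - 1))).
have me : (n%:R * m) `^ 4^-1 = n%:R `^ e.
  rewrite /m -{1}(powRr1 (ltW n0)) -powRD ?(gt_eqF n0) ?implybT// -powRrM.
  by congr (_ `^ _); rewrite /e e0; field; rewrite pn0 p1.
have : (W2 <= (K1 (1 `^ p) * (s^-1 * c * n%:R `^ p^-1 + s^-1 * c * (n%:R * m) `^ 4^-1
    + Num.sqrt D1))%:E)%E.
  apply: (@wasserstein_le_above _ _ _ P n F Y sigma2 _ _ _ _ _ (fun y => y `^ p)) => //.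
  - by move=> u u0; exact: powR_gt0.
  - exact: powR_gt0.
  - by rewrite -powRrM mulVf// powRr1// ltW.
  - move=> u v u0 uv; have v0 := lt_le_trans u0 uv.
    rewrite !powR_divX//; apply: ge0_ler_powR => //; rewrite ?nnegrE ?(ltW u0) ?(ltW v0)//; lra.
  - exact: powR_gt0.
  rewrite /m -powR_mulrn ?powR_ge0// -!powRrM -powRD ?(gt_eqF n0) ?implybT//.
  by congr (_ `^ _); field; rewrite pn0 p1.
rewrite powR1 me => /le_trans; apply; rewrite lee_fin [2 * _]mulrC -[leRHS]mulrA ler_pM2l//.
have sc : 0 <= s^-1 * c by rewrite mulr_ge0 ?(ltW sV0) ?(ltW c0).
have := ler_wpM2l sc xe; have := sqrtr_ge0 D1.
have -> : n%:R `^ e * s^-1 * c = s^-1 * c * n%:R `^ e by ring.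
lra.
Qed.

Let moment (p : R) := (\sum_(1 <= i < n.+1) 'E_P[fun w => (`|Y i w| `^ p)%R])%E.

Let moment_le p (k : R) : (moment p <= k%:E)%E ->
  (forall i, (i < n)%N -> rint P (fun w => `|Y i.+1 w| `^ p)) /\
  \sum_(0 <= i < n) E (fun w => `|Y i.+1 w| `^ p) <= k.
Proof.
apply: (@sum_expectation_le _ _ _ P n (fun i w => `|Y i w| `^ p)) => i.
  by apply: (measurableT_comp (measurable_powR p)); exact: measurableT_comp.
by move=> w; exact: powR_ge0.
Qed.

Let moment_ge0 p : (0 <= moment p)%E.
Proof.
by apply: sume_ge0 => i _; rewrite unlock; apply: integral_ge0 => w _; rewrite lee_fin powR_ge0.
Qed.

Let moment_scaled_le p (r c : R) : 0 < p -> 0 <= r -> 0 < c -> (n%:R^-1 * r) `^ p^-1 <= c ->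
  r <= n%:R * c `^ p.
Proof.
move=> p0 r0 c0 rc; rewrite -ler_pdivrMl//.
have nr : 0 <= n%:R^-1 * r by rewrite mulr_ge0// invr_ge0 ltW.
apply: (@le_trans _ _ (((n%:R^-1 * r) `^ p^-1) `^ p)).
  by rewrite -powRrM mulVf ?(lt0r_neq0 p0)// powRr1.
by apply: ge0_ler_powR; rewrite ?nnegrE ?powR_ge0 ?(ltW p0) ?(ltW c0).
Qed.

Lemma wasserstein_lyapunov (C p : R) : K0 <= C -> 2 < p <= 3 ->
  (W2 <= C%:E * (lyapunov n Y p + (Num.sqrt D1)%:E))%E.
Proof.
move=> KC p23; have p0 : 0 < p by case/andP: p23; lra.
have K00 : 0 < K0 by exact: wasserstein_cst_gt0.
rewrite /lyapunov -/(moment p); move: (moment_ge0 p).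
case mE : (moment p) => [r| |] // r0; last first.
  rewrite poweRyr ?invr_neq0 ?gt_eqF// gt0_muley ?lte_fin// addye//.
  by rewrite gt0_muley ?lte_fin ?leey// (lt_le_trans K00).
rewrite lee_fin in r0; have mle : (moment p <= r%:E)%E by rewrite mE.
have [ip hp] := moment_le mle.
(* The limiting scale is [(r / n) ^ (1 / p)]; multiplied by [psi^-1(n) = n ^ (1 / p)] it gives the
   unnormalised sum in the Lyapunov coefficient. *)
apply: (@le_trans _ _ (K0 * (s^-1 * n%:R `^ p^-1 * (n%:R^-1 * r) `^ p^-1 + Num.sqrt D1))%:E).
  apply: le_affine_limit; rewrite ?powR_ge0 ?(ltW K00)//; last first.
    by rewrite mulr_ge0 ?powR_ge0 ?(ltW sV0).
  move=> c c0 rc; apply: wasserstein_powR_between => //.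
  by apply: (le_trans hp); exact: moment_scaled_le.
rewrite -[leRHS]/((C * (s^-1 * r `^ p^-1 + Num.sqrt D1))%:E) lee_fin -mulrA -powRM ?(ltW n0)//; last first.
  by rewrite mulr_ge0// invr_ge0 ltW.
rewrite mulrA divff ?gt_eqF// mul1r ler_wpM2r// addr_ge0// mulr_ge0 ?powR_ge0 ?(ltW sV0)//.
Qed.

Lemma wasserstein_seq_norm (C p : R) : 2 * K1 1 <= C -> 3 < p ->
  (W2 <= C%:E * ((n%:R `^ (4^-1 + (2 * p ^+ 2 - 2 * p)^-1))%:E * (s^-1)%:E
              * seq_norm n Y p + (Num.sqrt D1)%:E))%E.
Proof.
move=> KC p3; have p0 : 0 < p by lra.
have K10 : 0 < K1 1 by apply: wasserstein_cst_gt0; rewrite mulr_ge0// (le_trans _ (young_cst_ge2 ltr01)).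
have K20 : 0 < 2 * K1 1 by rewrite mulr_gt0.
have C0 := lt_le_trans K20 KC.
set e := 4^-1 + _; have ne0 : 0 < n%:R `^ e by exact: powR_gt0.
rewrite /seq_norm -/(moment p); move: (moment_ge0 p).
case mE : (moment p) => [r| |] // r0; last first.
  rewrite gt0_muley ?lte_fin ?invr_gt0// poweRyr ?invr_neq0 ?gt_eqF//.
  by rewrite -EFinM gt0_muley ?lte_fin ?mulr_gt0// addye// gt0_muley ?lte_fin ?leey.
rewrite lee_fin in r0; have mle : (moment p <= r%:E)%E by rewrite mE.
have [ip hp] := moment_le mle.
apply: (@le_trans _ _ (2 * K1 1 * (n%:R `^ e * s^-1 * (n%:R^-1 * r) `^ p^-1 + Num.sqrt D1))%:E).
  apply: le_affine_limit; rewrite ?powR_ge0 ?(ltW K20)//; last first.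
    by rewrite mulr_ge0 ?(ltW ne0) ?(ltW sV0).
  move=> c c0 rc; apply: wasserstein_powR_above => //.
  by apply: (le_trans hp); exact: moment_scaled_le.
rewrite -[leRHS]/((C * (n%:R `^ e * s^-1 * (n%:R^-1 * r) `^ p^-1 + Num.sqrt D1))%:E) lee_fin ler_wpM2r// addr_ge0//.
by rewrite mulr_ge0 ?powR_ge0// mulr_ge0 ?(ltW ne0) ?(ltW sV0).
Qed.

Lemma moment_le_Lnorm_oo (p c : R) i : 0 <= p -> 0 <= c ->
  ('N[P]_+oo[EFin \o Y i] <= c%:E)%E ->
  ('E_P[fun w => (`|Y i w| `^ p)%R] <= (c `^ p)%:E)%E.
Proof.
move=> p0 c0 h.
have /ess_supP hc : (ess_sup P (abse \o (EFin \o Y i)) <= c%:E)%E.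
  have PT : (0 < P setT)%E by rewrite probability_setT lte01.
  by move: h; rewrite unlock ifT//; exact: PT.
rewrite unlock.
have -> : ((c `^ p)%:E = \int[P]_w (c `^ p)%:E)%E.
  by rewrite integral_cst// [X in (_ * X)%E](_ : _ = 1%E) ?mule1//; exact: probability_setT.
apply: ae_ge0_le_integral => //=.
- apply/measurable_EFinP; apply: (measurableT_comp (measurable_powR p)).
  exact: measurableT_comp.
- by move=> w _; rewrite lee_fin powR_ge0.
apply: filterS hc => w /=; rewrite !lee_fin => Yc _.
by apply: ge0_ler_powR.
Qed.

Lemma wasserstein_seq_norm_oo (C : R) : 4 * K1 1 <= C ->
  (W2 <= C%:E * ((n%:R `^ 4^-1)%:E * (s^-1)%:E * seq_norm_oo n Y + (Num.sqrt D1)%:E))%E.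
Proof.
move=> KC.
have K10 : 0 < K1 1 by apply: wasserstein_cst_gt0; rewrite mulr_ge0// (le_trans _ (young_cst_ge2 ltr01)).
have C0 : 0 < C by apply: lt_le_trans KC; rewrite mulr_gt0.
have ne0 : 0 < n%:R `^ 4^-1 :> R by exact: powR_gt0.
have Yo i : (1 <= i <= n)%N -> ('N[P]_+oo[EFin \o Y i] <= seq_norm_oo n Y)%E.
  by move=> hi; rewrite /seq_norm_oo; apply: Order.TotalTheory.le_bigmax_seq; rewrite ?mem_index_iota ?ltnS.
have : (0 <= seq_norm_oo n Y)%E by exact: bigmax_ge_id.
case oE : (seq_norm_oo n Y) Yo => [r| |] Yo // r0; last first.
  by rewrite -EFinM gt0_muley ?lte_fin ?mulr_gt0// addye// gt0_muley ?lte_fin ?leey.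
rewrite lee_fin in r0.
(* The exponent p is so large that [n%:R `^ (2 * p ^+ 2 - 2 * p)^-1 <= 2]. *)
pose p : R := n%:R + 3.
have p3 : 3 < p by rewrite /p ltrDr.
pose e := (2 * p ^+ 2 - 2 * p)^-1.
have ep : n%:R * e <= 1.
  have pp : 0 < p ^+ 2 - p by rewrite subr_gt0 expr2 ltr_pMr; lra.
  rewrite /e ler_pdivrMr ?mul1r; last by lra.
  by rewrite /p in pp *; nra.
have ne2 : n%:R `^ e <= 2.
  have e0 : 0 <= e.
    by rewrite invr_ge0 subr_ge0; nra.
  (* [n <= 2 ^ n] and [n * e <= 1] bound the surplus power of [n] by 2. A single large [p] thus
     replaces the limit and doubles the constant to [4 * K1 1]. *)
  apply: (@le_trans _ _ ((2 ^+ n) `^ e)).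
    apply: ge0_ler_powR; rewrite ?nnegrE ?exprn_ge0//.
    by rewrite -natrX ler_nat ltnW// ltn_expl.
  rewrite -powR_mulrn// -powRrM -[leRHS](powRr1 (ler0n R 2)).
  by apply: ler_powR => //; rewrite ler1n.
apply: (@le_trans _ _ (2 * K1 1 * (n%:R `^ (4^-1 + e) * s^-1 * r + Num.sqrt D1))%:E).
  apply: le_affine_limit; rewrite ?(ltW K10)//; last 2 first.
  - by rewrite mulr_ge0 ?(ltW K10).
  - by rewrite mulr_ge0 ?powR_ge0 ?(ltW sV0).
  move=> c c0 rc.
  have [|ip hp] := @moment_le p (n%:R * c `^ p).
    apply: (@le_trans _ _ (\sum_(1 <= i < n.+1) (c `^ p)%:E)%E).
      rewrite /moment !big_nat; apply: lee_sum => i; rewrite ltnS => hi.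
      apply: moment_le_Lnorm_oo; [lra|exact: ltW|].
      by apply: (le_trans (Yo _ hi)); rewrite lee_fin.
    by rewrite big_add1/= sumEFin sumr_const_nat subn0 mulr_natl.
  exact: wasserstein_powR_above.
rewrite -[leRHS]/((C * (n%:R `^ 4^-1 * s^-1 * r + Num.sqrt D1))%:E) lee_fin powRD; last by rewrite (gt_eqF n0) implybT.
have srt : 0 <= s^-1 * r by rewrite mulr_ge0 ?(ltW sV0).
set A := n%:R `^ 4^-1 in ne0 *; set B := n%:R `^ e in ne2 *; set S := s^-1 * r in srt *.
have hS := sqrtr_ge0 D1; set D := Num.sqrt D1 in hS *.
have -> : A * B * s^-1 * r = B * (A * S) by rewrite /S; ring.
rewrite -[A * s^-1 * r]mulrA -/S.
have AS : 0 <= A * S by apply: mulr_ge0 => //; exact: ltW.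
apply: (@le_trans _ _ (4 * K1 1 * (A * S + D))); last first.
  by apply: ler_wpM2r => //; exact: addr_ge0.
have -> : 4 * K1 1 * (A * S + D) = 2 * K1 1 * (2 * (A * S + D)) by ring.
apply: ler_wpM2l; first by rewrite mulr_ge0// ltW.
have := ler_wpM2r AS ne2; lra.
Qed.

End power_bounds.

Local Open Scope ereal_scope.

Theorem theorem7 (R : realType) :
  exists (C : R) (C_ : R -> R),
  [/\ (0 < C)%R, (forall a : R, (0 < a)%R -> (0 < C_ a)%R) &
  forall (d : measure_display) (T : measurableType d) (P : probability T R)
    (n : nat) (F : nat -> set (set T)) (Y : nat -> {RV P >-> R})
    (sigma2 : nat -> T -> R),
  (1 <= n)%N ->
  martingale_difference n F Y ->
  square_integrable n Y ->
  (forall i, (1 <= i <= n)%N ->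
    is_cond_exp P (F i.-1) (fun w => (Y i w ^+ 2)%R) (sigma2 i)) ->
  (0 < std_sum n Y)%R ->
  let s := std_sum n Y in
  let W2 := wasserstein 2 (distribution P (normalized_sum n Y))
              (normal_prob 0 1) in
  let D := 'N[P]_1[(fun w => (normalized_cond_var n Y sigma2 w - 1)%:E)]
             `^ 2^-1 in
  [/\ (forall psi : R -> R, N_function psi ->
         prec psi (fun x => (x ^+ 3)%R) ->
         convex_function (`[0%R, +oo[ : set R^o) (psi \o Num.sqrt) ->
         W2 <= C%:E * (lyapunov_orlicz n Y psi + D)),
      (forall psi : R -> R, N_function psi ->
         prec (fun x => (x ^+ 3)%R) psi ->
         let g := fun x => (psi x / x)%R in
         W2 <= (C_ (psi 1%R))%:E *
           (lyapunov_orlicz n Y psi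
            + (s^-1)%:E * orlicz_norm n Y psi
              * ((n%:R * ge0_inv g (ge0_inv psi n%:R ^+ 2)) `^ 4^-1)%:E
            + D)),
      (forall p : R, (2 < p <= 3)%R ->
         W2 <= C%:E * (lyapunov n Y p + D)),
      (forall p : R, (3 < p)%R ->
         W2 <= C%:E *
           ((n%:R `^ (4^-1 + (2 * p ^+ 2 - 2 * p)^-1))%:E * (s^-1)%:E
              * seq_norm n Y p + D)) &
      W2 <= C%:E * ((n%:R `^ 4^-1)%:E * (s^-1)%:E * seq_norm_oo n Y + D)]].

Proof.
pose K0 : R := wasserstein_cst 1; pose K1 (a : R) : R := wasserstein_cst (7 * young_cst a).
have K00 : (0 < K0)%R by exact: wasserstein_cst_gt0.
have K10 a : (0 < a)%R -> (0 < K1 a)%R.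
  move=> a0; apply: wasserstein_cst_gt0; apply: mulr_ge0 => //.
  exact: le_trans (young_cst_ge2 a0).
have K11 := K10 1%R ltr01.
exists (K0 + 4 * K1 1)%R, K1; split; [by rewrite addr_gt0// mulr_gt0|exact: K10|].
have h0 : (K0 <= K0 + 4 * K1 1)%R by rewrite lerDl mulr_ge0// ltW.
have h4 : (4 * K1 1 <= K0 + 4 * K1 1)%R by rewrite lerDr ltW.
have h2 : (2 * K1 1 <= K0 + 4 * K1 1)%R by apply: le_trans h4; rewrite ler_pM2r// ler_nat.
move=> d T P n F Y sigma2 n1 mY Y2 sigma2E s0 s W2 D.
have DE := Lnorm_variance_dist sigma2E; rewrite /D DE; split.
- move=> psi Npsi psi3 psi2.
  exact: (wasserstein_orlicz_between n1 mY Y2 sigma2E s0 h0 Npsi psi3 psi2).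
- move=> psi Npsi psi3.
  exact: (wasserstein_orlicz_above n1 mY Y2 sigma2E s0 Npsi psi3).
- by move=> p p23; exact: (wasserstein_lyapunov n1 mY Y2 sigma2E s0 h0 p23).
- by move=> p p3; exact: (wasserstein_seq_norm n1 mY Y2 sigma2E s0 h2 p3).
- exact: (wasserstein_seq_norm_oo n1 mY Y2 sigma2E s0 h4).
Qed.
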